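(* Let $0<a<d$, $0<b\le a/2$, and let $\mu$ be a probability measure on $\mathbb{R}^d$ such that, for constants $A\ge 1$, $B\ge 1$, $$\sup_{\mathrm{rad}(\mathcal{B})\le 1}\frac{\mu(\mathcal{B})}{\mathrm{rad}(\mathcal{B})^a}\le A,\qquad \sup_{|\xi|\ge 1}|\xi|^b|\widehat{\mu}(\xi)|\le B,$$ where the first supremum is over all balls $\mathcal{B}\subset\mathbb{R}^d$ of radius $\mathrm{rad}(\mathcal{B})\le 1$. Let $$p_\circ=\frac{2(d-a+b)}{2(d-a)+b}.$$ Then $$\int|\widehat f|^2\,d\mu\le C^2\,A^{\frac{b}{d-a+b}}\,B^{\frac{d-a}{d-a+b}}\,\|f\|_{L^{p_\circ,2}(\mathbb{R}^d)}^2 ,$$ with a constant $C$ independent of $f$, $\mu$, $A$, $B$. Moreover, if $a,b$ are chosen from a compact interval $I\subset(0,\infty)$, then the constant $C$ depends only on $d$ and $I$.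
   Context: $\widehat f(\xi)=\int f(x)e^{-2\pi i\langle x,\xi\rangle}dx$ and $\widehat\mu(\xi)=\int e^{-2\pi i\langle x,\xi\rangle}d\mu(x)$. $L^{p,s}$ denotes the Lorentz space. As usual for Fourier restriction estimates, the inequality is understood as an a priori estimate, e.g. for $f\in L^1\cap L^{p_\circ,2}$ (where $\widehat f$ is a continuous function), so that the map $f\mapsto\widehat f$ extends to a bounded operator from $L^{p_\circ,2}(\mathbb{R}^d)$ to $L^2(d\mu)$. *)

(* Defs.v *)
From HB Require Import structures.
From mathcomp Require Import all_boot all_order all_algebra.
From mathcomp Require Import complex.
From mathcomp Require Import all_classical all_reals all_analysis.

Set Implicit Arguments.
Unset Strict Implicit.
Unset Printing Implicit Defensive.

Import Order.TTheory GRing.Theory Num.Theory.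
Import numFieldNormedType.Exports.
Import ComplexField.Normc.

Local Open Scope classical_set_scope.
Local Open Scope ring_scope.
Local Open Scope complex_scope.

(* The sigma-algebra on tuples is the product of the Borel sigma-algebras of
   the factors, i.e. the Borel sigma-algebra of R^n. *)
Notation euclidean R n := (n.-tuple (measurableTypeR R)).

Section euclidean_space.
Context {R : realType} {n : nat}.
Implicit Types x y : euclidean R n.

Definition dotp x y : R := \sum_(i < n) tnth x i * tnth y i.

Definition enorm x : R := Num.sqrt (dotp x x).

Definition edist x y : R :=
  Num.sqrt (\sum_(i < n) (tnth x i - tnth y i) ^+ 2).

(* The library's norm and balls on finite products are those of the sup norm;
   these are the Euclidean ones. *)
Definition eball x (r : R) : set (euclidean R n) := [set y | edist x y < r].

End euclidean_space.

Lemma sigma_finite_product d1 d2 (T1 : measurableType d1)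
    (T2 : measurableType d2) (R : realType)
    (m1 : {sigma_finite_measure set T1 -> \bar R})
    (m2 : {sigma_finite_measure set T2 -> \bar R}) :
  sigma_finite setT (m1 \x m2)%E.
Proof.
have /sigma_finiteP[F [TF ndF Foo]] := sigma_finiteT m1.
have /sigma_finiteP[G [TG ndG Goo]] := sigma_finiteT m2.
exists (fun k => F k `*` G k).
  rewrite -setXTT TF TG predeqE => -[x y]; split.
    move=> [/= [k _ Fkx] [l _ Gly]]; exists (maxn k l) => //; split.
    - by move: x Fkx; exact/subsetPset/ndF/leq_maxl.
    - by move: y Gly; exact/subsetPset/ndG/leq_maxr.
  by move=> [k _ []/= ? ?]; split; exists k.
move=> k; have [? ?] := Foo k; have [? ?] := Goo k.
split; first exact: measurableX.
by rewrite product_measure1E// lte_mul_pinfty// ge0_fin_numE.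
Qed.

Section tuple_cons_measure.
Context {R : realType} {n : nat}.
Local Open Scope ereal_scope.
Variable m : {sigma_finite_measure set (euclidean R n) -> \bar R}.

Definition tuple_cons (z : measurableTypeR R * euclidean R n) :
  euclidean R n.+1 := [the n.+1.-tuple _ of z.1 :: z.2].

Let measurable_tuple_cons : measurable_fun setT tuple_cons.
Proof. exact: measurable_cons. Qed.

Let measurable_tuple_uncons :
  measurable_fun setT (fun v : euclidean R n.+1 =>
    (thead v, [tuple of behead v]) : measurableTypeR R * euclidean R n).
Proof.
apply/measurable_fun_pairP; split; first exact: measurable_tnth.
exact: measurable_behead.
Qed.

Definition lebesgue_cons : set (euclidean R n.+1) -> \bar R :=
  pushforward (lebesgue_measure \x m) tuple_cons.

Let lebesgue_cons0 : lebesgue_cons set0 = 0.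
Proof. exact: measure0. Qed.

Let lebesgue_cons_ge0 A : 0 <= lebesgue_cons A.
Proof. exact: measure_ge0. Qed.

Let lebesgue_cons_sigma_additive : semi_sigma_additive lebesgue_cons.
Proof. exact: measure_semi_sigma_additive. Qed.

HB.instance Definition _ := isMeasure.Build _ _ _ lebesgue_cons
  lebesgue_cons0 lebesgue_cons_ge0 lebesgue_cons_sigma_additive.

Let lebesgue_cons_sigma_finite : sigma_finite setT lebesgue_cons.
Proof.
have [F FT Foo] := sigma_finite_product (@lebesgue_measure R) m.
exists (fun i => [set v | F i (thead v, [tuple of behead v])]).
  apply/seteqP; split=> // v _.
  have : setT (thead v, [tuple of behead v]) by [].
  by rewrite FT => -[i _ Fi]; exists i.
move=> i; have [mF Flt] := Foo i; split.
  rewrite -[X in measurable X]setTI; exact: measurable_tuple_uncons.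
suff -> : lebesgue_cons [set v | F i (thead v, [tuple of behead v])] =
          (lebesgue_measure \x m) (F i) by [].
congr (_ \x _)%E; apply/funext => -[x v] /=; congr (F i (_, _)).
exact/val_inj.
Qed.

HB.instance Definition _ := Measure_isSigmaFinite.Build _ _ _ lebesgue_cons
  lebesgue_cons_sigma_finite.

End tuple_cons_measure.

(* Lebesgue measure on R^n, as the n-fold product of the one of R. *)
Fixpoint lebesgue_euclidean (R : realType) (n : nat) :
    {sigma_finite_measure set (euclidean R n) -> \bar R} :=
  match n with
  | 0 => [the {sigma_finite_measure set _ -> \bar R} of
            \d_([tuple] : euclidean R 0)]
  | m.+1 => [the {sigma_finite_measure set _ -> \bar R} of
            lebesgue_cons (lebesgue_euclidean R m)]
  end.

Lemma lebesgue_euclidean_box (R : realType) n (A : 'I_n -> set (measurableTypeR R)) :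
  (forall i, measurable (A i)) ->
  lebesgue_euclidean R n [set x | forall i, A i (tnth x i)] =
  (\prod_(i < n) lebesgue_measure (A i))%E.
Proof.
elim: n A => [|n IH] A mA.
  rewrite big_ord0 /= diracE mem_set//= => -[]//.
rewrite big_ord_recl -(IH (fun i => A (lift ord0 i)))//=.
rewrite -product_measure1E//=.
  congr (_ \x _)%E; apply/seteqP; split => -[x v] /=.
    move=> h; split; first exact: (h ord0).
    by move=> i; have := h (lift ord0 i); rewrite tnthS.
  move=> [h0 h] i; have [j ->|->//] := unliftP ord0 i.
  by rewrite tnthS.
rewrite (_ : [set _ | _] = \bigcap_(i in [set: 'I_n])
    ((fun x : euclidean R n => tnth x i) @^-1` A (lift ord0 i))).
  apply: fin_bigcap_measurable => // i _.
  rewrite -[X in measurable X]setTI; exact: measurable_tnth.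
by apply/seteqP; split => x /= h i; [move=> _|]; exact: h.
Qed.

Section complex_integral.
Context d {T : measurableType d} {R : realType}.
Variable mu : {measure set T -> \bar R}.
Implicit Type f : T -> R[i].

Definition measurable_complex f : Prop :=
  measurable_fun setT (fun x => complex.Re (f x)) /\
  measurable_fun setT (fun x => complex.Im (f x)).

Definition integrable_complex f : Prop :=
  measurable_complex f /\ (\int[mu]_x (normc (f x))%:E < +oo)%E.

(* Meaningful for [integrable_complex] functions only. *)
Definition integral_complex f : R[i] :=
  (\int[mu]_x complex.Re (f x)) +i* (\int[mu]_x complex.Im (f x)).

End complex_integral.

Section lorentz.
Context d {T : measurableType d} {R : realType}.
Variable mu : {measure set T -> \bar R}.
Implicit Type f : T -> R[i].
Local Open Scope ereal_scope.

Definition distribution_function f (s : R) : \bar R :=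
  mu [set x | (s < normc (f x))%R].

Definition decreasing_rearrangement f (t : R) : \bar R :=
  ereal_inf [set s%:E | s in
    [set s : R | (0 <= s)%R /\ distribution_function f s <= t%:E]].

(* For 0 < p, s < +oo. *)
Definition lorentz_norm (p s : R) f : \bar R :=
  (\int[lebesgue_measure]_(t in `]0%R, +oo[)
     (((t `^ p^-1)%:E * decreasing_rearrangement f t) `^ s * (t^-1)%:E))
  `^ s^-1.

Definition lorentz_space (p s : R) f : Prop :=
  measurable_complex f /\ lorentz_norm p s f < +oo.

End lorentz.

Section fourier.
Context {R : realType} {n : nat}.

Definition expi (t : R) : R[i] := cos t +i* sin t.

Definition fourier_character (xi x : euclidean R n) : R[i] :=
  expi (- (2 * pi * dotp x xi)).

Definition fourier (f : euclidean R n -> R[i]) (xi : euclidean R n) : R[i] :=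
  integral_complex (lebesgue_euclidean R n)
    (fun x => f x * fourier_character xi x).

Definition fourier_measure (mu : {measure set (euclidean R n) -> \bar R})
    (xi : euclidean R n) : R[i] :=
  integral_complex mu (fourier_character xi).

End fourier.

Section restriction.
Context {R : realType} {n : nat}.
Implicit Type mu : probability (euclidean R n) R.

Definition ball_growth (a A : R) mu : Prop :=
  forall (x : euclidean R n) (r : R), 0 < r -> r <= 1 ->
    (mu (eball x r) * ((r `^ a)^-1)%:E <= A%:E)%E.

Definition fourier_decay (b B : R) mu : Prop :=
  forall xi : euclidean R n, 1 <= enorm xi ->
    enorm xi `^ b * normc (fourier_measure mu xi) <= B.

Definition restriction_exponent (a b : R) : R :=
  2 * (n%:R - a + b) / (2 * (n%:R - a) + b).

(* The a priori form, for f in L^1, of the L^{p,2} -> L^2(mu) estimate. *)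
Definition restriction_estimate (a b C : R) : Prop :=
  forall (A B : R) mu, 1 <= A -> 1 <= B ->
    ball_growth a A mu -> fourier_decay b B mu ->
  forall f : euclidean R n -> R[i],
    integrable_complex (lebesgue_euclidean R n) f ->
    lorentz_space (lebesgue_euclidean R n) (restriction_exponent a b) 2 f ->
    (\int[mu]_xi (normc (fourier f xi) ^+ 2)%:E <=
      (C ^+ 2 * A `^ (b / (n%:R - a + b))
              * B `^ ((n%:R - a) / (n%:R - a + b)))%:E
      * (lorentz_norm (lebesgue_euclidean R n)
           (restriction_exponent a b) 2 f) ^+ 2)%E.

End restriction.

Arguments restriction_estimate {R} n a b C.
Arguments restriction_exponent {R} n a b.

(* Main.v *)
(** For a finite measure [nu] and real [f], [g], put [q_nu(f, g)] for the
    integral against [nu] of [C_f C_g + S_f S_g], with [C] and [S] the cosine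
    and sine transforms; it is also the double integral of
    [f(x) g(y) c_nu(x - y)], with [c_nu] the cosine transform of [nu].  At
    scale [1/r], let [Gamma] be the uniform probability on the cube of
    half-side [1/(2dr)].  Expanding [(delta - Gamma)^d] cuts [mu] in two: the
    measures [mu * Gamma^k], [k >= 1], have density at most a multiple of
    [A r^(d-a)], so that Bessel's inequality bounds [q] by the [L^2] norm,
    whereas [mu * (delta - Gamma)^d] has cosine transform at most a multiple
    of [B r^(-b)], because the multiplier [1 - Gamma^] is bounded by
    [min(1, |x|^2 / r^2)] and [b <= 2d].  Hence
      [q_mu(f, f) <= C (A r^(d-a) ||f||_2^2 + B r^(-b) ||f||_1^2)].

    The norm of [L^(p,2)] dominates that of [L^2(w)], where the weight [w(x)]
    is the power [kappa = (d-a)/(d-a+b)] of the measure of the set where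
    [|f| >= |f(x)|].
    The piece [F_k] of [f] where [w] is about [2^k] lives on a set of measure
    [2^(k/kappa)], and a choice of [r] depending on [k] and [l] yields
      [|q_mu(F_k, F_l)| <= C A^(1-kappa) B^kappa 2^(-eps|k-l|)
         (2^k ||F_k||_2^2 + 2^l ||F_l||_2^2)],
    which is summed over [k] and [l].  The gain [eps] depends only on [d] and
    on a lower bound of [b], whence the uniformity of the constant. *)

From HB Require Import structures.
Require Import Defs.
From mathcomp Require Import all_boot all_order all_algebra.
From mathcomp Require Import complex.
From mathcomp Require Import all_classical all_reals all_analysis.
From mathcomp Require Import measurable_realfun.
From mathcomp Require Import ring lra.

Set Implicit Arguments.
Unset Strict Implicit.
Unset Printing Implicit Defensive.

Import Order.TTheory GRing.Theory Num.Theory.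
Import numFieldNormedType.Exports.
Import ComplexField.Normc.
Local Open Scope classical_set_scope.
Local Open Scope ring_scope.

(** * Integrals against probability measures *)

Section bounded_integrands.
Context d (T : measurableType d) (R : realType).

(** Estimating both parts of the cut by norms alone gives no gain in |k - l|. Take blocks f, g at
    levels x >= y and a radius with A r^(d-a) = Lam 2^m, where Lam = A^(1-kappa) B^kappa. Relative
    to Lam (2^x ||f||_2^2 2^y ||g||_2^2)^(1/2), the low part (the measures mu * Gamma^k) has size
    2^(m - (x+y)/2) and the high part (the remainder) has size 2^(-(m - (x+y)/2) b/(d-a)): what one
    gains the other loses. The way out is that each mu * Gamma^k is an average of translates of mu,
    so that the low energy of g is bounded, at every radius, by the full energy of g against
    translates of mu, which is estimated at the radius belonging to g itself. Then every m strictly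
    between (x+y)/2 and x is profitable for both parts. This is why the hypotheses on mu are kept in
    a translation invariant form. The power d of delta - Gamma is there because a single factor
    would only reach b <= 2. *)

Lemma integrable_mul_bounded (m : {measure set T -> \bar R}) (f h : T -> R)
    (M : R) :
  m.-integrable setT (EFin \o f) -> measurable_fun setT h ->
  (forall x, `|h x| <= M) ->
  m.-integrable setT (EFin \o (fun x => f x * h x)).
Proof.
move=> intf mh hM.
have mf : measurable_fun setT f by apply/measurable_EFinP/measurable_int/intf.
apply: (@le_integrable _ _ _ _ _ measurableT _ (fun x => (M%:E * (f x)%:E)%E)).
- by apply/measurable_EFinP; exact: measurable_funM.
- move=> x _ /=; rewrite lee_fin !normrM mulrC ler_wpM2r//.
  by rewrite (le_trans (hM x))// ler_norm.
- exact: (integrableZl measurableT M intf).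
Qed.

Lemma normr_Rintegral_mul_bounded (m : {measure set T -> \bar R})
    (f h : T -> R) (M : R) :
  m.-integrable setT (EFin \o f) -> measurable_fun setT h ->
  (forall x, `|h x| <= M) ->
  `|\int[m]_x (f x * h x)| <= M * \int[m]_x `|f x|.
Proof.
move=> intf mh hM; have intfh := integrable_mul_bounded intf mh hM.
apply: (le_trans (le_normr_Rintegral _ intfh)) => //.
have intaf : m.-integrable setT (EFin \o (fun x => `|f x|)).
  exact: integrable_norm.
rewrite -RintegralZl//; apply: le_Rintegral => //.
- exact: (integrable_norm intfh).
- exact: (integrableZl measurableT M intaf).
- by move=> x _; rewrite normrM mulrC ler_wpM2r.
Qed.

Lemma probability_integrable (P : probability T R) (h : T -> R) (M : R) :
  measurable_fun setT h -> (forall x, `|h x| <= M) ->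
  P.-integrable setT (EFin \o h).
Proof.
move=> mh hM; apply: measurable_bounded_integrable => //.
  by rewrite -ge0_fin_numE// fin_num_measure.
exists M; split; first exact: num_real.
by move=> N MN x _ /=; rewrite (le_trans (hM x))// ltW.
Qed.

Lemma normr_Rintegral_probability (P : probability T R) (h : T -> R) (M : R) :
  measurable_fun setT h -> (forall x, `|h x| <= M) ->
  `|\int[P]_x h x| <= M.
Proof.
move=> mh hM; have inth := probability_integrable P mh hM.
apply: (le_trans (le_normr_Rintegral _ inth)) => //.
have := le_Rintegral measurableT (integrable_norm inth)
  (probability_integrable P (measurable_cst M) (fun=> lexx `|M|)).
have -> : \int[P]_x cst M x = M.
  by rewrite Rintegral_cst//= probability_setT mulr1.
by apply => x _; exact: hM.
Qed.

Lemma EFin_Rintegral (m : {measure set T -> \bar R}) (h : T -> R) :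
  m.-integrable setT (EFin \o h) ->
  (\int[m]_x h x)%:E = (\int[m]_x (h x)%:E)%E.
Proof. by move=> ih; rewrite fineK// integrable_fin_num. Qed.

End bounded_integrands.

Section parameter_integrals.
Context d1 d2 (T1 : measurableType d1) (T2 : measurableType d2) (R : realType).
Variables (P : probability T1 R) (m : {sigma_finite_measure set T2 -> \bar R}).
Variables (f : T2 -> R) (K : T1 -> T2 -> R) (M : R).
Hypothesis intf : m.-integrable setT (EFin \o f).
Hypothesis mK : measurable_fun setT (fun z : T1 * T2 => K z.1 z.2).
Hypothesis KM : forall x y, `|K x y| <= M.

Let mf : measurable_fun setT f.
Proof. by apply/measurable_EFinP/measurable_int/intf. Qed.

Let mK1 x : measurable_fun setT (K x).
Proof. by have := measurableT_comp mK (pair1_measurable x). Qed.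

Let mK2 y : measurable_fun setT (K ^~ y).
Proof. by have := measurableT_comp mK (pair2_measurable y). Qed.

Let mfK : measurable_fun setT (fun z : T1 * T2 => f z.2 * K z.1 z.2).
Proof. by apply: measurable_funM => //; exact: measurableT_comp. Qed.

Let integrable_prod_bounded : (P \x m)%E.-integrable setT
  (EFin \o (fun z : T1 * T2 => f z.2 * K z.1 z.2)).
Proof.
apply/integrable12ltyP; first exact/measurable_EFinP.
apply: (@le_lt_trans _ _ (\int[P]_x cst (`|M|%:E * \int[m]_y `|(f y)%:E|) x)%E).
  apply: ge0_le_integral => //.
  - by move=> x _; exact: integral_ge0.
  - apply: (measurable_fun_fubini_tonelli_F
        (fun z : T1 * T2 => `|(f z.2 * K z.1 z.2)%:E|%E)) => //.
    exact/measurableT_comp/measurable_EFinP.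
  - move=> x _; rewrite -ge0_integralZl//=.
    + apply: ge0_le_integral => //.
      * by apply/measurable_EFinP/measurableT_comp => //;
        exact: measurable_funM.
      * by apply: measurable_funeM; apply/measurable_EFinP/measurableT_comp.
      * move=> y _; rewrite -EFinM lee_fin normrM mulrC ler_wpM2r//.
        by rewrite (le_trans (KM _ _))// ler_norm.
    + by apply/measurable_EFinP/measurableT_comp.
rewrite integral_cst// [X in (_ * X)%E](_ : _ = 1%E) ?mule1; last first.
  exact: probability_setT.
move/integrableP : intf => [_ /=].
have -> : (\int[m]_x `|(f x)%:E| = \int[m]_x `|f x|%:E)%E by [].
by rewrite -ge0_fin_numE ?integral_ge0// => If;
  rewrite lte_mul_pinfty// -?ge0_fin_numE ?integral_ge0//.
Qed.

(** Joint integrability on [P \x m] yields measurability in the parameter. Where the parameter space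
    carries no natural measure, a Dirac mass is passed as [P]. *)
Lemma measurable_Rintegral_parameter :
  measurable_fun setT (fun x => \int[m]_y (f y * K x y)).
Proof.
apply: (measurableT_comp (f := fine)) => //.
exact: (measurable_fubini_F integrable_prod_bounded).
Qed.

Lemma Rintegral_swap :
  \int[P]_x \int[m]_y (f y * K x y) = \int[m]_y (f y * \int[P]_x K x y).
Proof.
have := Fubini integrable_prod_bounded => /= FK.
rewrite /Rintegral.
transitivity (fine (\int[P]_x \int[m]_y (f y * K x y)%:E))%E.
  congr fine; apply: eq_integral => x _; rewrite -/(Rintegral _ _ _).
  by rewrite EFin_Rintegral//; exact: (integrable_mul_bounded intf (mK1 x)).
rewrite FK; congr fine; apply: eq_integral => y _.
rewrite -/(Rintegral _ _ _).
have iK := probability_integrable P (mK2 y) (KM ^~ y).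
by rewrite EFinM EFin_Rintegral// -integralZl.
Qed.

End parameter_integrals.

Section image_of_product.
Context d1 d2 d3 (T1 : measurableType d1) (T2 : measurableType d2)
  (T3 : measurableType d3) (R : realType).
Variables (P1 : probability T1 R) (P2 : probability T2 R).
Variable f : {mfun (T1 * T2)%type >-> T3}.

(** Serves twice: with [tadd_pair] it is convolution, with [tuple_cons] it builds the uniform
    probability of a cube one coordinate at a time. *)
Definition prob_image2 : set T3 -> \bar R := pushforward (P1 \x P2)%E f.

Let prob_image2_0 : prob_image2 set0 = 0%E. Proof. exact: measure0. Qed.

Let prob_image2_ge0 A : (0 <= prob_image2 A)%E. Proof. exact: measure_ge0. Qed.

Let prob_image2_sigma_additive : semi_sigma_additive prob_image2.
Proof. exact: measure_semi_sigma_additive. Qed.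

HB.instance Definition _ := isMeasure.Build _ _ _ prob_image2
  prob_image2_0 prob_image2_ge0 prob_image2_sigma_additive.

Let prod_setT : (P1 \x P2)%E setT = 1%E.
Proof.
rewrite -setXTT [LHS]product_measure1E// -[RHS]mule1.
by congr (_ * _)%E; exact: probability_setT.
Qed.

Let prob_image2_setT : prob_image2 setT = 1%E.
Proof. by rewrite /prob_image2 /pushforward preimage_setT. Qed.

HB.instance Definition _ := Measure_isProbability.Build _ _ _ prob_image2
  prob_image2_setT.

Lemma ge0_integral_prob_image2 (w : T3 -> \bar R) :
  measurable_fun setT w -> (forall x, 0 <= w x)%E ->
  (\int[prob_image2]_z w z = \int[P1]_x \int[P2]_y w (f (x, y)))%E.
Proof.
move=> mw w0.
have mwf : measurable_fun setT (w \o f) by exact: measurableT_comp.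
rewrite ge0_integral_pushforward// preimage_setT.
exact: (fubini_tonelli1 _ mwf (fun z => w0 (f z))).
Qed.

Lemma Rintegral_prob_image2 (h : T3 -> R) (M : R) :
  measurable_fun setT h -> (forall x, `|h x| <= M) ->
  \int[prob_image2]_z h z = \int[P1]_x \int[P2]_y h (f (x, y)).
Proof.
move=> mh hM.
have mhf : measurable_fun setT (h \o f) by exact: measurableT_comp.
have ihf : (P1 \x P2)%E.-integrable setT (EFin \o (h \o f)).
  apply: measurable_bounded_integrable => //.
    by rewrite [X in (X < _)%E](_ : _ = 1%E) ?ltry//; exact: prod_setT.
  exists M; split; first exact: num_real.
  by move=> N MN x _ /=; rewrite (le_trans (hM _))// ltW.
rewrite /Rintegral; transitivity (fine (\int[P1]_x \int[P2]_y (h (f (x,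
  y)))%:E)%E).
  rewrite (@integral_pushforward _ _ _ _ _ f _ _ setT (EFin \o h))//;
    last first.
    exact/measurable_EFinP.
  by rewrite preimage_setT -(integral12_prod_meas1 ihf).
congr fine; apply: eq_integral => x _; rewrite -/(Rintegral _ _ _).
rewrite EFin_Rintegral//; apply: (@probability_integrable _ _ _ _ _ M) => //.
exact: (measurableT_comp mhf (pair1_measurable x)).
Qed.

End image_of_product.

(** * Convolution and Lebesgue measure on R^n *)

Section euclidean_structure.
Context {R : realType} {n : nat}.
Implicit Types x y : euclidean R n.

Definition tadd x y : euclidean R n := [tuple tnth x i + tnth y i | i < n].

Definition tsub x y : euclidean R n := [tuple tnth x i - tnth y i | i < n].

Definition tadd_pair (z : euclidean R n * euclidean R n) := tadd z.1 z.2.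

Lemma measurable_tadd : measurable_fun setT tadd_pair.
Proof.
apply/measurable_fun_tnthP => i.
rewrite (_ : _ \o _ = fun z => tnth z.1 i + tnth z.2 i); last first.
  by apply/funext => z /=; rewrite tnth_mktuple.
apply: measurable_funD.
  exact: (measurableT_comp (measurable_tnth i) measurable_fst).
exact: (measurableT_comp (measurable_tnth i) measurable_snd).
Qed.

Lemma measurable_tsub : measurable_fun setT
  (fun z : euclidean R n * euclidean R n => tsub z.1 z.2).
Proof.
apply/measurable_fun_tnthP => i.
rewrite (_ : _ \o _ = fun z => tnth z.1 i - tnth z.2 i); last first.
  by apply/funext => z /=; rewrite tnth_mktuple.
apply: measurable_funB.
  exact: (measurableT_comp (measurable_tnth i) measurable_fst).
exact: (measurableT_comp (measurable_tnth i) measurable_snd).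
Qed.

HB.instance Definition _ := isMeasurableFun.Build _ _ _ _
  tadd_pair measurable_tadd.

Definition convolution (P Q : probability (euclidean R n) R) :
    probability (euclidean R n) R :=
  prob_image2 P Q tadd_pair.

Lemma measurable_tuple_cons : measurable_fun setT (@tuple_cons R n).
Proof. exact: measurable_cons. Qed.

HB.instance Definition _ := isMeasurableFun.Build _ _ _ _
  (@tuple_cons R n) measurable_tuple_cons.

Lemma measurable_dotp : measurable_fun setT
  (fun z : euclidean R n * euclidean R n => dotp z.1 z.2).
Proof.
apply: measurable_sum => i.
apply: measurable_funM.
  exact: (measurableT_comp (measurable_tnth i) measurable_fst).
exact: (measurableT_comp (measurable_tnth i) measurable_snd).
Qed.

Lemma tsub_add x y : tsub (tadd x y) y = x.
Proof. by apply: eq_from_tnth => i; rewrite !tnth_mktuple addrK. Qed.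

Lemma taddC x y : tadd x y = tadd y x.
Proof. by apply: eq_from_tnth => i; rewrite !tnth_mktuple addrC. Qed.

Lemma tsubE x y : tsub x y = tadd x [tuple - tnth y i | i < n].
Proof. by apply: eq_from_tnth => i; rewrite !tnth_mktuple. Qed.

Lemma dotpDr x y z : dotp x (tadd y z) = dotp x y + dotp x z.
Proof.
rewrite -big_split; apply: eq_bigr => i _ /=.
by rewrite tnth_mktuple mulrDr.
Qed.

Lemma dotpBl x y z : dotp (tsub x y) z = dotp x z - dotp y z.
Proof.
rewrite -sumrN -big_split; apply: eq_bigr => i _ /=.
by rewrite tnth_mktuple mulrBl.
Qed.

Lemma ler_norm_tnth_enorm x i : `|tnth x i| <= enorm x.
Proof.
rewrite -sqrtr_sqr ler_sqrt; last by apply: sumr_ge0 => j _;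
  rewrite -expr2 sqr_ge0.
rewrite /dotp (bigD1 i)//= -expr2 lerDl.
by apply: sumr_ge0 => j _; rewrite -expr2 sqr_ge0.
Qed.

End euclidean_structure.

Lemma tadd_cons (R : realType) n (x : R) (v : euclidean R n)
    (y : euclidean R n.+1) :
  tadd (tuple_cons (x, v)) y =
  tuple_cons (x + thead y, tadd v [tuple of behead y]).
Proof.
apply: eq_from_tnth => i; rewrite tnth_mktuple.
have [j ->|->] := unliftP ord0 i; last by rewrite [in RHS]/tnth.
rewrite !tnthS tnth_mktuple; congr (_ + _).
by rewrite [in LHS](tuple_eta y) tnthS.
Qed.

Lemma dotp_cons (R : realType) n (x y : R) (v w : euclidean R n) :
  dotp (tuple_cons (x, v)) (tuple_cons (y, w)) = x * y + dotp v w.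
Proof.
by rewrite /dotp big_ord_recl; congr (_ + _); apply: eq_bigr => i _;
  rewrite !tnthS.
Qed.

Lemma tuple_consE (R : realType) n (y : euclidean R n.+1) :
  y = tuple_cons (thead y, [tuple of behead y]).
Proof. by rewrite [LHS]tuple_eta. Qed.

Section lebesgue_euclidean_theory.
Context {R : realType}.
Local Notation leb := (lebesgue_euclidean R).
Local Notation mu := (@lebesgue_measure R).

Lemma ge0_integral_lebesgue_euclideanS n (w : euclidean R n.+1 -> \bar R) :
  measurable_fun setT w -> (forall x, 0 <= w x)%E ->
  (\int[leb n.+1]_z w z = \int[mu]_x \int[leb n]_v w (tuple_cons (x, v)))%E.
Proof.
move=> mw w0; rewrite [LHS]ge0_integral_pushforward// preimage_setT.
have mwc : measurable_fun setT (w \o @tuple_cons R n).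
  by apply: measurableT_comp => //; exact: measurable_tuple_cons.
exact: (fubini_tonelli1 _ mwc (fun z => w0 (tuple_cons z))).
Qed.

Lemma integral_lebesgue_euclidean0 (w : euclidean R 0 -> \bar R) :
  measurable_fun setT w -> (\int[leb 0]_z w z = w [tuple])%E.
Proof. by move=> mw; rewrite integral_dirac// diracT mul1e. Qed.

(** The image of Lebesgue measure under the translation agrees with it on half-open intervals, which
    determine it. *)
Lemma lebesgue_measure_translation (t : R) (w : measurableTypeR R -> \bar R) :
  measurable_fun setT w -> (forall x, 0 <= w x)%E ->
  (\int[mu]_x w (x + t)%R = \int[mu]_x w x)%E.
Proof.
move=> mw w0; pose phi (x : measurableTypeR R) : measurableTypeR R := x + t.
have mphi : measurable_fun setT phi by exact: measurable_funD.
have := @ge0_integral_pushforward _ _ _ _ _ phi mphi mu setT w.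
rewrite preimage_setT => <-//.
apply: eq_measure_integral => A mA _ /=; apply/esym/lebesgue_measure_unique =>
  //.
move=> _ [[a b]] _ <- /=.
have e : phi @^-1` [set` `]a, b]] = [set` `]a - t, b - t]].
  by apply/seteqP; split => x /=; rewrite !in_itv/= ltrBlDr lerBrDr.
by rewrite /pushforward e !lebesgue_measure_itv/= !lte_fin ltrD2r -!EFinD;
  case: ifPn => // _;
  congr EFin; ring.
Qed.

Lemma lebesgue_euclidean_translation n (y : euclidean R n)
    (w : euclidean R n -> \bar R) :
  measurable_fun setT w -> (forall x, 0 <= w x)%E ->
  (\int[leb n]_x w (tadd x y) = \int[leb n]_x w x)%E.
Proof.
elim: n y w => [|n IH] y w mw w0.
  rewrite !integral_lebesgue_euclidean0//; last first.
    apply: measurableT_comp => //.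
    exact: (measurableT_comp measurable_tadd (pair2_measurable y)).
  by rewrite (tuple0 (tadd _ _)).
have mwc : measurable_fun setT (w \o @tuple_cons R n).
  by apply: measurableT_comp => //; exact: measurable_tuple_cons.
rewrite !ge0_integral_lebesgue_euclideanS//; last first.
  apply: measurableT_comp => //.
  exact: (measurableT_comp measurable_tadd (pair2_measurable y)).
under eq_integral => x _.
  under eq_integral => v _ do rewrite tadd_cons.
  rewrite (IH _ (fun v => w (tuple_cons (x + thead y, v))))//; last first.
    exact: (measurableT_comp mwc (pair1_measurable (x + thead y))).
  over.
rewrite /= (lebesgue_measure_translation (thead y)
  (w := fun x => (\int[leb n]_v w (tuple_cons (x, v)))%E))//.
- by apply: (measurable_fun_fubini_tonelli_F (w \o @tuple_cons R n)) => // z /=.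
- by move=> x; exact: integral_ge0.
Qed.

End lebesgue_euclidean_theory.

(** * Uniform probabilities on cubes *)

Section sinc.
Context {R : realType}.
Implicit Types s t x y : R.
Local Notation mu := (@lebesgue_measure R).

Definition sinc s : R := if s == 0 then 1 else sin s / s.

Lemma measurable_cos_comp d (T : measurableType d) (f : T -> R) :
  measurable_fun setT f -> measurable_fun setT (fun x : T => cos (f x) : R).
Proof.
move=> mf; apply: (measurableT_comp _ mf).
by apply: continuous_measurable_fun; exact: continuous_cos.
Qed.

Lemma measurable_sin_comp d (T : measurableType d) (f : T -> R) :
  measurable_fun setT f -> measurable_fun setT (fun x : T => sin (f x) : R).
Proof.
move=> mf; apply: (measurableT_comp _ mf).
by apply: continuous_measurable_fun; exact: continuous_sin.
Qed.

Lemma is_derive_sin_affine (theta y t : R) : y != 0 ->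
  is_derive t (1 : R) (fun t => t + sin (theta + y * t) / y) (1 + cos (theta +
    y * t)).
Proof.
move=> y0.
have d1 : is_derive t (1:R) (fun t => theta + y * t) y.
  have H := is_deriveD (is_derive_cst theta t (1 : R))
    (is_deriveZ y (is_derive_id t (1 : R))).
  by apply: (is_derive_eq H); rewrite add0r /GRing.scale/= mulr1.
have d2 := @is_derive1_comp _ sin (fun t =>
  theta + y * t) t _ _ (is_derive_sin _) d1.
have -> : (fun t => t + sin (theta + y * t) / y) =
    (fun t => t) + y^-1 *: (sin \o (fun t => theta + y * t)).
  by apply/funext => u /=; congr (_ + _); exact: mulrC.
have H := is_deriveD (is_derive_id t (1 : R)) (is_deriveZ y^-1 d2).
by apply: (is_derive_eq H); rewrite /GRing.scale/=; field.
Qed.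

(** The sine part of the addition formula integrates to 0 by symmetry. The phase [theta] is what
    lets the induction over coordinates in [Rintegral_cube_prob_cos] close: the other coordinates
    enter through it. *)
Lemma Rintegral_uniform_cos (delta : R) (h : - delta < delta) (theta y : R) :
  \int[uniform_prob h]_t cos (theta + y * t) = cos theta * sinc (delta * y).
Proof.
have d0 : 0 < delta by move: h; lra.
have [->|y0] := eqVneq y 0.
  rewrite mulr0 /sinc eqxx mulr1.
  under eq_Rintegral => t _ do rewrite mul0r addr0.
  by rewrite Rintegral_cst//= (@probability_setT _ _ _ (uniform_prob h)) mulr1.
rewrite /sinc mulf_eq0 (negbTE y0) orbF gt_eqF//.
have mc : measurable_fun setT (fun t : measurableTypeR R =>
  cos (theta + y * t)).
  by apply: measurable_cos_comp; apply: measurable_funD => //;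
    exact: measurable_funM.
have ic : (uniform_prob h).-integrable setT (EFin \o (fun t =>
  cos (theta + y * t))).
  by apply: (@probability_integrable _ _ _ _ _ 1) => // t;
    rewrite ler_norml cos_geN1 cos_le1.
have cc : continuous (fun t : R => 1 + cos (theta + y * t)).
  move=> t; apply: cvgD; first exact: cvg_cst.
  apply: (@continuous_comp _ _ _ (fun t : R => theta + y * t) cos).
    by apply: cvgD; [exact: cvg_cst|exact: mulrl_continuous].
  exact: continuous_cos.
have m1 : measurable_fun setT
    (EFin \o (fun t : measurableTypeR R => 1 + cos (theta + y * t))).
  by apply/measurable_EFinP; exact: measurable_funD.
(* The added 1 makes the integrand nonnegative, so that the integral against [uniform_prob] turns
   into one over the interval; it is cancelled at the end. *)
have : \int[uniform_prob h]_t (1 + cos (theta + y * t)) =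
    1 + cos theta * (sin (delta * y) / (delta * y)).
  rewrite /Rintegral integral_uniform//=.
  have dF t : is_derive t (1 : R) (fun t => t + sin (theta + y * t) / y)
    (1 + cos (theta + y * t)) by exact: is_derive_sin_affine.
  have cF : continuous (fun t : R => t + sin (theta + y * t) / y).
    move=> t; apply: differentiable_continuous.
    by apply/derivable1_diffP; exact: ex_derive.
  rewrite (@continuous_FTC2 _ _ (fun t => t + sin (theta + y * t) / y))//.
  - rewrite -EFinD -EFinM /= mulrN sinD sinD cosN sinN.
    rewrite (mulrC delta y); field.
    by apply/and3P; split=> //; rewrite gt_eqF//; lra.
  - by apply: continuous_in_subspaceT => t _; exact: cc.
  - split.
    + by move=> t _; exact: ex_derive.
    + exact: (cvg_at_right_filter (cF (- delta))).
    + exact: (cvg_at_left_filter (cF delta)).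
  - by move=> t _; rewrite derive1E; exact: derive_val.
rewrite RintegralD//; last first.
  by apply: (@probability_integrable _ _ _ _ _ 1) => // t; rewrite normr1.
rewrite Rintegral_cst//= (@probability_setT _ _ _ (uniform_prob h)) mulr1.
exact: addrI.
Qed.

(** [sinc s] is the mean of cos (s t) over t in [-1, 1]. *)
Lemma normr_sinc_le1 s : `|sinc s| <= 1.
Proof.
have h : (- 1 : R) < 1 by lra.
have := Rintegral_uniform_cos h 0 s; rewrite cos0 !mul1r => <-.
apply: normr_Rintegral_probability.
  by apply: measurable_cos_comp; apply: measurable_funD => //;
    exact: measurable_funM.
by move=> t; rewrite ler_norml cos_geN1 cos_le1.
Qed.

Lemma normr_mul_sinc_le1 s : `|s * sinc s| <= 1.
Proof.
rewrite /sinc; have [->|s0] := eqVneq s 0; first by rewrite mul0r normr0.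
by rewrite mulrC divfK// sin_max.
Qed.

(** One [sinc] is not absolutely integrable, but a product of two decays like s^(-2). Such a product
    is one coordinate factor of the transform of the convolution of the cubes of half-sides N and
    2N, and the bound by a Cauchy kernel makes that transform fit for Schur's test. *)
Lemma normr_sinc_mul_sinc_double s :
  `|sinc s * sinc (2 * s)| <= 2 * (1 + s ^+ 2)^-1.
Proof.
rewrite ler_pdivlMr; last by have := sqr_ge0 s; lra.
have h1 := normr_sinc_le1 s; have h2 := normr_sinc_le1 (2 * s).
have h3 := normr_mul_sinc_le1 s; have h4 := normr_mul_sinc_le1 (2 * s).
have e : s ^+ 2 = `|s| ^+ 2 by rewrite real_normK// num_real.
move: h3 h4; rewrite !normrM e.
rewrite (_ : `|2| = 2 :> R); last by rewrite normr_nat.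
set a := `|sinc s| in h1 *; set b := `|sinc (2 * s)| in h2 *; set u := `|s|.
have [a0 b0 u0] : [/\ 0 <= a, 0 <= b & 0 <= u] by split; exact: normr_ge0.
move=> h3 h4.
have h5 : a * b <= 1 by rewrite mulr_ile1.
have h6 : (u * a) * (2 * u * b) <= 1 by rewrite mulr_ile1// !mulr_ge0.
nra.
Qed.

Lemma integral_invr_oneDsqr_scale (c : R) : 0 < c ->
  (\int[mu]_x (((1 + (c * x) ^+ 2)^-1)%:E) = (pi / c)%:E)%E.
Proof.
move=> c0.
have pos x : 0 < 1 + (c * x) ^+ 2 by have := sqr_ge0 (c * x); lra.
have cont : continuous (fun x : R => (1 + (c * x) ^+ 2)^-1).
  move=> x; apply: cvgV; first by rewrite gt_eqF.
  apply: cvgD; first exact: cvg_cst.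
  by apply: cvgM; exact: mulrl_continuous.
rewrite (@ge0_symfun_integralT _ (fun x => (1 + (c * x) ^+ 2)^-1))//;
  last 2 first.
- by move=> x; rewrite invr_ge0 ltW.
- by move=> x /=; rewrite mulrN sqrrN.
have -> : [set x : R | 0 <= x] = `[0, +oo[%classic.
  by apply/seteqP; split => x /=; rewrite in_itv/= andbT.
have dF x : is_derive x (1 : R) (fun x =>
  c^-1 * atan (c * x)) (1 + (c * x) ^+ 2)^-1.
  have d1 : is_derive x (1:R) (fun t => c * t) c.
    apply: (is_derive_eq (is_deriveZ c (is_derive_id x (1 : R)))).
    by rewrite /GRing.scale/= mulr1.
  have d2 := is_derive1_comp (is_derive1_atan (c * x)) d1.
  apply: (is_derive_eq (is_deriveZ c^-1 d2)).
  by rewrite /GRing.scale/= mulrCA mulVf ?mulr1// gt_eqF.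
rewrite (@ge0_continuous_FTC2y _ _ (fun x =>
  c^-1 * atan (c * x)) 0 (c^-1 * (pi / 2))).
- rewrite mulr0 atan0 mulr0 sube0 -EFinM; congr EFin; field.
  by rewrite gt_eqF.
- by move=> x _; rewrite invr_ge0 ltW.
- by apply: continuous_in_subspaceT => x _; exact: cont.
- apply: cvgM; first exact: cvg_cst.
  apply: (@cvg_comp _ _ _ (fun x => c * x) atan _ _ _ _ (@cvgy_atan R)).
  by apply: gt0_cvgMry => //; exact: cvg_id.
- by move=> x _; exact: ex_derive.
- have h : {for 0, continuous (fun x => c^-1 * atan (c * x))}.
    apply: differentiable_continuous.
    by apply/derivable1_diffP; exact: ex_derive.
  exact: (cvg_at_right_filter h).
- by move=> x _; rewrite derive1E; exact: derive_val.
Qed.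

End sinc.

Definition cube {R : realType} (n : nat) (delta : R) : set (euclidean R n) :=
  [set x | forall i, `|tnth x i| <= delta].

Arguments cube {R} n delta _.

Section cubes.
Context {R : realType}.
Implicit Types delta : R.
Local Notation leb := (lebesgue_euclidean R).
Local Notation mu := (@lebesgue_measure R).

Lemma measurable_cube n delta : measurable (cube n delta).
Proof.
rewrite (_ : cube n delta = \bigcap_(i in [set: 'I_n])
    ((fun x : euclidean R n => tnth x i) @^-1` `[- delta, delta])).
  apply: fin_bigcap_measurable => // i _.
  by rewrite -[X in measurable X]setTI; exact: measurable_tnth.
by apply/seteqP; split => x /= h i; [move=> _|]; have := h i;
  rewrite /= in_itv/= ler_norml// => ->.
Qed.

Lemma indic_cube_cons n delta (x : R) (v : euclidean R n) :
  \1_(cube n.+1 delta) (tuple_cons (x, v)) =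
  \1_(`[- delta, delta]) x * \1_(cube n delta) v :> R.
Proof.
rewrite !indicE -natrM mulnb; congr ((nat_of_bool _)%:R).
apply/idP/andP => [/set_mem h|[/set_mem/= + /set_mem h]].
  split; apply: mem_set; first by rewrite /= in_itv/= -ler_norml;
    exact: (h ord0).
  by move=> i; have := h (lift ord0 i); rewrite tnthS.
rewrite in_itv/= -ler_norml => h0; apply: mem_set => i; have [j ->|->//] :=
  unliftP ord0 i.
by rewrite tnthS; exact: h.
Qed.

Fixpoint cube_prob delta (h : - delta < delta) (n : nat) :
    probability (euclidean R n) R :=
  match n with
  | 0 => [the probability (euclidean R 0) R of \d_([tuple] : euclidean R 0)]
  | m.+1 => [the probability (euclidean R m.+1) R of
      @prob_image2 _ _ _ _ _ _ R (uniform_prob h) (cube_prob h m) (@tuple_cons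
        R m)]
  end.

Lemma ge0_integral_cube_prob delta (h : - delta < delta) n
    (w : euclidean R n -> \bar R) :
  measurable_fun setT w -> (forall x, 0 <= w x)%E ->
  (\int[cube_prob h n]_z w z =
   ((delta - - delta)^-1 ^+ n)%:E *
   \int[leb n]_z (w z * (\1_(cube n delta) z)%:E))%E.
Proof.
have c0 : 0 <= (delta - - delta)^-1 by rewrite invr_ge0 subr_ge0 ltW.
elim: n w => [|n IH] w mw w0.
  rewrite expr0 mul1e integral_lebesgue_euclidean0; last first.
    apply: emeasurable_funM => //; apply/measurable_EFinP.
    by apply: measurable_indic; exact: measurable_cube.
  rewrite /= integral_dirac// diracT mul1e indicE mem_set ?mule1//.
  by case.
have mwc : measurable_fun setT (w \o @tuple_cons R n).
  by apply: measurableT_comp => //; exact: measurable_tuple_cons.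
have mw1 : measurable_fun setT (fun z => (w z * (\1_(cube n.+1 delta) z)%:E)%E).
  apply: emeasurable_funM => //; apply/measurable_EFinP.
  by apply: measurable_indic; exact: measurable_cube.
have w10 (z : euclidean R n.+1) : (0 <= w z * (\1_(cube n.+1 delta) z)%:E)%E.
  by rewrite mule_ge0// lee_fin.
rewrite ge0_integral_lebesgue_euclideanS// ge0_integral_prob_image2//.
pose G (x : measurableTypeR R) :=
  (\int[leb n]_v (w (tuple_cons (x, v)) * (\1_(cube n delta) v)%:E))%E.
have G0 x : (0 <= G x)%E.
  by apply: integral_ge0 => v _; rewrite mule_ge0// lee_fin.
have mw2 : measurable_fun setT (fun z : measurableTypeR R * euclidean R n =>
    (w (tuple_cons z) * (\1_(cube n delta) z.2)%:E)%E).
  apply: emeasurable_funM => //; apply/measurable_EFinP.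
  have mI : measurable_fun setT (\1_(cube n delta) : euclidean R n -> R).
    by apply: measurable_indic; exact: measurable_cube.
  exact: (measurableT_comp mI measurable_snd).
have mG : measurable_fun setT G.
  apply: (measurable_fun_fubini_tonelli_F _ mw2) => z.
  by rewrite mule_ge0// lee_fin.
transitivity (\int[uniform_prob h]_x (((delta - - delta)^-1 ^+ n)%:E * G x))%E.
  apply: eq_integral => x _; rewrite IH//.
  exact: (measurableT_comp mwc (pair1_measurable x)).
rewrite integral_uniform//; last 2 first.
- exact: measurable_funeM.
- by move=> x; rewrite mule_ge0// lee_fin exprn_ge0.
rewrite ge0_integralZl//; last 2 first.
- exact: measurable_funTS.
- by rewrite lee_fin exprn_ge0.
have cS : ((delta - - delta)^-1 ^+ n.+1)%:E =
    ((delta - - delta)^-1%:E * ((delta - - delta)^-1 ^+ n)%:E)%E.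
  by rewrite exprS EFinM.
apply: (etrans (muleA _ _ _)); apply: (f_equal2 mule); first exact/esym/cS.
rewrite integral_mkcond epatch_indic; apply: eq_integral => x _ /=.
rewrite muleC -ge0_integralZl//; last 2 first.
- apply: (measurableT_comp mw2); exact: pair1_measurable.
- by move=> v _; rewrite mule_ge0// lee_fin.
apply: eq_integral => v _.
by rewrite indic_cube_cons EFinM muleCA.
Qed.

(** Allows a pointwise bound to be checked on the cube only: the density already contains the
    indicator, which is idempotent. *)
Lemma cube_prob_support delta (h : - delta < delta) n
    (w : euclidean R n -> \bar R) :
  measurable_fun setT w -> (forall x, 0 <= w x)%E ->
  (\int[cube_prob h n]_z w z =
   \int[cube_prob h n]_z (w z * (\1_(cube n delta) z)%:E))%E.
Proof.
move=> mw w0; rewrite !ge0_integral_cube_prob//.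
- congr (_ * _)%E; apply: eq_integral => z _.
  rewrite indicE; case: (z \in _); last by rewrite !mule0.
  by rewrite !mule1.
- apply: emeasurable_funM => //; apply/measurable_EFinP.
  by apply: measurable_indic; exact: measurable_cube.
- by move=> z; rewrite mule_ge0// lee_fin.
Qed.

Lemma Rintegral_cube_prob_cos delta (h : - delta < delta) n (theta : R)
    (x : euclidean R n) :
  \int[cube_prob h n]_y cos (theta + 2 * pi * dotp x y) =
  cos theta * \prod_(i < n) sinc (delta * (2 * pi * tnth x i)).
Proof.
have mc m (t : R) (z : euclidean R m) :
    measurable_fun setT (fun y => cos (t + 2 * pi * dotp z y)).
  apply: measurable_cos_comp; apply: measurable_funD => //.
  apply: measurable_funM => //.
  exact: (measurableT_comp measurable_dotp (pair1_measurable z)).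
have c1 (t : R) : `|cos t| <= 1 by rewrite ler_norml cos_geN1 cos_le1.
elim: n theta x => [|n IH] theta x.
  rewrite big_ord0 mulr1 /Rintegral /= integral_dirac//; last first.
    by apply/measurable_EFinP; exact: mc.
  by rewrite diracT mul1e /= /dotp big_ord0 mulr0 addr0.
rewrite (Rintegral_prob_image2 _ _ _ (mc _ theta x) (fun=> c1 _)).
rewrite (tuple_consE x).
under eq_Rintegral => s _.
  under eq_Rintegral => v _ do rewrite dotp_cons mulrDr addrA.
  rewrite IH.
  over.
rewrite /= RintegralZr//; last first.
  apply: (@probability_integrable _ _ _ _ _ 1) => //.
  apply: measurable_cos_comp; apply: measurable_funD => //.
  by do 2 apply: measurable_funM => //.
under eq_Rintegral => s _ do rewrite mulrA.
rewrite Rintegral_uniform_cos big_ord_recl [RHS]mulrA; congr (_ * _ * _).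
by apply: eq_bigr => i _; rewrite tnthS.
Qed.

Lemma integral_lebesgue_euclidean_prod n (k : R -> R) (I : R) :
  measurable_fun setT (k : measurableTypeR R -> R) -> (forall x, 0 <= k x) ->
  (\int[mu]_x (k x)%:E = I%:E)%E ->
  (\int[leb n]_z (\prod_(i < n) k (tnth z i))%:E = (I ^+ n)%:E)%E.
Proof.
move=> mk k0 kI.
have mp m : measurable_fun setT
    (fun z : euclidean R m => \prod_(i < m) k (tnth z i)).
  apply: measurable_prod => i _; apply: (measurableT_comp mk).
  exact: measurable_tnth.
elim: n => [|n IH].
  rewrite integral_lebesgue_euclidean0; last first.
    by apply/measurable_EFinP; exact: (mp 0).
  by rewrite big_ord0 expr0.
have p0 m (z : euclidean R m) : 0 <= \prod_(i < m) k (tnth z i).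
  exact: prodr_ge0.
rewrite ge0_integral_lebesgue_euclideanS; last 2 first.
- by apply/measurable_EFinP; exact: mp.
- by move=> z; rewrite lee_fin.
transitivity (\int[mu]_x ((k x)%:E * (I ^+ n)%:E))%E.
  apply: eq_integral => x _; rewrite -IH -ge0_integralZl//; last 3 first.
  - by apply/measurable_EFinP; exact: mp.
  - by move=> v _; rewrite lee_fin.
  - by rewrite lee_fin.
  apply: eq_integral => v _; rewrite big_ord_recl EFinM; congr (_ * _%:E)%E.
  by apply: eq_bigr => i _; rewrite tnthS.
rewrite /= ge0_integralZr//; last 3 first.
- exact/measurable_EFinP.
- by move=> v _; rewrite lee_fin.
- by rewrite lee_fin exprn_ge0// -lee_fin -kI; apply: integral_ge0 => x _;
  rewrite lee_fin.
by rewrite kI -EFinM -exprS.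
Qed.

End cubes.

(** * Cosine and sine transforms, and Bessel's inequality *)

Section real_fourier.
Context {R : realType} {n : nat}.
Local Notation E := (euclidean R n).
Local Notation leb := (lebesgue_euclidean R n).
Implicit Types (f g : E -> R) (P Q : probability E R).

Definition cos_transform f (xi : E) : R :=
  \int[leb]_x (f x * cos (2 * pi * dotp x xi)).

Definition sin_transform f (xi : E) : R :=
  \int[leb]_x (f x * sin (2 * pi * dotp x xi)).

(** For real [f] and [g] this is the real part of the product of the Fourier transform of [f] with
    the conjugate of that of [g]. The whole argument thus stays with real integrals. *)
Definition cross_density f g (xi : E) : R :=
  cos_transform f xi * cos_transform g xi +
  sin_transform f xi * sin_transform g xi.

Definition energy P f g : R := \int[P]_xi cross_density f g xi.

Definition cos_measure P (x : E) : R := \int[P]_xi cos (2 * pi * dotp x xi).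

Definition kernel_form (k : E -> R) f g : R :=
  \int[leb]_x (f x * \int[leb]_y (g y * k (tsub x y))).

Local Notation L1 f := (leb.-integrable setT (EFin \o f)).
Local Notation norm1 f := (\int[leb]_x `|f x|).

Lemma normr_cos_le1 (t : R) : `|cos t| <= 1.
Proof. by rewrite ler_norml cos_geN1 cos_le1. Qed.

Let mdot : measurable_fun setT (fun z : E * E => 2 * pi * dotp z.1 z.2).
Proof. by apply: measurable_funM => //; exact: measurable_dotp. Qed.

Lemma dotpC (x y : E) : dotp x y = dotp y x.
Proof. by apply: eq_bigr => i _; rewrite mulrC. Qed.

Lemma measurable_cos_dotp : measurable_fun setT
  (fun z : E * E => cos (2 * pi * dotp z.1 z.2)).
Proof. exact: measurable_cos_comp. Qed.

Lemma measurable_sin_dotp : measurable_fun setT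
  (fun z : E * E => sin (2 * pi * dotp z.1 z.2)).
Proof. exact: measurable_sin_comp. Qed.

Let mcos1 (x : E) : measurable_fun setT (fun y : E => cos (2 * pi * dotp x y)).
Proof. exact: (measurableT_comp measurable_cos_dotp (pair1_measurable x)). Qed.

Let mcos2 (x : E) : measurable_fun setT (fun y : E => cos (2 * pi * dotp y x)).
Proof. exact: (measurableT_comp measurable_cos_dotp (pair2_measurable x)). Qed.

Let msin2 (x : E) : measurable_fun setT (fun y : E => sin (2 * pi * dotp y x)).
Proof. exact: (measurableT_comp measurable_sin_dotp (pair2_measurable x)). Qed.

Lemma measurable_cos_transform f : L1 f -> measurable_fun setT (cos_transform
  f).
Proof.
move=> f1; apply: (@measurable_Rintegral_parameter _ _ _ _ _
  \d_(point : E) leb f (fun xi x : E => cos (2 * pi * dotp x xi)) 1 f1).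
  rewrite [X in measurable_fun _ X](_ : _ =
    fun z : E * E => cos (2 * pi * dotp z.1 z.2)).
    exact: measurable_cos_dotp.
  by apply/funext => z; rewrite dotpC.
by move=> *; exact: normr_cos_le1.
Qed.

Lemma measurable_sin_transform f : L1 f -> measurable_fun setT (sin_transform
  f).
Proof.
move=> f1; apply: (@measurable_Rintegral_parameter _ _ _ _ _
  \d_(point : E) leb f (fun xi x : E => sin (2 * pi * dotp x xi)) 1 f1).
  rewrite [X in measurable_fun _ X](_ : _ =
    fun z : E * E => sin (2 * pi * dotp z.1 z.2)).
    exact: measurable_sin_dotp.
  by apply/funext => z; rewrite dotpC.
by move=> *; exact: sin_max.
Qed.

Lemma normr_cos_transform f xi : L1 f -> `|cos_transform f xi| <= norm1 f.
Proof.
move=> f1; rewrite -[leRHS]mul1r; apply: normr_Rintegral_mul_bounded => //.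
by move=> *; exact: normr_cos_le1.
Qed.

Lemma normr_sin_transform f xi : L1 f -> `|sin_transform f xi| <= norm1 f.
Proof.
move=> f1; rewrite -[leRHS]mul1r; apply: normr_Rintegral_mul_bounded => //.
by move=> *; exact: sin_max.
Qed.

Lemma measurable_cross_density f g : L1 f -> L1 g ->
  measurable_fun setT (cross_density f g).
Proof.
move=> f1 g1; apply: measurable_funD; apply: measurable_funM.
- exact: (measurable_cos_transform f1).
- exact: (measurable_cos_transform g1).
- exact: (measurable_sin_transform f1).
- exact: (measurable_sin_transform g1).
Qed.

Lemma normr_cross_density f g xi : L1 f -> L1 g ->
  `|cross_density f g xi| <= 2 * (norm1 f * norm1 g).
Proof.
move=> f1 g1; rewrite mulr_natl mulr2n (le_trans (ler_normD _ _))//.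
apply: lerD; rewrite normrM; apply: ler_pM => //.
- exact: (normr_cos_transform xi f1).
- exact: (normr_cos_transform xi g1).
- exact: (normr_sin_transform xi f1).
- exact: (normr_sin_transform xi g1).
Qed.

Lemma measurable_cos_measure P : measurable_fun setT (cos_measure P).
Proof.
have i1 : P.-integrable setT (EFin \o (fun=> 1 : R)).
  by apply: (@probability_integrable _ _ _ _ _ 1) => // x; rewrite normr1.
have := @measurable_Rintegral_parameter _ _ _ _ _ \d_(point : E) P (fun=> 1)
  (fun x xi : E => cos (2 * pi * dotp x xi)) 1 i1 measurable_cos_dotp
  (fun _ _ => normr_cos_le1 _).
congr measurable_fun; apply/funext => x.
by apply: eq_Rintegral => xi _; rewrite mul1r.
Qed.

Lemma normr_cos_measure P x : `|cos_measure P x| <= 1.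
Proof.
apply: normr_Rintegral_probability; first exact: mcos1.
by move=> *; exact: normr_cos_le1.
Qed.

(** The addition formula for cos (u - v), then one exchange of [P] with each of the two Lebesgue
    integrals. *)
Lemma energyE P f g : L1 f -> L1 g ->
  energy P f g = kernel_form (cos_measure P) f g.
Proof.
move=> f1 g1.
(* What multiplies [f x] in the cross density once [g] has been integrated out. It is bounded by a
   multiple of the L^1 norm of [g], so that the first exchange involves [f] alone. *)
pose K (xi x : E) : R := cos (2 * pi * dotp x xi) * cos_transform g xi +
  sin (2 * pi * dotp x xi) * sin_transform g xi.
have mK : measurable_fun setT (fun z : E * E => K z.1 z.2).
  apply: measurable_funD; apply: measurable_funM.
  - rewrite [X in measurable_fun _ X](_ : _ =
      fun z : E * E => cos (2 * pi * dotp z.1 z.2)).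
      exact: measurable_cos_dotp.
    by apply/funext => z; rewrite dotpC.
  - by apply: measurableT_comp => //; exact: measurable_cos_transform.
  - rewrite [X in measurable_fun _ X](_ : _ =
      fun z : E * E => sin (2 * pi * dotp z.1 z.2)).
      exact: measurable_sin_dotp.
    by apply/funext => z; rewrite dotpC.
  - by apply: measurableT_comp => //; exact: measurable_sin_transform.
have KM xi x : `|K xi x| <= 2 * norm1 g.
  rewrite mulr_natl mulr2n (le_trans (ler_normD _ _))//.
  rewrite lerD// normrM -[leRHS]mul1r ler_pM//.
  - exact: normr_cos_le1.
  - exact: normr_cos_transform.
  - exact: sin_max.
  - exact: normr_sin_transform.
have KE xi x : K xi x = \int[leb]_y (g y * cos (2 * pi * dotp (tsub x y) xi)).
  rewrite /K [X in X + _]mulrC [X in _ + X]mulrC.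
  rewrite -!RintegralZr//; last 2 first.
  - by apply: (integrable_mul_bounded (M := 1) g1) => // *; exact: sin_max.
  - by apply: (integrable_mul_bounded (M := 1) g1) => // *;
    exact: normr_cos_le1.
  rewrite -RintegralD//.
  - apply: eq_Rintegral => y _.
    rewrite dotpBl mulrBr cosB; ring.
  - apply: (integrable_mul_bounded (M := `|cos (2 * pi * dotp x xi)|)) => //.
    by apply: (integrable_mul_bounded (M := 1) g1) => // *;
      exact: normr_cos_le1.
  - apply: (integrable_mul_bounded (M := `|sin (2 * pi * dotp x xi)|)) => //.
    by apply: (integrable_mul_bounded (M := 1) g1) => // *; exact: sin_max.
transitivity (\int[P]_xi \int[leb]_x (f x * K xi x)).
  apply: eq_Rintegral => xi _; rewrite /cross_density -!RintegralZr//;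
    last 2 first.
  - by apply: (integrable_mul_bounded (M := 1) f1) => // *; exact: sin_max.
  - by apply: (integrable_mul_bounded (M := 1) f1) => // *;
    exact: normr_cos_le1.
  rewrite -RintegralD//.
  - by apply: eq_Rintegral => x _; rewrite /K; ring.
  - apply: (integrable_mul_bounded (M := `|cos_transform g xi|)) => //.
    by apply: (integrable_mul_bounded (M := 1) f1) => // *;
      exact: normr_cos_le1.
  - apply: (integrable_mul_bounded (M := `|sin_transform g xi|)) => //.
    by apply: (integrable_mul_bounded (M := 1) f1) => // *; exact: sin_max.
rewrite (Rintegral_swap P f1 mK KM); apply: eq_Rintegral => x _; congr (_ * _).
under eq_Rintegral => xi _ do rewrite KE.
apply: (Rintegral_swap (M := 1) P g1).
  rewrite [X in measurable_fun _ X](_ : _ = (fun z : E * E =>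
    cos (2 * pi * dotp z.1 z.2)) \o (fun z : E * E => (tsub x z.2, z.1))).
    apply: (measurableT_comp measurable_cos_dotp).
    apply/measurable_fun_pairP; split => //=.
    exact: (measurableT_comp (measurableT_comp measurable_tsub
      (pair1_measurable x)) measurable_snd).
    exact: measurable_fst.
  by apply/funext => z.
by move=> *; exact: normr_cos_le1.
Qed.

End real_fourier.

Lemma Rintegral_sum d (T : measurableType d) (R : realType)
    (m : {measure set T -> \bar R}) (I : Type) (s : seq I) (F : I -> T -> R) :
  (forall i, m.-integrable setT (EFin \o F i)) ->
  m.-integrable setT (EFin \o (fun x => \sum_(i <- s) F i x)) /\
  \int[m]_x (\sum_(i <- s) F i x) = \sum_(i <- s) \int[m]_x F i x.
Proof.
move=> iF; elim: s => [|i s [IH1 IH2]].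
  rewrite big_nil (_ : (fun x => _) = cst 0); last first.
    by apply/funext => x; rewrite big_nil.
  split; first exact: integrable0.
  by rewrite Rintegral_cst// mul0r.
rewrite big_cons -IH2 -RintegralD//.
have -> : (fun x => \sum_(j <- i :: s) F j x) =
    (fun x => F i x + \sum_(j <- s) F j x).
  by apply/funext => x; rewrite big_cons.
by split=> //; exact: (integrableD measurableT (iF i) IH1).
Qed.

(** * Bilinear forms of bounded kernels and Schur's test *)

Section kernel_forms.
Context {R : realType} {n : nat}.
Local Notation E := (euclidean R n).
Local Notation leb := (lebesgue_euclidean R n).
Implicit Types (f g k : E -> R) (P Q : probability E R).
Local Notation L1 f := (leb.-integrable setT (EFin \o f)).
Local Notation norm1 f := (\int[leb]_x `|f x|).

Lemma measurable_tsub_comp k : measurable_fun setT k ->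
  measurable_fun setT (fun z : E * E => k (tsub z.1 z.2)).
Proof. by move=> mk; exact: (measurableT_comp mk measurable_tsub). Qed.

Lemma measurable_kernel_inner k g M : L1 g -> measurable_fun setT k ->
  (forall z, `|k z| <= M) ->
  measurable_fun setT (fun x => \int[leb]_y (g y * k (tsub x y))).
Proof.
move=> g1 mk kM.
exact: (@measurable_Rintegral_parameter _ _ _ _ _ \d_(point : E) leb g
  (fun x y => k (tsub x y)) M g1 (measurable_tsub_comp mk) (fun _ _ => kM _)).
Qed.

Let msub1 k x : measurable_fun setT k ->
  measurable_fun setT (fun y : E => k (tsub x y)).
Proof.
move=> mk; exact: (measurableT_comp (measurable_tsub_comp mk)
  (pair1_measurable x)).
Qed.

Lemma normr_kernel_inner k g M x : L1 g -> measurable_fun setT k ->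
  (forall z, `|k z| <= M) ->
  `|\int[leb]_y (g y * k (tsub x y))| <= M * norm1 g.
Proof.
by move=> g1 mk kM; apply: normr_Rintegral_mul_bounded => //; exact: msub1.
Qed.

Lemma normr_kernel_form k f g M : L1 f -> L1 g -> measurable_fun setT k ->
  (forall z, `|k z| <= M) ->
  `|kernel_form k f g| <= M * norm1 g * norm1 f.
Proof.
move=> f1 g1 mk kM; apply: normr_Rintegral_mul_bounded => //.
  exact: measurable_kernel_inner kM.
by move=> x; exact: normr_kernel_inner.
Qed.

Lemma kernel_form_sum (I : Type) (s : seq I) (c : I -> R) (k : I -> E -> R)
    (M : R) f g :
  L1 f -> L1 g -> (forall i, measurable_fun setT (k i)) ->
  (forall i z, `|k i z| <= M) ->
  \sum_(i <- s) c i * kernel_form (k i) f g =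
  kernel_form (fun z => \sum_(i <- s) c i * k i z) f g.
Proof.
move=> f1 g1 mk kM.
have ig i x : L1 (fun y => g y * k i (tsub x y)).
  by apply: (integrable_mul_bounded (M := M) g1) => //; exact: msub1.
have igc i x : L1 (fun y => c i * (g y * k i (tsub x y))).
  exact: (integrableZl measurableT (c i) (ig i x)).
have iF i : L1 (fun x => f x * \int[leb]_y (g y * k i (tsub x y))).
  apply: (integrable_mul_bounded (M := M * norm1 g)) => //.
    exact: measurable_kernel_inner (kM i).
  by move=> x; exact: normr_kernel_inner.
have iFc i : L1 (fun x => c i * (f x * \int[leb]_y (g y * k i (tsub x y)))).
  exact: (integrableZl measurableT (c i) (iF i)).
transitivity (\sum_(i <- s) \int[leb]_x
    (c i * (f x * \int[leb]_y (g y * k i (tsub x y))))).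
  by apply: eq_bigr => i _; rewrite RintegralZl.
rewrite -(Rintegral_sum s iFc).2; apply: eq_Rintegral => x _.
transitivity (f x * \sum_(i <- s) \int[leb]_y (c i * (g y * k i (tsub x y)))).
  rewrite mulr_sumr; apply: eq_bigr => i _; rewrite RintegralZl//.
  by rewrite mulrCA.
rewrite -(Rintegral_sum s (fun i => igc i x)).2; congr (_ * _).
apply: eq_Rintegral => y _; rewrite mulr_sumr.
by apply: eq_bigr => i _; rewrite mulrCA.
Qed.

(** Schur's test from the crude bound |f(x) f(y)| <= f(x)^2 + f(y)^2, whence the factor 2.
    Translation invariance gives the integral [I] along columns, and the symmetry of [kap] gives it
    along rows. The right side is an extended real because [f] is only assumed integrable. *)
Lemma schur_kernel_form k kap f M I :
  L1 f -> measurable_fun setT k -> (forall z, `|k z| <= M) ->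
  measurable_fun setT kap -> (forall z, `|k z| <= kap z) ->
  (forall x y, kap (tsub x y) = kap (tsub y x)) ->
  (\int[leb]_z (kap z)%:E = I%:E)%E ->
  ((kernel_form k f f)%:E <= (2 * I)%:E * \int[leb]_x (f x ^+ 2)%:E)%E.
Proof.
move=> f1 mk kM mkap kkap kape kapI.
have kap0 z : 0 <= kap z by rewrite (le_trans _ (kkap z)).
have mf : measurable_fun setT f by apply/measurable_EFinP/measurable_int/f1.
pose h x := \int[leb]_y (f y * k (tsub x y)).
have mh : measurable_fun setT h := measurable_kernel_inner f1 mk kM.
have ifh : L1 (fun x => f x * h x).
  by apply: (integrable_mul_bounded f1 mh) => x;
    exact: (normr_kernel_inner x f1 mk kM).
have mfsq : measurable_fun setT (fun x => (f x ^+ 2)%:E).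
  by apply/measurable_EFinP; exact: measurable_funX.
have fsq0 x : (0 <= (f x ^+ 2)%:E)%E by rewrite lee_fin sqr_ge0.
have mkap2 : measurable_fun setT (fun z : E * E => (kap (tsub z.1 z.2))%:E).
  by apply/measurable_EFinP; exact: (measurable_tsub_comp mkap).
have mA : measurable_fun setT
    (fun z : E * E => ((f z.1 ^+ 2)%:E * (kap (tsub z.1 z.2))%:E)%E).
  by apply: emeasurable_funM => //; exact: (measurableT_comp mfsq
    measurable_fst).
have mB : measurable_fun setT
    (fun z : E * E => ((f z.2 ^+ 2)%:E * (kap (tsub z.1 z.2))%:E)%E).
  by apply: emeasurable_funM => //; exact: (measurableT_comp mfsq
    measurable_snd).
have A0 (x y : E) : (0 <= (f x ^+ 2)%:E * (kap (tsub x y))%:E)%E.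
  by rewrite mule_ge0// lee_fin.
have B0 (x y : E) : (0 <= (f y ^+ 2)%:E * (kap (tsub x y))%:E)%E.
  by rewrite mule_ge0// lee_fin.
have kapT y : (\int[leb]_x (kap (tsub x y))%:E = I%:E)%E.
  rewrite -kapI -(@lebesgue_euclidean_translation _ _ [tuple - tnth y i | i < n]
    (fun z => (kap z)%:E))//.
  - by apply: eq_integral => x _; rewrite tsubE.
  - exact/measurable_EFinP.
have I0 : 0 <= I by rewrite -lee_fin -kapI; apply: integral_ge0 => z _;
  rewrite lee_fin.
apply: (@le_trans _ _ (\int[leb]_x \int[leb]_y
   ((f x ^+ 2)%:E * (kap (tsub x y))%:E + (f y ^+ 2)%:E * (kap (tsub x
     y))%:E))%E).
  apply: (@le_trans _ _ (\int[leb]_x `|f x * h x|%:E)%E).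
    rewrite EFin_Rintegral// (le_trans (lee_abs _))//.
    by apply: (le_trans (le_abse_integral _ _ _)) => //;
      exact/measurable_int/ifh.
  apply: ge0_le_integral => //.
  - apply/measurable_EFinP/measurableT_comp => //.
    exact: measurable_funM.
  - apply: (measurable_fun_fubini_tonelli_F (fun z : E * E =>
      ((f z.1 ^+ 2)%:E * (kap (tsub z.1 z.2))%:E +
       (f z.2 ^+ 2)%:E * (kap (tsub z.1 z.2))%:E)%E)).
      exact: emeasurable_funD.
    by move=> z; rewrite adde_ge0.
  - move=> x _.
    have ifk : L1 (fun y => f y * k (tsub x y)).
      by apply: (integrable_mul_bounded (M := M) f1) => //; exact: msub1.
    have := le_normr_Rintegral measurableT ifk.
    rewrite -/(h x) -lee_fin => hx.
    rewrite normrM EFinM.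
    apply: (@le_trans _ _ (`|f x|%:E * (\int[leb]_y `|f y * k (tsub x
      y)|)%:E)%E).
      by apply: lee_pmul => //; rewrite lee_fin.
    rewrite EFin_Rintegral; last exact: (integrable_norm ifk).
    have mafk : measurable_fun setT (EFin \o (fun y => `|f y * k (tsub x y)|)).
      apply/measurable_EFinP; apply: measurableT_comp => //.
      by apply: measurable_funM => //; exact: msub1.
    rewrite -ge0_integralZl//.
    apply: ge0_le_integral => //.
    + exact: measurable_funeM.
    + apply: emeasurable_funD.
        exact: (measurableT_comp mA (pair1_measurable x)).
      exact: (measurableT_comp mB (pair1_measurable x)).
    + move=> y _; rewrite -!EFinM -EFinD lee_fin normrM -mulrDl mulrA.
      apply: ler_pM => //.
      rewrite -[f x ^+ 2]real_normK ?num_real//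
        -[f y ^+ 2]real_normK ?num_real//.
      have := sqr_ge0 (`|f x| - `|f y|); have := sqr_ge0 `|f x|; have :=
        sqr_ge0 `|f y|.
      nra.
rewrite (_ : (2 * I)%:E = (I%:E + I%:E)%E); last by rewrite -EFinD;
  congr EFin; ring.
rewrite ge0_muleDl ?lee_fin//.
under eq_integral => x _.
  rewrite ge0_integralD//; last 2 first.
  - exact: (measurableT_comp mA (pair1_measurable x)).
  - exact: (measurableT_comp mB (pair1_measurable x)).
  over.
rewrite /= ge0_integralD//; last 4 first.
- by move=> x _; exact: integral_ge0.
- by apply: (measurable_fun_fubini_tonelli_F _ mA) => z.
- by move=> x _; exact: integral_ge0.
- by apply: (measurable_fun_fubini_tonelli_F _ mB) => z.
apply: leeD.
  rewrite -ge0_integralZl// ?lee_fin//.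
  apply: ge0_le_integral => //.
  - by move=> x _; exact: integral_ge0.
  - by apply: (measurable_fun_fubini_tonelli_F _ mA) => z.
  - exact: measurable_funeM.
  - move=> x _; rewrite ge0_integralZl//; last 2 first.
    + exact: (measurableT_comp mkap2 (pair1_measurable x)).
    + by move=> y _; rewrite lee_fin.
    under eq_integral => y _ do rewrite kape.
    by rewrite kapT muleC.
rewrite (fubini_tonelli _ mB)//=.
rewrite -ge0_integralZl// ?lee_fin//.
apply: ge0_le_integral => //.
- by move=> x _; exact: integral_ge0.
- by apply: (measurable_fun_fubini_tonelli_G _ mB) => z.
- exact: measurable_funeM.
- move=> y _; rewrite ge0_integralZl//; last 2 first.
  + exact: (measurableT_comp mkap2 (pair2_measurable y)).
  + by move=> x _; rewrite lee_fin.
  by rewrite kapT muleC.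
Qed.

End kernel_forms.

(** * Bessel's inequality *)

Section bessel.
Context {R : realType} {n : nat}.
Local Notation E := (euclidean R n).
Local Notation leb := (lebesgue_euclidean R n).
Implicit Types (f g : E -> R) (P Q : probability E R).
Local Notation L1 f := (leb.-integrable setT (EFin \o f)).

Definition cube_multiplier (delta : R) (x : E) : R :=
  \prod_(i < n) sinc (delta * (2 * pi * tnth x i)).

Lemma measurable_cos_dotp1 (x : E) :
  measurable_fun setT (fun y : E => cos (2 * pi * dotp x y)).
Proof. exact: (measurableT_comp measurable_cos_dotp (pair1_measurable x)). Qed.

Lemma cos_measure_cube (delta : R) (h : - delta < delta) x :
  cos_measure (cube_prob h n) x = cube_multiplier delta x.
Proof.
rewrite -[RHS]mul1r -cos0 -(Rintegral_cube_prob_cos h).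
by apply: eq_Rintegral => y _; rewrite add0r.
Qed.

Lemma cos_measure_convolution P (delta : R) (h : - delta < delta) x :
  cos_measure (convolution P (cube_prob h n)) x =
  cos_measure P x * cube_multiplier delta x.
Proof.
rewrite /cos_measure (Rintegral_prob_image2 _ _ _ (measurable_cos_dotp1 x)
  (fun=> normr_cos_le1 _)).
rewrite -RintegralZr//.
  apply: eq_Rintegral => xi _; rewrite -Rintegral_cube_prob_cos.
  by apply: eq_Rintegral => eta _; rewrite /tadd_pair/= dotpDr mulrDr.
apply: (@probability_integrable _ _ _ _ _ 1) => //.
  exact: measurable_cos_dotp1.
by move=> *; exact: normr_cos_le1.
Qed.

Lemma ge0_integral_convolution P Q (w : E -> \bar R) :
  measurable_fun setT w -> (forall x, 0 <= w x)%E ->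
  (\int[convolution P Q]_x w x = \int[P]_x \int[Q]_y w (tadd x y))%E.
Proof. by move=> mw w0; rewrite ge0_integral_prob_image2. Qed.

Lemma measurable_tadd1 (w : E -> \bar R) (x : E) : measurable_fun setT w ->
  measurable_fun setT (fun y => w (tadd x y)).
Proof.
move=> mw; apply: (measurableT_comp mw).
exact: (measurableT_comp measurable_tadd (pair1_measurable x)).
Qed.

Lemma measurable_tadd_pair (w : E -> \bar R) : measurable_fun setT w ->
  measurable_fun setT (fun z : E * E => w (tadd z.1 z.2)).
Proof. by move=> mw; exact: (measurableT_comp mw measurable_tadd). Qed.

Lemma cross_density_self_ge0 f xi : 0 <= cross_density f f xi.
Proof. by rewrite addr_ge0// -expr2 sqr_ge0. Qed.

Lemma EFin_energy P f g : L1 f -> L1 g ->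
  (energy P f g)%:E = (\int[P]_xi (cross_density f g xi)%:E)%E.
Proof.
move=> f1 g1; rewrite EFin_Rintegral//.
apply: (@probability_integrable _ _ _ _ _
  (2 * ((\int[leb]_x `|f x|) * (\int[leb]_x `|g x|)))).
  exact: measurable_cross_density.
by move=> x; exact: normr_cross_density.
Qed.

(** If z and a lie in the cube of half-side N, then z - a lies in the cube of half-side 2N, where
    the second probability has constant density (4N)^(-n). Hence the convolution has density at
    least (4N)^(-n) on the smaller cube. *)
Lemma integral_convolution_cube_ge (N : R) (h1 : - N < N)
    (h2 : - (2 * N) < 2 * N) (w : E -> \bar R) :
  measurable_fun setT w -> (forall x, 0 <= w x)%E ->
  (((4 * N)^-1 ^+ n)%:E * \int[leb]_(z in cube n N) w z <=
   \int[convolution (cube_prob h1 n) (cube_prob h2 n)]_z w z)%E.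
Proof.
move=> mw w0; have N0 : 0 < N by move: h1; lra.
set c := (X in (X <= _)%E).
have c0 : (0 <= c)%E.
  by rewrite mule_ge0 ?integral_ge0// lee_fin exprn_ge0// invr_ge0; lra.
rewrite ge0_integral_convolution//.
have mg : measurable_fun setT (fun x => \int[cube_prob h2 n]_y w (tadd x y))%E.
  apply: (measurable_fun_fubini_tonelli_F (fun z : E * E =>
    w (tadd z.1 z.2))) => //.
  exact: measurable_tadd_pair.
have g0 x : (0 <= \int[cube_prob h2 n]_y w (tadd x y))%E by exact: integral_ge0.
rewrite cube_prob_support//.
have <- : (\int[cube_prob h1 n]_z cst c z = c)%E.
  rewrite integral_cst// [X in (_ * X)%E](_ : _ = 1%E) ?mule1//.
  exact: probability_setT.
rewrite cube_prob_support//.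
have mI (delta : R) : measurable_fun setT (EFin \o (\1_(cube n delta) :
  E -> R)).
  by apply/measurable_EFinP; apply: measurable_indic; exact: measurable_cube.
apply: ge0_le_integral => //.
- by move=> x _; rewrite mule_ge0// lee_fin.
- by apply: emeasurable_funM => //; exact: mI.
- by apply: emeasurable_funM => //; exact: mI.
move=> a _; rewrite indicE; have [aN|_] := boolP (a \in cube n N); last first.
  by rewrite !mule0.
rewrite !mule1 /c ge0_integral_cube_prob//; last exact: measurable_tadd1.
rewrite (_ : 2 * N - - (2 * N) = 4 * N); last by ring.
apply: lee_wpmul2l; first by rewrite lee_fin exprn_ge0// invr_ge0; lra.
pose W (z : E) := (w z * (\1_(cube n (2 * N)) (tsub z a))%:E)%E.
have mW : measurable_fun setT W.
  apply: emeasurable_funM => //; apply: (measurableT_comp (mI (2 * N))).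
  exact: (measurableT_comp measurable_tsub (pair2_measurable a)).
have W0 z : (0 <= W z)%E by rewrite mule_ge0// lee_fin.
rewrite [leRHS](_ : _ = \int[leb]_z W (tadd z a))%E; last first.
  by apply: eq_integral => z _; rewrite /W tsub_add taddC.
rewrite lebesgue_euclidean_translation// integral_mkcond epatch_indic.
apply: ge0_le_integral => //.
- by move=> z _; rewrite mule_ge0// lee_fin.
- exact: emeasurable_funM.
move=> z _ /=; apply: lee_wpmul2l => //; rewrite lee_fin !indicE ler_nat.
have [zN|//] := boolP (z \in cube n N).
rewrite (_ : tsub z a \in _)//; apply: mem_set => i; rewrite tnth_mktuple.
move/set_mem : aN => /(_ i) ai; move/set_mem : zN => /(_ i) zi.
by rewrite (le_trans (ler_normB _ _))//; lra.
Qed.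

(** The cosine transform of the convolution is a product over coordinates of values of [sinc] at s
    and 2s. Each factor is dominated by a Cauchy kernel of integral 1/N, and Schur's test
    applies. *)
Lemma energy_convolution_cubes_le (N : R) (h1 : - N < N)
    (h2 : - (2 * N) < 2 * N) f : L1 f ->
  ((energy (convolution (cube_prob h1 n) (cube_prob h2 n)) f f)%:E <=
   (2 * N^-1 ^+ n)%:E * \int[leb]_x (f x ^+ 2)%:E)%E.
Proof.
move=> f1; have N0 : 0 < N by move: h1; lra.
have c0 : 0 < N * (2 * pi) by rewrite mulr_gt0// mulr_gt0// pi_gt0.
pose k1 (x : R) := 2 * (1 + (N * (2 * pi) * x) ^+ 2)^-1.
have k10 x : 0 <= k1 x.
  by rewrite mulr_ge0// invr_ge0 addr_ge0// sqr_ge0.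
have mk0 : measurable_fun setT (fun x : measurableTypeR R =>
  (1 + (N * (2 * pi) * x) ^+ 2)^-1).
  apply: continuous_measurable_fun => x.
  apply: cvgV; first by rewrite gt_eqF// ltr_pwDl// sqr_ge0.
  apply: cvgD; first exact: cvg_cst.
  by apply: cvgM; exact: mulrl_continuous.
have mk1 : measurable_fun setT (k1 : measurableTypeR R -> R) by exact:
  measurable_funM.
have k1I : (\int[lebesgue_measure]_x (k1 x)%:E = (N^-1)%:E)%E.
  rewrite /k1; under eq_integral => x _ do rewrite EFinM.
  rewrite ge0_integralZl//; last 2 first.
  - exact/measurable_EFinP.
  - by move=> x _; rewrite lee_fin invr_ge0 addr_ge0// sqr_ge0.
  have e (p : R) : p != 0 -> 2 * (p / (N * (2 * p))) = N^-1.
    by move=> p0; field; rewrite (gt_eqF N0).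
  by rewrite integral_invr_oneDsqr_scale// -EFinM e// gt_eqF// pi_gt0.
rewrite energyE//.
apply: (@schur_kernel_form _ _ _ (fun z =>
  \prod_(i < n) k1 (tnth z i)) _ 1) => //.
- exact: measurable_cos_measure.
- by move=> z; exact: normr_cos_measure.
- apply: measurable_prod => i _; apply: (measurableT_comp mk1).
  exact: measurable_tnth.
- move=> z; rewrite cos_measure_convolution cos_measure_cube -big_split/=.
  rewrite normr_prod; apply: ler_prod => i _; rewrite normr_ge0/=.
  by rewrite /k1 -!mulrA normr_sinc_mul_sinc_double.
- move=> x y; apply: eq_bigr => i _; rewrite !tnth_mktuple /k1.
  by rewrite -opprB mulrN sqrrN.
- exact: integral_lebesgue_euclidean_prod.
Qed.

(* Plancherel's inequality, the Fejer-type kernels of the large cubes serving as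
   an approximate identity. *)
Lemma bessel_inequality f : L1 f ->
  (\int[leb]_xi (cross_density f f xi)%:E <=
   (2 * 4 ^+ n)%:E * \int[leb]_x (f x ^+ 2)%:E)%E.
Proof.
move=> f1.
have mw : measurable_fun setT (fun xi => (cross_density f f xi)%:E).
  by apply/measurable_EFinP; exact: measurable_cross_density.
have w0 xi : (0 <= (cross_density f f xi)%:E)%E.
  by rewrite lee_fin cross_density_self_ge0.
pose F (N : nat) : set E := cube n N.+1%:R.
have FT : \bigcup_N F N = setT.
  apply/seteqP; split => // x _.
  have [N hN] : exists N : nat, enorm x <= N.+1%:R.
    exists (Num.trunc (enorm x)); apply: ltW; rewrite Num.Theory.truncnS_gt//.
  exists N => // i; exact: (le_trans (ler_norm_tnth_enorm x i)).
have cvgF : (\int[leb]_(x in F N) (cross_density f f x)%:E @[N --> \oo] -->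
   \int[leb]_x (cross_density f f x)%:E)%E.
  rewrite -FT; apply: ge0_nondecreasing_set_cvg_integral => //.
  - move=> N M NM; rewrite subsetEset => x xN i.
    by rewrite (le_trans (xN i))// ler_nat.
  - by move=> N; exact: measurable_cube.
  - by move=> N; exact: measurable_funTS.
rewrite -(cvg_lim _ cvgF)//; apply: lime_le; first by apply/cvg_ex; eexists;
  exact: cvgF.
apply: nearW => N.
have N0 : (0 : R) < N.+1%:R by rewrite ltr0n.
have h1 : - N.+1%:R < N.+1%:R :> R by lra.
have h2 : - (2 * N.+1%:R) < 2 * N.+1%:R :> R by lra.
have := integral_convolution_cube_ge h1 h2 mw w0.
rewrite -EFin_energy// => /le_trans /(_ (energy_convolution_cubes_le h1 h2 f1)).
(* Against the factor N^(-n) of the upper bound, (4N)^n leaves 4^n, which no longer depends on N. *)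
rewrite -(@lee_pmul2l _ ((4 * N.+1%:R) ^+ n)%:E); last 2 first.
- by [].
- by rewrite lte_fin exprn_gt0// mulr_gt0.
rewrite !muleA -!EFinM -exprMn divff ?expr1n ?mul1e; last by rewrite gt_eqF//
  mulr_gt0.
move=> /le_trans; apply; apply: lee_wpmul2r; first by apply: integral_ge0 =>
  x _; rewrite lee_fin sqr_ge0.
rewrite lee_fin mulrCA -exprMn mulfK ?gt_eqF//.
Qed.

End bessel.

(** * Cutting the measure at a scale *)

Section smoothing_by_cubes.
Context {R : realType} {n : nat}.
Local Notation E := (euclidean R n).
Local Notation leb := (lebesgue_euclidean R n).
Implicit Types (P Q : probability E R) (w : E -> \bar R).

(** Domination by [M] times Lebesgue measure, tested on nonnegative functions: this is how it is
    applied to a cross density, just before Bessel's inequality. *)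
Definition density_bounded P (M : R) := forall w,
  measurable_fun setT w -> (forall x, 0 <= w x)%E ->
  (\int[P]_x w x <= M%:E * \int[leb]_x w x)%E.

(** Uniformity over translates is what survives smoothing, since [convolution P Q] is an average of
    translates of [P]. *)
Definition translates_bounded P w (M : R) :=
  forall eta, (\int[P]_x w (tadd x eta) <= M%:E)%E.

Lemma taddA (x y z : E) : tadd x (tadd y z) = tadd (tadd x y) z.
Proof. by apply: eq_from_tnth => i; rewrite !tnth_mktuple addrA. Qed.

Lemma measurable_tadd2 w (y : E) : measurable_fun setT w ->
  measurable_fun setT (fun x => w (tadd x y)).
Proof.
move=> mw; apply: (measurableT_comp mw).
exact: (measurableT_comp measurable_tadd (pair2_measurable y)).
Qed.

Lemma ge0_integral_convolutionC P Q w :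
  measurable_fun setT w -> (forall x, 0 <= w x)%E ->
  (\int[convolution P Q]_x w x = \int[Q]_y \int[P]_x w (tadd x y))%E.
Proof.
move=> mw w0; rewrite ge0_integral_convolution//.
exact: (fubini_tonelli (fun z : E * E => w (tadd z.1 z.2))
  (measurable_tadd_pair mw) (fun z => w0 _)).
Qed.

Lemma integral_probability_le Q w (M : \bar R) : (0 <= M)%E ->
  measurable_fun setT w -> (forall x, 0 <= w x)%E -> (forall x, w x <= M)%E ->
  (\int[Q]_x w x <= M)%E.
Proof.
move=> M0 mw w0 wM; apply: (@le_trans _ _ (\int[Q]_x cst M x)%E).
  exact: ge0_le_integral.
rewrite integral_cst// [X in (_ * X)%E](_ : _ = 1%E) ?mule1//.
exact: probability_setT.
Qed.

Lemma measurable_convolution_inner P w :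
  measurable_fun setT w -> (forall x, 0 <= w x)%E ->
  measurable_fun setT (fun y => \int[P]_x w (tadd x y))%E.
Proof.
move=> mw w0.
exact: (measurable_fun_fubini_tonelli_G (fun z : E * E => w (tadd z.1 z.2))
  (measurable_tadd_pair mw) (fun z => w0 _)).
Qed.

Lemma density_bounded_convolution P Q M : 0 <= M ->
  density_bounded P M -> density_bounded (convolution P Q) M.
Proof.
move=> M0 PM w mw w0; rewrite ge0_integral_convolutionC//.
apply: integral_probability_le.
- by rewrite mule_ge0 ?integral_ge0.
- exact: measurable_convolution_inner.
- by move=> y; exact: integral_ge0.
move=> y; rewrite -(lebesgue_euclidean_translation y mw w0).
by apply: PM => //; exact: measurable_tadd2.
Qed.

Lemma translates_bounded_convolution P Q w M : 0 <= M ->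
  measurable_fun setT w -> (forall x, 0 <= w x)%E ->
  translates_bounded P w M -> translates_bounded (convolution P Q) w M.
Proof.
move=> M0 mw w0 PM eta.
have mw2 := measurable_tadd2 eta mw.
rewrite (ge0_integral_convolutionC _ _ mw2)//.
apply: integral_probability_le => //.
- by have := measurable_convolution_inner P mw2 (fun x => w0 _).
- by move=> y; exact: integral_ge0.
move=> y; have := PM (tadd y eta); congr (_ <= _)%E.
by apply: eq_integral => x _; rewrite taddA.
Qed.

(** The density of the convolution at z is the mass that [P] gives to the cube centred at z, divided
    by the volume of that cube. *)
Lemma density_bounded_cube P (delta : R) (h : - delta < delta) (V : R) :
  0 <= V ->
  (forall z, (P [set x | cube n delta (tsub z x)] <= V%:E)%E) ->
  density_bounded (convolution P (cube_prob h n)) ((delta - - delta)^-1 ^+ n *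
    V).
Proof.
move=> V0 PV w mw w0; rewrite ge0_integral_convolution//.
set c := (delta - - delta)^-1 ^+ n.
have c0 : 0 <= c by rewrite exprn_ge0// invr_ge0 subr_ge0 ltW.
have mI : measurable_fun setT (EFin \o (\1_(cube n delta) : E -> R)).
  by apply/measurable_EFinP; apply: measurable_indic; exact: measurable_cube.
pose W (z : E * E) := (w z.2 * (\1_(cube n delta) (tsub z.2 z.1))%:E)%E.
have mW : measurable_fun setT W.
  apply: emeasurable_funM; first exact: (measurableT_comp mw measurable_snd).
  apply: (measurableT_comp mI); apply: (measurableT_comp measurable_tsub
    (g := fun z : E * E => (z.2, z.1))).
  apply/measurable_fun_pairP; split; [exact: measurable_snd|exact:
    measurable_fst].
have W0 z : (0 <= W z)%E by rewrite mule_ge0// lee_fin.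
have -> : (\int[P]_x \int[cube_prob h n]_y w (tadd x y) =
    \int[P]_x (c%:E * \int[leb]_z W (x, z)))%E.
  apply: eq_integral => x _; rewrite ge0_integral_cube_prob//;
    last exact: measurable_tadd1.
  congr (_ * _)%E.
  rewrite -[RHS](lebesgue_euclidean_translation x (w := fun z => W (x, z)))//.
    by apply: eq_integral => z _; rewrite /W/= tsub_add taddC.
  exact: (measurableT_comp mW (pair1_measurable x)).
have mF := measurable_fun_fubini_tonelli_F (m2 := leb) W mW W0.
rewrite ge0_integralZl//; last by move=> x _; exact: integral_ge0.
rewrite EFinM -muleA; apply: lee_wpmul2l; first by rewrite lee_fin.
rewrite (fubini_tonelli W mW W0) -ge0_integralZl// ?lee_fin//.
apply: ge0_le_integral => //.
- by move=> z _; exact: integral_ge0.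
- exact: (measurable_fun_fubini_tonelli_G W mW W0).
- exact: measurable_funeM.
move=> z _; rewrite /W/= ge0_integralZl//; last first.
  exact: (measurableT_comp mI (measurableT_comp measurable_tsub
    (pair1_measurable z))).
rewrite muleC; apply: lee_wpmul2r => //.
rewrite (_ : (fun x => _) = (fun x =>
  (\1_[set x | cube n delta (tsub z x)] x)%:E)); last first.
  by apply/funext => x; rewrite !indicE; congr ((nat_of_bool _)%:R%:E);
    apply/idP/idP => /set_mem h1; apply/mem_set.
rewrite integral_indic ?setIT//; last first.
  rewrite -[X in measurable X]setTI.
  have mt : measurable_fun setT (fun x : E => tsub z x).
    exact: (measurableT_comp measurable_tsub (pair1_measurable z)).
  have mc : measurable (setT `&` (fun x : E => tsub z x) @^-1` cube n delta).
    by apply: mt => //; exact: measurable_cube.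
  exact: mc.
exact: PV.
Qed.

End smoothing_by_cubes.

(** * Size of the multiplier of a small cube *)

Section cube_multiplier_bounds.
Context {R : realType} {n : nat}.
Local Notation E := (euclidean R n).

Lemma normr_sin_le (s : R) : `|sin s| <= `|s|.
Proof.
have [->|s0] := eqVneq s 0; first by rewrite sin0.
have := normr_sinc_le1 s; rewrite /sinc (negbTE s0) normrM normfV.
by rewrite ler_pdivrMr ?mul1r// normr_gt0.
Qed.

Lemma one_sub_cos_le (t : R) : 1 - cos t <= t ^+ 2 / 2.
Proof.
have -> : cos t = 1 - 2 * sin (t / 2) ^+ 2.
  rewrite [in LHS](_ : t = t / 2 + t / 2); last by field.
  by rewrite cosD -!expr2 cos2sin2; ring.
have := normr_sin_le (t / 2); rewrite -(ler_pXn2r (n := 2))// ?nnegrE//.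
rewrite !real_normK ?num_real// exprMn => h.
have : t ^+ 2 * 2^-1 ^+ 2 = t ^+ 2 / 4 by field.
move=> e; rewrite e in h; lra.
Qed.

Lemma normr_dotp_le (x y : E) (delta : R) : cube n delta y ->
  `|dotp x y| <= n%:R * (enorm x * delta).
Proof.
move=> cy; rewrite (le_trans (ler_norm_sum _ _ _))//.
rewrite (le_trans (ler_sum _ (G := fun=> enorm x * delta) _))//.
  move=> i _; rewrite normrM; apply: ler_pM => //.
  exact: ler_norm_tnth_enorm.
by rewrite sumr_const card_ord mulr_natl.
Qed.

Lemma cube_multiplier_le1 (delta : R) (x : E) : cube_multiplier delta x <= 1.
Proof.
rewrite (le_trans (ler_norm _))// normr_prod.
by apply: prodr_ile1 => i _; rewrite normr_ge0 normr_sinc_le1.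
Qed.

Lemma cube_multiplier_geN1 (delta : R) (x : E) : -1 <= cube_multiplier delta x.
Proof.
rewrite lerNl (le_trans (ler_norm _))// normrN normr_prod.
by apply: prodr_ile1 => i _; rewrite normr_ge0 normr_sinc_le1.
Qed.

(** The left side is the mean of 1 - cos (2 pi <x, y>) over y in the cube. The bound 1 - cos t <=
    t^2 / 2 gives 2 pi^2 <x, y>^2, and pi <= 4 gives the constant 32. *)
Lemma one_sub_cube_multiplier_le (delta : R) (x : E) : 0 < delta ->
  1 - cube_multiplier delta x <= 32 * (n%:R * (enorm x * delta)) ^+ 2.
Proof.
move=> d0; have h : - delta < delta by lra.
have mc : measurable_fun setT (fun y : E => 1 - cos (2 * pi * dotp x y)).
  by apply: measurable_funB => //; exact: measurable_cos_dotp1.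
have c0 y : 0 <= 1 - cos (2 * pi * dotp x y).
  by rewrite subr_ge0 cos_le1.
have ic : (cube_prob h n).-integrable setT (EFin \o (fun y =>
  cos (2 * pi * dotp x y))).
  apply: (@probability_integrable _ _ _ _ _ 1);
    first exact: measurable_cos_dotp1.
  by move=> y; exact: normr_cos_le1.
have i1 : (cube_prob h n).-integrable setT (EFin \o (fun=> 1 : R)).
  by apply: (@probability_integrable _ _ _ _ _ 1) => // y; rewrite normr1.
have e : 1 - cube_multiplier delta x =
    \int[cube_prob h n]_y (1 - cos (2 * pi * dotp x y)).
  rewrite RintegralB// Rintegral_cst//= probability_setT mulr1; congr (_ - _).
  by rewrite -(cos_measure_cube h).
rewrite -lee_fin e EFin_Rintegral; last exact: (integrableB measurableT i1 ic).
rewrite cube_prob_support//; last exact/measurable_EFinP.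
have mI : measurable_fun setT (EFin \o (\1_(cube n delta) : E -> R)).
  by apply/measurable_EFinP; apply: measurable_indic; exact: measurable_cube.
apply: integral_probability_le.
- by rewrite lee_fin mulr_ge0// sqr_ge0.
- by apply: emeasurable_funM => //; exact/measurable_EFinP.
- by move=> y; rewrite mule_ge0// lee_fin.
move=> y; rewrite indicE; have [yc|_] := boolP (y \in _); last first.
  by rewrite mule0 lee_fin mulr_ge0// sqr_ge0.
rewrite mule1 lee_fin (le_trans (one_sub_cos_le _))//.
have := normr_dotp_le x (set_mem yc); set u := _ * (_ * _) => hu.
have : dotp x y ^+ 2 <= u ^+ 2.
  rewrite -[dotp x y ^+ 2]real_normK ?num_real// ler_pXn2r// nnegrE//.
  by rewrite (le_trans _ hu).
have /andP[pi0 pi2] := pihalf_02 R.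
rewrite !exprMn => hs.
have hp : pi ^+ 2 <= 4 ^+ 2 :> R by rewrite ler_pXn2r ?nnegrE//; lra.
have := sqr_ge0 (dotp x y); have := sqr_ge0 (pi : R).
nra.
Qed.

(** With y = |x| / r, the half-side turns the quadratic bound into 8 y^2. For y >= 1 the trivial
    bound is enough; for y < 1 the power n gives y^(2n), at most y^b because b <= 2n. *)
Lemma one_sub_cube_multiplier_powR (r b : R) (x : E) :
  (0 < n)%N -> 0 < r -> 0 < enorm x -> 0 <= b -> b <= (2 * n)%:R ->
  `|(1 - cube_multiplier (2 * n%:R * r)^-1 x) ^+ n| <=
  8 ^+ n * (enorm x / r) `^ b.
Proof.
move=> n0 r0 x0 b0 bn; set y := enorm x / r.
have y0 : 0 < y by rewrite divr_gt0.
have n1 : 0 < n%:R :> R by rewrite ltr0n.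
have d0 : 0 < (2 * n%:R * r)^-1 by rewrite invr_gt0 !mulr_gt0.
set m := 1 - _.
have m0 : 0 <= m by rewrite subr_ge0 cube_multiplier_le1.
have m2 : m <= 8 by have := cube_multiplier_geN1 (2 * n%:R * r)^-1 x;
  rewrite /m; lra.
have m3 : m <= 8 * y ^+ 2.
  rewrite (le_trans (one_sub_cube_multiplier_le x d0))//.
  have -> : n%:R * (enorm x * (2 * n%:R * r)^-1) = y / 2.
    by rewrite /y; field; rewrite !gt_eqF.
  rewrite exprMn; have := sqr_ge0 y; have -> : 2^-1 ^+ 2 = 4^-1 :> R by field.
  lra.
rewrite ger0_norm ?exprn_ge0//.
have [y1|y1] := leP 1 y.
  rewrite (@le_trans _ _ (8 ^+ n))//; first by rewrite ler_pXn2r// nnegrE.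
  rewrite ler_peMr//; apply: (@le_trans _ _ (1 `^ b)); first by rewrite powR1.
  by rewrite ge0_ler_powR// ?nnegrE// ltW.
rewrite (@le_trans _ _ ((8 * y ^+ 2) ^+ n))//.
  by rewrite ler_pXn2r// nnegrE mulr_ge0// sqr_ge0.
rewrite exprMn ler_wpM2l// -exprM -powR_mulrn; last exact: ltW.
by apply: ger_powR => //; rewrite y0 ltW.
Qed.

End cube_multiplier_bounds.

Section cutting_the_measure.
Context {R : realType} {n : nat}.
Local Notation E := (euclidean R n).
Local Notation leb := (lebesgue_euclidean R n).
Implicit Types (P Q : probability E R) (f g : E -> R).
Local Notation L1 f := (leb.-integrable setT (EFin \o f)).
Local Notation norm1 f := (\int[leb]_x `|f x|).
Local Notation norm2sq f := (\int[leb]_x f x ^+ 2).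

(* The hypotheses on the measure, in a form invariant under translations: the
   phase [theta] absorbs the modulation of the Fourier transform. *)
Definition admissible (a b A B : R) P :=
  (forall r z, 1 <= r ->
    (P [set x | cube n (2 * n%:R * r)^-1 (tsub z x)] <= (A * r `^ (-
      a))%:E)%E) /\
  (forall theta x, 1 <= enorm x ->
    `|\int[P]_xi cos (theta + 2 * pi * dotp x xi)| <= B * enorm x `^ (- b)).

Fixpoint iterated_convolution P Q (k : nat) : probability E R :=
  if k is k'.+1 then convolution (iterated_convolution P Q k') Q else P.

Lemma cos_measure_iterated_convolution P (delta : R) (h : - delta < delta) k x :
  cos_measure (iterated_convolution P (cube_prob h n) k) x =
  cos_measure P x * cube_multiplier delta x ^+ k.
Proof.
elim: k => [|k IH]; first by rewrite expr0 mulr1.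
by rewrite cos_measure_convolution IH exprSr mulrA.
Qed.

Lemma energy_self_ge0 P f : 0 <= energy P f f.
Proof. by apply: Rintegral_ge0 => xi _; exact: cross_density_self_ge0. Qed.

(** Cauchy-Schwarz in linearized form; [t] is left free so that it can be tuned to each pair of
    blocks. *)
Lemma energy_sq_amgm P f g (t : R) : L1 f -> L1 g -> 0 < t ->
  `|energy P f g| <= t * energy P f f + energy P g g / t.
Proof.
move=> f1 g1 t0.
have ie f' g' : L1 f' -> L1 g' ->
    P.-integrable setT (EFin \o cross_density f' g').
  move=> h1 h2; apply: (@probability_integrable _ _ _ _ _
    (2 * ((\int[leb]_x `|f' x|) * (\int[leb]_x `|g' x|)))).
    exact: measurable_cross_density.
  by move=> x; exact: normr_cross_density.
have iff := ie _ _ f1 f1; have igg := ie _ _ g1 g1; have ifg := ie _ _ f1 g1.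
have itf : P.-integrable setT (EFin \o (fun x => t * cross_density f f x)).
  exact: (integrableZl measurableT t iff).
have itg : P.-integrable setT (EFin \o (fun x => t^-1 * cross_density g g x)).
  exact: (integrableZl measurableT t^-1 igg).
rewrite (le_trans (le_normr_Rintegral _ ifg))// [energy P g g / t]mulrC.
rewrite -!RintegralZl// -RintegralD//.
apply: le_Rintegral => //.
- exact: (integrable_norm ifg).
- exact: (integrableD measurableT itf itg).
move=> xi _; rewrite /cross_density.
set u := cos_transform f xi; set v := cos_transform g xi.
set u' := sin_transform f xi; set v' := sin_transform g xi.
have amgm (p q : R) : `|p * q| <= t * (p * p) + t^-1 * (q * q).
  have e : t * (p * p) + t^-1 * (q * q) = t^-1 * ((t * `|p|) ^+ 2 + `|q| ^+ 2).
    by rewrite exprMn !real_normK ?num_real//; field; rewrite gt_eqF.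
  rewrite e [leRHS]mulrC ler_pdivlMr// normrM.
  have := sqr_ge0 (t * `|p| - `|q|); have := sqr_ge0 (t * `|p|).
  have := sqr_ge0 `|q|; nra.
rewrite (le_trans (ler_normD _ _))//.
have := amgm u v; have := amgm u' v'; lra.
Qed.

Lemma energy_density_bounded P (M : R) f : 0 <= M -> L1 f ->
  L1 (fun x => f x ^+ 2) -> density_bounded P M ->
  energy P f f <= M * (2 * 4 ^+ n * norm2sq f).
Proof.
move=> M0 f1 f2 PM; rewrite -lee_fin EFin_energy//.
apply: (le_trans (PM _ _ _)).
- by apply/measurable_EFinP; exact: measurable_cross_density.
- by move=> x; rewrite lee_fin cross_density_self_ge0.
rewrite [in leRHS]EFinM; apply: lee_wpmul2l; first by rewrite lee_fin.
by rewrite [in leRHS]EFinM EFin_Rintegral//; exact: bessel_inequality.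
Qed.

Lemma normr_energy P f g : L1 f -> L1 g ->
  `|energy P f g| <= norm1 f * norm1 g.
Proof.
move=> f1 g1; rewrite energyE// mulrC -[norm1 g]mul1r.
apply: normr_kernel_form => //; first exact: measurable_cos_measure.
by move=> z; exact: normr_cos_measure.
Qed.

(** The first convolution spreads the mass A r^(-a) of a cube over its volume (n r)^(-n); the
    further ones only average translates. *)
Lemma density_bounded_iterated P (a b A B r : R) (h :
  - (2 * n%:R * r)^-1 < (2 * n%:R * r)^-1) k :
  (0 < n)%N -> 0 <= A -> 1 <= r -> admissible a b A B P ->
  density_bounded (iterated_convolution P (cube_prob h n) k.+1)
    (n%:R ^+ n * (A * r `^ (n%:R - a))).
Proof.
move=> n0 A0 r1 [PG _]; have r0 : 0 < r by lra.
have nn : 0 < n%:R :> R by rewrite ltr0n.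
have M0 : 0 <= n%:R ^+ n * (A * r `^ (n%:R - a)).
  by rewrite mulr_ge0// mulr_ge0// powR_ge0.
elim: k => [|k IH]; last exact: density_bounded_convolution.
have := density_bounded_cube h (V := A * r `^ (- a)) _ (fun z => PG r z r1).
rewrite (_ : ((2 * n%:R * r)^-1 - - (2 * n%:R * r)^-1)^-1 = n%:R * r);
  last first.
  by field; rewrite !gt_eqF.
have -> : (n%:R * r) ^+ n * (A * r `^ (- a)) = n%:R ^+ n * (A * r `^ (n%:R -
  a)).
  rewrite exprMn powRD; last by apply/implyP => _; rewrite gt_eqF.
  by rewrite powR_mulrn; [ring|exact: ltW].
by apply; rewrite mulr_ge0// powR_ge0.
Qed.

(** In the alternating binomial sum the term of index 0 is [P] itself. The full sum has kernel
    [cos_measure P] times (1 - multiplier)^n and is bounded by the L^1 norms; the terms of index at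
    least 1 are moved to the other side. *)
Lemma low_high_decomposition P (a b A B r : R) f g :
  (0 < n)%N -> 0 <= B -> 0 <= b -> b <= (2 * n)%:R -> 1 <= r ->
  admissible a b A B P -> L1 f -> L1 g -> 1 <= B ->
  forall h : - (2 * n%:R * r)^-1 < (2 * n%:R * r)^-1,
  `|energy P f g| <=
  (\sum_(k < n) 'C(n, k.+1)%:R *
      `|energy (iterated_convolution P (cube_prob h n) k.+1) f g|) +
  8 ^+ n * (B * r `^ (- b)) * (norm1 f * norm1 g).
Proof.
move=> n0 B0 b0 bn r1 [_ PF] f1 g1 B1 h; have r0 : 0 < r by lra.
pose Pk k := iterated_convolution P (cube_prob h n) k.
pose c (k : 'I_n.+1) : R := (-1) ^+ k * 'C(n, k)%:R.
have e : \sum_(k < n.+1) c k * energy (Pk k) f g =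
    kernel_form (fun z => \sum_(k < n.+1) c k * cos_measure (Pk k) z) f g.
  rewrite -(@kernel_form_sum _ _ _ _ _ _ 1)//.
  - by apply: eq_bigr => k _; rewrite energyE.
  - by move=> k; exact: measurable_cos_measure.
  - by move=> k z; exact: normr_cos_measure.
have kE z : \sum_(k < n.+1) c k * cos_measure (Pk k) z =
    cos_measure P z * (1 - cube_multiplier (2 * n%:R * r)^-1 z) ^+ n.
  rewrite exprBn mulr_sumr; apply: eq_bigr => k _.
  by rewrite /Pk cos_measure_iterated_convolution /c expr1n mulr1 -mulr_natr;
    ring.
have kM z : `|\sum_(k < n.+1) c k * cos_measure (Pk k) z| <=
    8 ^+ n * (B * r `^ (- b)).
  (* Three ranges of |z|: at 0 the multiplier is 1 and the kernel vanishes, as 0 < n; for |z| >= 1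
     the decay of [P] compensates |z|^b; in between |z|^b <= 1 and the transform of [P] is at most 1
     <= B. *)
  rewrite kE normrM; have [z0|z0] := leP (enorm z) 0.
    rewrite (_ : cube_multiplier _ _ = 1) ?subrr ?expr0n ?eqn0Ngt ?n0//.
      by rewrite /= normr0 mulr0 mulr_ge0// mulr_ge0// powR_ge0.
    apply: big1 => i _; rewrite (_ : tnth z i = 0) ?mulr0 /sinc ?eqxx//.
    by apply/eqP; rewrite -normr_le0 (le_trans (ler_norm_tnth_enorm z i)).
  have := one_sub_cube_multiplier_powR n0 r0 z0 b0 bn.
  set q := `|(1 - _) ^+ n| => hq; have q0 : 0 <= q by exact: normr_ge0.
  have rb : 0 <= r `^ (- b) by exact: powR_ge0.
  have hz : q <= 8 ^+ n * (enorm z `^ b * r `^ (- b)).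
    rewrite (le_trans hq)// powRM; [|exact: ltW|by rewrite invr_ge0 ltW].
    by rewrite -[r^-1](powR_inv1 (ltW r0)) -powRrM mulN1r.
  have [z1|z1] := leP 1 (enorm z).
    have := PF 0 z z1; rewrite (_ : \int[P]_xi _ = cos_measure P z); last first.
      by apply: eq_Rintegral => xi _; rewrite add0r.
    move=> hP; rewrite (le_trans (ler_pM _ _ hP hz))//.
    have -> : B * enorm z `^ (- b) * (8 ^+ n * (enorm z `^ b * r `^ (- b))) =
      (enorm z `^ (- b) * enorm z `^ b) * (8 ^+ n * (B * r `^ (- b))) by ring.
    rewrite -powRD; last by apply/implyP => _; rewrite gt_eqF.
    by rewrite addNr powRr0 mul1r.
  have zb : enorm z `^ b <= 1.
    rewrite (@le_trans _ _ (1 `^ b))//; last by rewrite powR1.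
    by rewrite ge0_ler_powR// ?nnegrE// ltW.
  rewrite (le_trans (ler_pM _ _ (normr_cos_measure P z) hz))// mul1r.
  by rewrite ler_wpM2l// ler_wpM2r// (le_trans zb).
have mk : measurable_fun setT
    (fun z => \sum_(k < n.+1) c k * cos_measure (Pk k) z).
  apply: measurable_sum => k; apply: measurable_funM => //.
  exact: measurable_cos_measure.
have H := normr_kernel_form f1 g1 mk kM.
rewrite -e big_ord_recl /c /= expr0 bin0 !mul1r in H.
set S := \sum_(k < n) _ in H.
have hS : `|S| <= \sum_(k < n) 'C(n, k.+1)%:R * `|energy (Pk k.+1) f g|.
  rewrite (le_trans (ler_norm_sum _ _ _))//; apply: ler_sum => k _.
  by rewrite !normrM normrX normrN1 expr1n mul1r normr_nat.
have -> : energy P f g = energy (Pk 0%N) f g + S - S by rewrite addrK.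
rewrite (le_trans (ler_normB _ _))// addrC lerD//.
by rewrite [leRHS]mulrA [leRHS]mulrAC.
Qed.

End cutting_the_measure.

(** * Energy estimates at one radius *)

Section single_scale_estimates.
Context {R : realType} {n : nat}.
Local Notation E := (euclidean R n).
Local Notation leb := (lebesgue_euclidean R n).
Implicit Types (P Q : probability E R) (f g : E -> R).
Local Notation L1 f := (leb.-integrable setT (EFin \o f)).
Local Notation norm1 f := (\int[leb]_x `|f x|).
Local Notation norm2sq f := (\int[leb]_x f x ^+ 2).

(** Here S = 2^n - 1 is the total weight of the smoothed measures. The three summands come from
    their density times Bessel's constant, from the term [M / t] of the linearized Cauchy-Schwarz
    inequality, and from the high part. *)
Definition scale_constant : R :=
  let S := \sum_(k < n) 'C(n, k.+1)%:R in
  S * (n%:R ^+ n * (2 * 4 ^+ n)) + S + 8 ^+ n.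

Lemma scale_constant_ge1 : 1 <= scale_constant.
Proof.
rewrite /scale_constant; set S := \sum_(k < n) _.
have S0 : 0 <= S by exact: sumr_ge0.
have h8 : 1 <= 8 ^+ n :> R by rewrite exprn_ege1// ler1n.
have h : 0 <= S * (n%:R ^+ n * (2 * 4 ^+ n)) by rewrite !mulr_ge0// exprn_ge0.
lra.
Qed.

Lemma tadd0 (x : E) : tadd x [tuple 0 | i < n] = x.
Proof. by apply: eq_from_tnth => i; rewrite !tnth_mktuple addr0. Qed.

Lemma translates_bounded_iterated P Q (w : E -> \bar R) (M : R) k : 0 <= M ->
  measurable_fun setT w -> (forall x, 0 <= w x)%E ->
  translates_bounded P w M -> translates_bounded (iterated_convolution P Q k)
    w M.
Proof.
move=> M0 mw w0 PM; elim: k => [//|k IH].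
exact: translates_bounded_convolution.
Qed.

Lemma translates_bounded_energy P g (M : R) : L1 g ->
  translates_bounded P (fun xi => (cross_density g g xi)%:E) M -> energy P g g
    <= M.
Proof.
move=> g1 gM; rewrite -lee_fin EFin_energy//.
apply: le_trans (gM [tuple 0 | i < n]); rewrite le_eqVlt; apply/orP; left.
by apply/eqP; apply: eq_integral => x _; rewrite tadd0.
Qed.

(** The cut is only available for r >= 1, but the radius chosen later may be smaller. In that case
    the factor B r^(-b) is at least 1, and the trivial bound by the L^1 norms already suffices. *)
Lemma small_radius_bound (b B r : R) : 0 <= b -> 1 <= B -> 0 < r -> r < 1 ->
  1 <= B * r `^ (- b).
Proof.
move=> b0 B1 r0 r1; have h : 1 <= r `^ (- b).
  rewrite -(powRr0 r); apply: ger_powR; last by lra.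
  by rewrite r0 ltW.
by rewrite (le_trans B1)// ler_peMr//; lra.
Qed.

Lemma norm2sq_ge0 f : 0 <= norm2sq f.
Proof. by apply: Rintegral_ge0 => x _; exact: sqr_ge0. Qed.

Lemma norm1_ge0 f : 0 <= norm1 f.
Proof. exact: Rintegral_ge0. Qed.

Section fixed_parameters.
Variables (a b A B : R).
Hypotheses (n0 : (0 < n)%N) (A1 : 1 <= A) (B1 : 1 <= B).
Hypotheses (b0 : 0 <= b) (bn : b <= (2 * n)%:R).

Let A0 : 0 <= A. Proof. exact: le_trans A1. Qed.

Let B0 : 0 <= B. Proof. exact: le_trans B1. Qed.

Lemma energy_diagonal P (r : R) f : 0 < r -> admissible a b A B P ->
  L1 f -> L1 (fun x => f x ^+ 2) ->
  energy P f f <= scale_constant *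
    (A * r `^ (n%:R - a) * norm2sq f + B * r `^ (- b) * norm1 f ^+ 2).
Proof.
move=> r0 PA f1 f2; set X := A * _ `^ _; set Y := B * _ `^ _.
have X0 : 0 <= X by rewrite mulr_ge0 ?powR_ge0.
have Y0 : 0 <= Y by rewrite mulr_ge0 ?powR_ge0.
have N20 := norm2sq_ge0 f; have N10 := sqr_ge0 (norm1 f).
have C1 := scale_constant_ge1.
have [r1|r1] := leP 1 r; last first.
  have Y1 : 1 <= Y by exact: small_radius_bound.
  have := normr_energy P f1 f1; rewrite -expr2 => /(le_trans (ler_norm _)) h.
  rewrite (le_trans h)//; set u := norm1 f ^+ 2.
  have h1 : u <= Y * u by rewrite ler_peMl.
  have h2 : 0 <= X * norm2sq f by rewrite mulr_ge0.
  have h3 : Y * u <= scale_constant * (Y * u) by rewrite ler_peMl//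
    (le_trans _ h1).
  rewrite mulrDr; have : 0 <= scale_constant * (X * norm2sq f) by rewrite
    mulr_ge0//; lra.
  lra.
have h : - (2 * n%:R * r)^-1 < (2 * n%:R * r)^-1.
  have : 0 < (2 * n%:R * r)^-1 by rewrite invr_gt0 !mulr_gt0// ltr0n.
  lra.
have H := low_high_decomposition n0 B0 b0 bn r1 PA f1 f1 B1 h.
rewrite (le_trans (ler_norm _))// (le_trans H)//.
rewrite /scale_constant; set S := \sum_(k < n) 'C(n, k.+1)%:R.
have S0 : 0 <= S by exact: sumr_ge0.
have hS : \sum_(k < n) 'C(n, k.+1)%:R *
    `|energy (iterated_convolution P (cube_prob h n) k.+1) f f| <=
    S * (n%:R ^+ n * X * (2 * 4 ^+ n * norm2sq f)).
  rewrite mulr_suml; apply: ler_sum => k _; apply: ler_wpM2l => //.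
  rewrite ger0_norm ?energy_self_ge0//.
  apply: energy_density_bounded => //; first by rewrite mulr_ge0// exprn_ge0.
  exact: (density_bounded_iterated _ _ n0 A0 r1 PA).
rewrite (le_trans (lerD hS (lexx _)))// -expr2 -/Y.
set u := norm1 f ^+ 2 in N10 *; set c := n%:R ^+ n; set e := 4 ^+ n; set e8 :=
  8 ^+ n.
have c0 : 0 <= c by exact: exprn_ge0.
have e0 : 0 <= e by exact: exprn_ge0.
have e80 : 0 <= e8 by exact: exprn_ge0.
rewrite -subr_ge0 (_ : _ - _ = S * (c * (2 * e)) * (Y * u) + S * (X * norm2sq f)
  + S * (Y * u) + e8 * (X * norm2sq f)); last by ring.
by repeat (first [done | apply: addr_ge0 | apply: mulr_ge0]).
Qed.

(** The low energies of [g] are not estimated at the radius [r]: as averages over translates of [P]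
    they are at most [M], whatever [r] is. Only [f] pays the factor A r^(n-a). *)
Lemma energy_off_diagonal P (r t M : R) f g : 0 < r -> 0 < t -> 0 <= M ->
  admissible a b A B P -> L1 f -> L1 (fun x => f x ^+ 2) -> L1 g ->
  translates_bounded P (fun xi => (cross_density g g xi)%:E) M ->
  `|energy P f g| <= scale_constant *
    (t * (A * r `^ (n%:R - a)) * norm2sq f + M / t +
     B * r `^ (- b) * (norm1 f * norm1 g)).
Proof.
move=> r0 t0 M0 PA f1 f2 g1 gM; set X := A * _ `^ _; set Y := B * _ `^ _.
have X0 : 0 <= X by rewrite mulr_ge0 ?powR_ge0.
have Y0 : 0 <= Y by rewrite mulr_ge0 ?powR_ge0.
have N20 := norm2sq_ge0 f.
have N10 : 0 <= norm1 f * norm1 g by rewrite mulr_ge0// norm1_ge0.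
have C1 := scale_constant_ge1.
have Mt0 : 0 <= M / t by rewrite divr_ge0// ltW.
have tX0 : 0 <= t * X * norm2sq f := mulr_ge0 (mulr_ge0 (ltW t0) X0) N20.
have [r1|r1] := leP 1 r; last first.
  have Y1 : 1 <= Y by exact: small_radius_bound.
  rewrite (le_trans (normr_energy P f1 g1))//; set u :=
    norm1 f * norm1 g in N10 *.
  have h1 : u <= Y * u by rewrite ler_peMl.
  have h3 : Y * u <= scale_constant * (Y * u) by rewrite ler_peMl//
    (le_trans _ h1).
  rewrite mulrDr; have : 0 <= scale_constant * (t * X * norm2sq f + M / t).
    by apply: mulr_ge0; [lra|exact: addr_ge0].
  lra.
have h : - (2 * n%:R * r)^-1 < (2 * n%:R * r)^-1.
  have : 0 < (2 * n%:R * r)^-1 by rewrite invr_gt0 !mulr_gt0// ltr0n.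
  lra.
rewrite (le_trans (low_high_decomposition n0 B0 b0 bn r1 PA f1 g1 B1 h))//.
rewrite /scale_constant; set S := \sum_(k < n) 'C(n, k.+1)%:R.
have S0 : 0 <= S by exact: sumr_ge0.
have hS : \sum_(k < n) 'C(n, k.+1)%:R *
    `|energy (iterated_convolution P (cube_prob h n) k.+1) f g| <=
    S * (t * (n%:R ^+ n * X * (2 * 4 ^+ n * norm2sq f)) + M / t).
  rewrite mulr_suml; apply: ler_sum => k _; apply: ler_wpM2l => //.
  rewrite (le_trans (energy_sq_amgm _ f1 g1 t0))//; apply: lerD.
    apply: ler_wpM2l; [exact: ltW|apply: energy_density_bounded => //].
      by rewrite mulr_ge0// exprn_ge0.
    exact: (density_bounded_iterated _ _ n0 A0 r1 PA).
  apply: ler_wpM2r; first by rewrite invr_ge0 ltW.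
  apply: translates_bounded_energy => //.
  apply: translates_bounded_iterated => //.
    by apply/measurable_EFinP; exact: measurable_cross_density.
  by move=> xi; rewrite lee_fin cross_density_self_ge0.
rewrite (le_trans (lerD hS (lexx _)))// -/Y.
set u := norm1 f * norm1 g in N10 *.
set c := n%:R ^+ n; set e := 4 ^+ n; set e8 := 8 ^+ n; set v := M / t in Mt0 *.
have c0 : 0 <= c by exact: exprn_ge0.
have e0 : 0 <= e by exact: exprn_ge0.
have e80 : 0 <= e8 by exact: exprn_ge0.
rewrite -subr_ge0 (_ : _ - _ = S * (c * (2 * e)) * (Y * u) + S * (c * (2 * e))
  * v
  + S * (t * X * norm2sq f)
  + S * (Y * u) + e8 * (t * X * norm2sq f) + e8 * v); last by ring.
by repeat (first [done | apply: addr_ge0 | apply: mulr_ge0]).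
Qed.

Lemma integral_convolution_dirac P (eta : E) (w : E -> \bar R) :
  measurable_fun setT w -> (forall x, 0 <= w x)%E ->
  (\int[convolution P [the probability _ _ of \d_eta]]_x w x =
   \int[P]_x w (tadd x eta))%E.
Proof.
move=> mw w0; rewrite ge0_integral_convolution//; apply: eq_integral => x _.
by rewrite integral_dirac ?diracT ?mul1e//; exact: measurable_tadd1.
Qed.

Lemma admissible_translate P (eta : E) : admissible a b A B P ->
  admissible a b A B (convolution P [the probability _ _ of \d_eta]).
Proof.
move=> [PG PF]; split=> [r z r1|theta x x1].
  have mS y : measurable [set x : E | cube n (2 * n%:R * r)^-1 (tsub y x)].
    rewrite -[X in measurable X]setTI.
    have mt : measurable_fun setT (fun x : E => tsub y x).
      exact: (measurableT_comp measurable_tsub (pair1_measurable y)).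
    have mc : measurable (setT `&` (fun x : E =>
      tsub y x) @^-1` cube n (2 * n%:R * r)^-1).
      by apply: mt => //; exact: measurable_cube.
    exact: mc.
  have mI : measurable_fun setT (EFin \o
      (\1_[set x : E | cube n (2 * n%:R * r)^-1 (tsub z x)] : E -> R)).
    by apply/measurable_EFinP; exact: measurable_indic.
  rewrite -[X in (_ X <= _)%E]setIT -(integral_indic _ measurableT (mS z)).
  rewrite (integral_convolution_dirac _ _ mI); last by move=> x;
    rewrite lee_fin.
  apply: le_trans (PG r (tsub z eta) r1).
  rewrite -[X in (_ <= _ X)%E]setIT -(integral_indic _ measurableT (mS (tsub z
    eta))).
  rewrite le_eqVlt; apply/orP; left; apply/eqP; apply: eq_integral => x _ /=.
  have e : tsub z (tadd x eta) = tsub (tsub z eta) x.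
    by apply: eq_from_tnth => i; rewrite !tnth_mktuple; ring.
  rewrite !indicE; congr ((nat_of_bool _)%:R%:E).
  by apply/idP/idP => /set_mem /= h; apply/mem_set => /=; move: h; rewrite e.
have mc := measurable_cos_dotp1 x.
have mt : measurable_fun setT (fun y => cos (theta + 2 * pi * dotp x y)).
  apply: measurable_cos_comp; apply: measurable_funD => //.
  apply: measurable_funM => //.
  exact: (measurableT_comp measurable_dotp (pair1_measurable x)).
rewrite (Rintegral_prob_image2 _ _ _ mt (fun=> normr_cos_le1 _)).
have := PF (theta + 2 * pi * dotp x eta) x x1; congr (`|_| <= _).
apply: eq_Rintegral => xi _; rewrite /Rintegral integral_dirac//.
  by rewrite diracT mul1e /= /tadd_pair/= dotpDr mulrDr; congr cos; ring.
apply/measurable_EFinP.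
exact: (measurableT_comp mt
    (measurableT_comp measurable_tadd (pair1_measurable xi))).
Qed.

(** Integrating a translate of the cross density against [P] is computing the energy against a
    translate of [P], which is admissible with the same constants. This supplies the [M] of
    [energy_off_diagonal]. *)
Lemma translates_bounded_diagonal P (r : R) f : 0 < r -> admissible a b A B P ->
  L1 f -> L1 (fun x => f x ^+ 2) ->
  translates_bounded P (fun xi => (cross_density f f xi)%:E)
   (scale_constant *
    (A * r `^ (n%:R - a) * norm2sq f + B * r `^ (- b) * norm1 f ^+ 2)).
Proof.
move=> r0 PA f1 f2 eta.
rewrite -(integral_convolution_dirac P eta
  (w := fun xi => (cross_density f f xi)%:E)); last 2 first.
- by apply/measurable_EFinP; exact: measurable_cross_density.
- by move=> xi; rewrite lee_fin cross_density_self_ge0.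
rewrite -EFin_energy// lee_fin; apply: energy_diagonal => //.
exact: admissible_translate.
Qed.

End fixed_parameters.
End single_scale_estimates.

(** * Almost orthogonality of the pieces *)

Section powers.
Context {R : realType}.

Lemma powR_expR (x y : R) : expR x `^ y = expR (x * y).
Proof. by rewrite /powR gt_eqF ?expR_gt0// expRK mulrC. Qed.

Lemma powR2D (x y : R) : 2 `^ (x + y) = 2 `^ x * 2 `^ y :> R.
Proof. by rewrite powRD//; apply/implyP => _; rewrite gt_eqF. Qed.

Lemma powR2_le (x y : R) : x <= y -> 2 `^ x <= 2 `^ y :> R.
Proof. by apply: ler_powR; lra. Qed.

Lemma powR2_gt0 (x : R) : 0 < 2 `^ x :> R.
Proof. by rewrite powR_gt0. Qed.

(* The radius at which the low-frequency bound [A r^D] equals [2^m] times the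
   critical constant. *)
Lemma scale_radius (A B D b m : R) : 0 < A -> 0 < B -> 0 < D -> 0 < b ->
  exists2 r, 0 < r &
    (A * r `^ D = A `^ (b / (D + b)) * B `^ (D / (D + b)) * 2 `^ m) /\
    (B * r `^ (- b) = A `^ (b / (D + b)) * B `^ (D / (D + b)) * 2 `^ (- m * (b
      / D))).
Proof.
move=> A0 B0 D0 b0; have [Db0 D0'] : D + b != 0 /\ D != 0 by split;
  rewrite gt_eqF//; lra.
pose u := ln A; pose v := ln B; pose l : R := ln 2.
have eA : A = expR u by rewrite lnK.
have eB : B = expR v by rewrite lnK.
have e2 : 2 = expR l by rewrite lnK// posrE.
(* That is, r = (B / A)^(1 / (D + b)) 2^(m / D). *)
exists (expR (((v - u) * (D / (D + b)) + m * l) / D)); first exact: expR_gt0.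
split; rewrite eA eB e2 !powR_expR -!expRD; congr expR; field; by apply/andP.
Qed.

End powers.

Section geometric_sums.
Context {R : realType}.

(** With truncated subtraction the exponent is |i - j|. The induction carries a closed bound: a
    single geometric tail as long as N <= i + 1, and afterwards both tails, 2c - c rho^(N-i), with c
    = 1 / (1 - rho). *)
Lemma geometric_dist_sum_le (rho : R) (i N : nat) : 0 <= rho -> rho < 1 ->
  \sum_(j < N) rho ^+ (i - j + (j - i)) <= 2 / (1 - rho).
Proof.
move=> r0 r1; set c := (1 - rho)^-1.
have c0 : 0 <= c by rewrite invr_ge0; lra.
have c1 : c * (1 - rho) = 1 by rewrite mulVf//; apply/eqP; lra.
have step k : c * rho ^+ k.+1 + rho ^+ k = c * rho ^+ k.
  by rewrite -[X in _ + X = _]mul1r -c1 exprS; ring.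
have rk k : 0 <= rho ^+ k <= 1 by rewrite exprn_ge0//= exprn_ile1// ltW.
suff : \sum_(j < N) rho ^+ (i - j + (j - i)) <=
    if (N <= i.+1)%N then c * rho ^+ (i.+1 - N) else 2 * c - c * rho ^+ (N - i).
  move=> /le_trans; apply; case: ifP => _.
    by have /andP[h0 h1] := rk (i.+1 - N)%N; nra.
  by have /andP[h0 h1] := rk (N - i)%N; nra.
elim: N => [|N IH]; first by rewrite big_ord0 leq0n mulr_ge0// exprn_ge0.
rewrite big_ord_recr/= ltnS.
have [Ni|iN] := leqP N i.
  move: IH; rewrite (leq_trans Ni)// (eqP (_ : (N - i)%N == 0%N)) ?subn_eq0//
    addn0 => IH.
  rewrite subSS -step -(subSn Ni); apply: lerD => //.
have iN0 : (i - N = 0)%N by apply/eqP; rewrite subn_eq0 ltnW.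
rewrite iN0 add0n; move: iN IH; rewrite leq_eqVlt => /predU1P[<-|iN].
  rewrite leqnn subnn !subSnn expr0 (_ : (i.+2 - i = 2)%N);
    last by rewrite -addn2 addKn.
  by have := step 0%N; have := step 1%N; rewrite expr0 expr1; lra.
rewrite leqNgt iN/= => IH; rewrite (subSn (ltnW (ltnW iN))).
by have := step (N - i)%N; lra.
Qed.

End geometric_sums.

Section energy_of_blocks.
Context {R : realType} {n : nat}.
Local Notation E := (euclidean R n).
Local Notation leb := (lebesgue_euclidean R n).
Implicit Types (P Q : probability E R) (f g : E -> R).
Local Notation L1 f := (leb.-integrable setT (EFin \o f)).
Local Notation norm1 f := (\int[leb]_x `|f x|).
Local Notation norm2sq f := (\int[leb]_x f x ^+ 2).

Lemma energyC P f g : energy P f g = energy P g f.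
Proof.
by apply: eq_Rintegral => xi _; rewrite /cross_density mulrC [X in _ + X]mulrC.
Qed.

Lemma energy_sum P (I : Type) (s : seq I) (F : I -> E -> R) :
  (forall i, L1 (F i)) ->
  energy P (fun x => \sum_(i <- s) F i x) (fun x => \sum_(i <- s) F i x) =
  \sum_(i <- s) \sum_(j <- s) energy P (F i) (F j).
Proof.
move=> F1.
have icos xi i : L1 (fun x => F i x * cos (2 * pi * dotp x xi)).
  apply: (integrable_mul_bounded (M := 1) (F1 i)).
    exact: (measurableT_comp measurable_cos_dotp (pair2_measurable xi)).
  by move=> *; exact: normr_cos_le1.
have isin xi i : L1 (fun x => F i x * sin (2 * pi * dotp x xi)).
  apply: (integrable_mul_bounded (M := 1) (F1 i)).
    exact: (measurableT_comp measurable_sin_dotp (pair2_measurable xi)).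
  by move=> *; exact: sin_max.
have cE xi : cos_transform (fun x => \sum_(i <- s) F i x) xi =
    \sum_(i <- s) cos_transform (F i) xi.
  rewrite -(Rintegral_sum s (icos xi)).2.
  by apply: eq_Rintegral => x _; rewrite mulr_suml.
have sE xi : sin_transform (fun x => \sum_(i <- s) F i x) xi =
    \sum_(i <- s) sin_transform (F i) xi.
  rewrite -(Rintegral_sum s (isin xi)).2.
  by apply: eq_Rintegral => x _; rewrite mulr_suml.
have ie i j : P.-integrable setT (EFin \o cross_density (F i) (F j)).
  apply: (@probability_integrable _ _ _ _ _ (2 * (norm1 (F i) * norm1 (F j)))).
    exact: measurable_cross_density.
  by move=> xi; exact: normr_cross_density.
transitivity (\int[P]_xi \sum_(i <- s) \sum_(j <- s) cross_density (F i) (F j)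
  xi).
  apply: eq_Rintegral => xi _; rewrite /cross_density cE sE !big_distrlr/=.
  by rewrite -big_split; apply: eq_bigr => i _; rewrite -big_split.
have iss i := (Rintegral_sum s (ie i)).1.
rewrite (Rintegral_sum s iss).2; apply: eq_bigr => i _.
by rewrite (Rintegral_sum s (ie i)).2.
Qed.

Section fixed_parameters.
Variables (a b A B eps : R).
Hypotheses (n0 : (0 < n)%N) (A1 : 1 <= A) (B1 : 1 <= B).
Hypotheses (an : a < n%:R) (b0 : 0 < b) (bn : b <= (2 * n)%:R).
Hypotheses (eps0 : 0 < eps) (eps8 : eps <= 8^-1) (epsb :
  eps <= b / (n%:R - a) / 4).

Let D := n%:R - a.
Let Lam := A `^ (b / (D + b)) * B `^ (D / (D + b)).
Let C0 := @scale_constant R n.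

(* [f] lives on a set of measure [2 ^ (q x)], [q = (D + b) / D], where the
   weight is about [2 ^ x]. *)
Definition block (x : R) f :=
  [/\ L1 f, L1 (fun y => f y ^+ 2) &
      norm1 f ^+ 2 <= 2 `^ (x + x * (b / (n%:R - a))) * norm2sq f].

Let D0 : 0 < D. Proof. by rewrite subr_gt0. Qed.

Let s := b / D.

Let s0 : 0 < s. Proof. by rewrite divr_gt0. Qed.

Let Lam0 : 0 < Lam.
Proof. by rewrite mulr_gt0// powR_gt0//;
  [exact: lt_le_trans A1|exact: lt_le_trans B1]. Qed.

Let radius m : exists2 r, 0 < r & A * r `^ D = Lam * 2 `^ m /\
  B * r `^ (- b) = Lam * 2 `^ (- m * s).
Proof. by apply: scale_radius => //; [exact: lt_le_trans A1|exact: lt_le_trans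
  B1]. Qed.

(** The block at the lower level [y] is handled through its own diagonal bound, so that the radius
    in the mixed estimate can be chosen in favour of the other block. *)
Lemma energy_two_blocks P x y f g : y <= x -> admissible a b A B P ->
  block x f -> block y g ->
  `|energy P f g| <= C0 * (2 + 2 * C0) * Lam * 2 `^ (- eps * (x - y)) *
     (2 `^ x * norm2sq f + 2 `^ y * norm2sq g).
Proof.
move=> yx PA [f1 f2 fN] [g1 g2 gN].
rewrite -/D -/s in fN gN.
(* At this radius both terms of the diagonal bound for [g] are at most Lam 2^y ||g||_2^2, hence the
   bound 2 C0 Lam v below. *)
have [r' r'0 [rA' rB']] := radius y.
have gM := translates_bounded_diagonal n0 A1 B1 (ltW b0) bn r'0 PA g1 g2.
rewrite -/D rA' rB' in gM.
have C1 : 1 <= C0 := scale_constant_ge1.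
have Ng0 := norm2sq_ge0 g; have Nf0 := norm2sq_ge0 f.
set u := 2 `^ x * norm2sq f; set v := 2 `^ y * norm2sq g.
have u0 : 0 <= u by rewrite mulr_ge0// powR_ge0.
have v0 : 0 <= v by rewrite mulr_ge0// powR_ge0.
have C0p : 0 <= C0 by exact: le_trans C1.
have Lamp : 0 <= Lam by exact: ltW.
have M0 : 0 <= 2 * C0 * Lam * v :=
  mulr_ge0 (mulr_ge0 (mulr_ge0 (ler0n _ 2) C0p) Lamp) v0.
have gM' : translates_bounded P (fun xi =>
  (cross_density g g xi)%:E) (2 * C0 * Lam * v).
  move=> eta; apply: (le_trans (gM eta)); rewrite lee_fin.
  have -> : 2 * C0 * Lam * v = C0 * (Lam * 2 `^ y * norm2sq g + Lam * v).
    by rewrite /v; ring.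
  apply: ler_wpM2l; first exact: C0p.
  apply: lerD => //; rewrite -mulrA; apply: ler_wpM2l; first exact: ltW.
  apply: (le_trans (ler_wpM2l (powR_ge0 _ _) gN)).
  by rewrite mulrA -powR2D (_ : - y * s + (y + y * s) = y)//; ring.
pose de := x - y.
(* Lying de/4 below [x], the exponent makes the low term of [f] gain 2^(-de/4), of which t =
   2^(de/8) passes half to the term of [g]. Lying de/4 above the midpoint of [x] and [y], it makes
   the high part gain 2^(-s de/4). The bounds 1/8 and s/4 on [eps] come from here. *)
have [r r0 [rA rB]] := radius (x - de / 4).
have t0 : 0 < 2 `^ (de / 8) :> R := powR2_gt0 _.
have H := energy_off_diagonal n0 A1 B1 (ltW b0) bn r0 t0 M0 PA f1 f2 g1 gM'.
rewrite -/D rA rB in H; apply: (le_trans H).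
have -> : C0 * (2 + 2 * C0) * Lam * 2 `^ (- eps * (x - y)) * (u + v) =
  C0 * ((2 + 2 * C0) * Lam * 2 `^ (- eps * (x - y)) * (u + v)) by ring.
apply: ler_wpM2l; first exact: C0p.
set e := 2 `^ (- eps * (x - y)).
have de0 : 0 <= de by rewrite subr_ge0.
have e8 : 2 `^ (- (de / 8)) <= e.
  by apply: powR2_le; rewrite -/de mulNr lerN2 mulrC; apply: ler_wpM2l.
have es : 2 `^ (- (de * (s / 4))) <= e.
  by apply: powR2_le; rewrite -/de mulNr lerN2 mulrC; apply: ler_wpM2l.
have e0 : 0 <= e by exact: powR_ge0.
have t1 : 2 `^ (de / 8) * (Lam * 2 `^ (x - de / 4)) * norm2sq f <= Lam * e * u.
  have -> : 2 `^ (de / 8) * (Lam * 2 `^ (x - de / 4)) * norm2sq f =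
      Lam * 2 `^ (- (de / 8)) * u.
    rewrite /u; have -> : 2 `^ (x - de / 4) = 2 `^ (- (de / 8)) * 2 `^ (- (de
      / 8)) * 2 `^ x :> R.
      by rewrite -!powR2D; congr (_ `^ _); field.
    have ee : 2 `^ (de / 8) * 2 `^ (- (de / 8)) = 1 :> R.
      by rewrite -powR2D subrr powRr0.
    transitivity ((2 `^ (de / 8) * 2 `^ (- (de / 8))) *
      (Lam * 2 `^ (- (de / 8)) * (2 `^ x * norm2sq f))); first by ring.
    by rewrite ee mul1r.
  by apply: ler_wpM2r => //; apply: ler_wpM2l => //; exact: ltW.
have t2 : 2 * C0 * Lam * v / 2 `^ (de / 8) <= 2 * C0 * Lam * e * v.
  have -> : 2 * C0 * Lam * e * v = 2 * C0 * Lam * v * e by ring.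
  by rewrite -powRN; apply: ler_wpM2l.
have t3 : Lam * 2 `^ (- (x - de / 4) * s) * (norm1 f * norm1 g) <= Lam * e *
  (u + v).
  rewrite -[leLHS]mulrA -[leRHS]mulrA; apply: ler_wpM2l; first exact: ltW.
  (* Chosen so that the two squares, whose block bounds differ by the factor 2^(de + s de), both end
     with the same gain 2^(-s de/4). *)
  pose sg : R := 2 `^ (s * de / 2).
  have sg0 : 0 < sg := powR2_gt0 _.
  have am : norm1 f * norm1 g <= sg^-1 * norm1 f ^+ 2 + sg * norm1 g ^+ 2.
    have e1 : sg^-1 * norm1 f ^+ 2 + sg * norm1 g ^+ 2 =
        sg^-1 * (norm1 f ^+ 2 + (sg * norm1 g) ^+ 2).
      by field; rewrite gt_eqF.
    rewrite e1 [leRHS]mulrC ler_pdivlMr//.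
    have := sqr_ge0 (norm1 f - sg * norm1 g); have := sqr_ge0 (norm1 f).
    have := sqr_ge0 (sg * norm1 g); nra.
  apply: (le_trans (ler_wpM2l (powR_ge0 _ _) am)).
  rewrite mulrDr [leRHS]mulrDr; apply: lerD.
    rewrite mulrA; apply: (le_trans (ler_wpM2l _ fN)).
      by rewrite mulr_ge0 ?powR_ge0// invr_ge0 ltW.
    rewrite /u [leLHS]mulrA [leRHS]mulrA; apply: ler_wpM2r => //.
    rewrite /sg -powRN /e -!powR2D; apply: powR2_le.
    have -> : - (x - de / 4) * s + - (s * de / 2) + (x + x * s) = - (de * (s /
      4)) + x by field.
    rewrite lerD2r -/de mulNr lerN2 mulrC; apply: ler_wpM2l => //.
  rewrite mulrA; apply: (le_trans (ler_wpM2l _ gN)).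
    by rewrite mulr_ge0 ?powR_ge0// ltW.
  rewrite /v [leLHS]mulrA [leRHS]mulrA; apply: ler_wpM2r => //.
  rewrite /sg /e -!powR2D; apply: powR2_le.
  have -> : - (x - de / 4) * s + s * de / 2 + (y + y * s) = - (de * (s / 4)) +
    y.
    by rewrite /de; field.
  rewrite lerD2r -/de mulNr lerN2 mulrC; apply: ler_wpM2l => //.
apply: (le_trans (lerD (lerD t1 t2) t3)).
rewrite -subr_ge0 (_ : _ - _ = Lam * e * (v + 2 * C0 * u)); last by ring.
rewrite mulr_ge0//; first by rewrite mulr_ge0// ltW.
by rewrite addr_ge0// !mulr_ge0.
Qed.

(** Schur's test for the matrix rho^|i-j|, rho = 2^(-eps): rows and columns each sum to at most 2 /
    (1 - rho), whence the 4. *)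
Lemma energy_sum_blocks P N (K : R) (F : 'I_N -> E -> R) :
  admissible a b A B P -> (forall i : 'I_N, block (i%:R - K) (F i)) ->
  energy P (fun x => \sum_(i < N) F i x) (fun x => \sum_(i < N) F i x) <=
  C0 * (2 + 2 * C0) * Lam * (4 / (1 - 2 `^ (- eps))) *
    \sum_(i < N) 2 `^ (i%:R - K) * norm2sq (F i).
Proof.
move=> PA FB; pose rho : R := 2 `^ (- eps).
have rho0 : 0 <= rho by exact: powR_ge0.
have rho1 : rho < 1.
  have l2 : 0 < ln 2 :> R by rewrite ln_gt0//; lra.
  by rewrite /rho /powR gt_eqF// -[ltRHS]expR0 ltr_expR mulNr oppr_lt0 mulr_gt0.
pose al (i : 'I_N) : R := 2 `^ (i%:R - K) * norm2sq (F i).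
have al0 i : 0 <= al i by rewrite mulr_ge0 ?powR_ge0// norm2sq_ge0.
have C1 : 1 <= C0 := scale_constant_ge1.
set C := C0 * (2 + 2 * C0) * Lam.
have C0p : 0 <= C0 by exact: le_trans C1.
have Lamp : 0 <= Lam by exact: ltW.
have C_ge0 : 0 <= C := mulr_ge0 (mulr_ge0 C0p
  (addr_ge0 (ler0n _ 2) (mulr_ge0 (ler0n _ 2) C0p))) Lamp.
have pair (i j : 'I_N) : `|energy P (F i) (F j)| <=
    C * (rho ^+ (i - j + (j - i)) * (al i + al j)).
  wlog ji : i j / (j <= i)%N.
    move=> H; have [/H//|/ltnW/H] := leqP j i.
    by rewrite energyC addnC [al j + _]addrC.
  have ji' : j%:R - K <= i%:R - K :> R by rewrite lerD2r ler_nat.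
  rewrite (le_trans (energy_two_blocks ji' PA (FB i) (FB j)))//
    -/C -/(al i) -/(al j).
  rewrite (_ : (j - i = 0)%N) ?addn0; last by apply/eqP; rewrite subn_eq0.
  rewrite -mulrA; apply: ler_wpM2l => //; apply: ler_wpM2r;
    first by rewrite addr_ge0.
  rewrite /rho -powR_mulrn ?powR_ge0// -powRrM natrB//.
  by rewrite (_ : i%:R - K - (j%:R - K) = i%:R - j%:R)//; ring.
rewrite energy_sum; last by move=> i; have [] := FB i.
apply: (@le_trans _ _ (\sum_(i < N) \sum_(j < N)
    C * (rho ^+ (i - j + (j - i)) * (al i + al j)))).
  by apply: ler_sum => i _; apply: ler_sum => j _;
    rewrite (le_trans (ler_norm _)).
have row (i : 'I_N) : \sum_(j < N) rho ^+ (i - j + (j - i)) * al i <=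
    2 / (1 - rho) * al i.
  by rewrite -mulr_suml; apply: ler_wpM2r => //; exact: geometric_dist_sum_le.
have -> : \sum_(i < N) \sum_(j < N) C * (rho ^+ (i - j + (j - i)) * (al i + al
  j)) =
  C * (\sum_(i < N) \sum_(j < N) rho ^+ (i - j + (j - i)) * al i +
       \sum_(i < N) \sum_(j < N) rho ^+ (i - j + (j - i)) * al i).
  rewrite [X in _ = C * (_ + X)]exchange_big/= -big_split/= mulr_sumr.
  apply: eq_bigr => i _; rewrite -big_split/= mulr_sumr; apply: eq_bigr => j _.
  by rewrite mulrDr [(j - i + _)%N]addnC.
rewrite -[leRHS]mulrA; apply: ler_wpM2l => //.
have rows : \sum_(i < N) \sum_(j < N) rho ^+ (i - j + (j - i)) * al i <=
    2 / (1 - rho) * \sum_(i < N) al i.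
  by rewrite mulr_sumr; apply: ler_sum => i _.
apply: (le_trans (lerD rows rows)).
by rewrite -mulrDl -/rho le_eqVlt; apply/orP; left; apply/eqP; congr (_ * _);
  ring.
Qed.

End fixed_parameters.
End energy_of_blocks.

(** * The weight attached to a function of L^(p,2) *)

(** The integral of a nonnegative function is a supremum over simple functions below it, hence
    monotone without measurability. This is applied to the integrand with the decreasing
    rearrangement and to the squared modulus of the Fourier transform. *)
Lemma ge0_le_integral_nonmeasurable d (T : measurableType d) (R : realType)
    (m : {measure set T -> \bar R}) (D : set T) (u v : T -> \bar R) :
  (forall x, D x -> (0 <= u x)%E) -> (forall x, D x -> (u x <= v x)%E) ->
  (\int[m]_(x in D) u x <= \int[m]_(x in D) v x)%E.
Proof.
move=> u0 uv; have v0 x : D x -> (0 <= v x)%E.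
  by move=> Dx; rewrite (le_trans (u0 x Dx))// uv.
rewrite !ge0_integralE//; apply: ge_ereal_sup => _ [h hu <-].
apply: ereal_sup_ubound; exists h => // x; rewrite (le_trans (hu x))//.
rewrite !patchE; case: ifPn => // /set_mem; exact: uv.
Qed.

Lemma measurable_set_ge0 d (T : measurableType d) (R : realType) (h : T -> R) :
  measurable_fun setT h -> measurable [set x | 0 <= h x].
Proof.
move=> mh; rewrite (_ : [set x | _] = setT `&` h @^-1` `[0, +oo[%classic).
  by apply: mh => //; exact: measurable_itv.
by apply/seteqP; split => x /=; rewrite in_itv/= andbT; [|case].
Qed.

Lemma measurable_set_gt0 d (T : measurableType d) (R : realType) (h : T -> R) :
  measurable_fun setT h -> measurable [set x | 0 < h x].
Proof.
move=> mh; rewrite (_ : [set x | _] = setT `&` h @^-1` `]0, +oo[%classic).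
  by apply: mh => //; exact: measurable_itv.
by apply/seteqP; split => x /=; rewrite in_itv/= andbT; [|case].
Qed.

Section rearrangement_weight.
Context d (T : measurableType d) (R : realType).
Variable m : {sigma_finite_measure set T -> \bar R}.
Variable g : T -> R.
Hypotheses (mg : measurable_fun setT g) (g0 : forall x, 0 <= g x).
Hypothesis ig : (\int[m]_x (g x)%:E < +oo)%E.
Variable kap : R.
Hypotheses (kap0 : 0 < kap) (kap1 : kap <= 1).
Local Notation mu := (@lebesgue_measure R).

(** For s > 0 the measure is finite by Markov's inequality ([EFin_tail]), and [fine] loses nothing.
    Points where [g] vanishes, whose tail may be a default value, are met only with the factor
    g(x)^2 = 0 or are excluded by the condition 0 < g(x). *)
Definition tail (s : R) : R := fine (m [set x | s <= g x]).

(* The space [L^{p,2}], [2 / p = 1 + kap], is the union of the spaces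
   [L^2(weight)], and this weight is the extremal one for [g]. *)
Definition weight (x : T) : R := tail (g x) `^ kap.

Lemma measurable_superlevel s : measurable [set x | s <= g x].
Proof.
rewrite (_ : [set x | _] = [set x | 0 <= g x - s]).
  by apply: measurable_set_ge0; exact: measurable_funB.
by apply/seteqP; split => x /=; rewrite subr_ge0.
Qed.

Lemma tail_ge0 s : 0 <= tail s. Proof. exact: fine_ge0. Qed.

Lemma EFin_tail (s : R) : 0 < s -> (tail s)%:E = m [set x | s <= g x].
Proof.
move=> s0; rewrite /tail fineK// ge0_fin_numE//.
have H : (s%:E * m [set x | (s <= g x)%R] <= \int[m]_x (g x)%:E)%E.
  have mI : measurable_fun setT (EFin \o (\1_[set x | s <= g x] : T -> R)).
    by apply/measurable_EFinP/measurable_indic; exact: measurable_superlevel.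
  rewrite -[X in (_ * m X)%E]setIT -(integral_indic m measurableT
    (measurable_superlevel s)).
  rewrite -ge0_integralZl//; last by rewrite lee_fin ltW.
  apply: ge0_le_integral => //.
  - by move=> x _; rewrite mule_ge0// lee_fin ltW.
  - exact: measurable_funeM.
  - exact/measurable_EFinP.
  - move=> x _; rewrite -EFinM lee_fin indicE.
    have [/set_mem/= sg|_] := boolP (x \in _); first by rewrite mulr1.
    by rewrite mulr0.
rewrite -lee_pdivlMl// in H; apply: (le_lt_trans H).
by rewrite lte_mul_pinfty// ?lee_fin ?invr_ge0 ?ltW.
Qed.

Lemma tail_antitone (s t : R) : 0 < s -> s <= t -> tail t <= tail s.
Proof.
move=> s0 st; rewrite -lee_fin !EFin_tail//; last exact: lt_le_trans st.
apply: le_measure; rewrite ?inE; [exact: measurable_superlevel..|].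
by move=> x /=; exact: le_trans.
Qed.

Lemma measurable_tail : measurable_fun setT (tail : measurableTypeR R -> R).
Proof.
pose A : set (measurableTypeR R * T) := [set z | 0 <= g z.2 - z.1].
have mA : measurable A.
  apply: (measurable_set_ge0 (h := fun z : measurableTypeR R * T =>
    g z.2 - z.1)).
  apply: measurable_funB.
    exact: (measurableT_comp mg measurable_snd).
  exact: measurable_fst.
have := measurable_fun_xsection m mA => H.
have -> : tail = fine \o (m \o xsection A).
  apply/funext => s; rewrite /tail/=; congr (fine (m _)).
  by apply/seteqP; split => x; rewrite /xsection/= inE/A/= subr_ge0.
exact: (measurableT_comp (f := fine)).
Qed.

Lemma measurable_weight : measurable_fun setT weight.
Proof.
apply: (measurableT_comp (measurable_powR kap)).
exact: (measurableT_comp measurable_tail mg).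
Qed.

Lemma measurable_weight_sublevel (T0 : R) :
  measurable [set x | 0 < g x /\ tail (g x) <= T0].
Proof.
rewrite (_ : [set x | _] = [set x | 0 < g x] `&` [set x | 0 <= T0 - tail (g
  x)]).
  apply: measurableI; first exact: measurable_set_gt0.
  apply: measurable_set_ge0; apply: measurable_funB => //.
  exact: (measurableT_comp measurable_tail mg).
by apply/seteqP; split => x /=; rewrite subr_ge0.
Qed.

(** As the tail is antitone, this set lies above the infimum s0 of the heights whose tail is at most
    [T0]. If s0 is such a height, the set is inside {g >= s0}; otherwise it is inside {g > s0}, the
    increasing union of the sets {g >= s0 + 1/(k+1)}, each of measure at most [T0]. *)
Lemma measure_weight_sublevel (T0 : R) : 0 <= T0 ->
  (m [set x | (0 < g x)%R /\ (tail (g x) <= T0)%R] <= T0%:E)%E.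
Proof.
move=> T00; set S := [set x | _].
pose Z := [set s | 0 < s /\ tail s <= T0].
have [[x0 Sx0]|S0] := pselect (S !=set0); last first.
  have -> : S = set0 by apply: contrapT => /eqP/set0P.
  by rewrite measure0 lee_fin.
have Z0 : Z !=set0 by exists (g x0).
have lZ : lbound Z 0 by move=> s [/ltW].
have hZ : has_inf Z by split => //; exists 0.
pose s0 := inf Z.
have s00 : 0 <= s0 by exact: lb_le_inf.
have mS : measurable S by exact: measurable_weight_sublevel.
have [s0Z|s0Z] := pselect (Z s0).
  have [s0p ts0] := s0Z.
  apply: (@le_trans _ _ (tail s0)%:E); last by rewrite lee_fin.
  rewrite EFin_tail//; apply: le_measure; rewrite ?inE//;
    first exact: measurable_superlevel.
  by move=> x Sx /=; apply: inf_lbound => //; exists 0.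
pose F (k : nat) := [set x | s0 + k.+1%:R^-1 <= g x].
have mF k : measurable (F k) by exact: measurable_superlevel.
have FT0 k : (m (F k) <= T0%:E)%E.
  have k0 : 0 < k.+1%:R^-1 :> R by rewrite invr_gt0.
  have [z [z0 zT] zk] := inf_adherent k0 hZ.
  rewrite -EFin_tail ?lee_fin; last by rewrite ltr_wpDl.
  by rewrite (le_trans (tail_antitone z0 (ltW zk))).
have ndF : nondecreasing_seq F.
  move=> k l kl; rewrite subsetEset => x /=; apply: le_trans.
  by rewrite lerD2l lef_pV2 ?posrE// ler_nat.
apply: (@le_trans _ _ (m (\bigcup_k F k))).
  apply: le_measure; rewrite ?inE//; first exact: bigcup_measurable.
  move=> x Sx; have gs : s0 < g x.
    rewrite lt_neqAle; apply/andP; split; last by apply: inf_lbound => //;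
      exists 0.
    by apply/eqP => e; apply: s0Z; rewrite e.
  have d0 : 0 < g x - s0 by rewrite subr_gt0.
  exists (Num.trunc (g x - s0)^-1) => //=.
  rewrite /F/= -lerBrDl invf_ple ?posrE//; last by rewrite ltW//
    Num.Theory.truncnS_gt.
have mbF : measurable (\bigcup_k F k) by exact: bigcup_measurable.
have cF := nondecreasing_cvg_mu (mu := m) mF mbF ndF.
rewrite -(cvg_lim _ cF)//; apply: lime_le; first by apply/cvg_ex; eexists;
  exact: cF.
by apply: nearW => k; exact: FT0.
Qed.

(** The integral of s tail(s)^(1+kap) over s > 0 is, up to a constant, the squared norm of L^(p,2)
    written with the distribution function; it is the intermediate term between the weighted norm
    and the rearrangement. *)
Let j s : R := \1_[set s : R | 0 < s] s * (s * tail s `^ kap * tail s).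

Let measurable_pos : measurable [set s : measurableTypeR R | 0 < s].
Proof. exact: (measurable_set_gt0 (h := fun s : measurableTypeR R => s)). Qed.

Let measurable_j : measurable_fun setT (j : measurableTypeR R -> R).
Proof.
apply: measurable_funM; first exact: measurable_indic.
apply: measurable_funM; last exact: measurable_tail.
apply: measurable_funM => //.
exact: (measurableT_comp (measurable_powR kap) measurable_tail).
Qed.

Lemma integral_indic_scale (U : set (measurableTypeR R)) (c : R) :
  measurable U ->
  0 <= c -> (\int[mu]_s (\1_U s * c)%:E = mu U * c%:E)%E.
Proof.
move=> mU c0.
have mI : measurable_fun setT (EFin \o (\1_U : measurableTypeR R -> R)).
  by apply/measurable_EFinP; exact: measurable_indic.
transitivity (\int[mu]_s ((\1_U s)%:E * c%:E))%E.
  by apply: eq_integral => s _; rewrite EFinM.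
by rewrite ge0_integralZr// ?lee_fin// integral_indic// setIT.
Qed.

(** For s in [g(x)/2, g(x)] one has s tail(s)^kap >= (g(x)/2) weight(x), because the tail is
    antitone; integrating over this interval of length g(x)/2 gives a quarter of the integrand. Then
    the order of integration is exchanged. *)
Let integral_sq_weight_le_layers :
  (\int[m]_x (g x ^+ 2 * weight x)%:E <= 4%:E * \int[mu]_s (j s)%:E)%E.
Proof.
pose A : set (measurableTypeR R * T) :=
  [set z | 0 < z.1] `&` [set z | 0 <= g z.2 - z.1].
have mA : measurable A.
  apply: measurableI.
    by apply: (measurable_set_gt0 (h := fun z : measurableTypeR R * T =>
      z.1)); exact: measurable_fst.
  apply: (measurable_set_ge0 (h := fun z : measurableTypeR R * T =>
    g z.2 - z.1)).
  apply: measurable_funB.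
    exact: (measurableT_comp mg measurable_snd).
  exact: measurable_fst.
pose k (z : measurableTypeR R * T) : \bar R :=
  (\1_A z * (z.1 * tail z.1 `^ kap))%:E.
have mk : measurable_fun setT k.
  apply/measurable_EFinP; apply: measurable_funM; first exact: measurable_indic.
  apply: measurable_funM; first exact: measurable_fst.
  apply: (measurableT_comp (measurable_powR kap)).
  exact: (measurableT_comp measurable_tail measurable_fst).
have k0 z : (0 <= k z)%E.
  rewrite lee_fin /k indicE; have [/set_mem[z1 _]|_] := boolP (z \in A).
    by rewrite mul1r mulr_ge0 ?powR_ge0// ltW.
  by rewrite mul0r.
have kj s : (\int[m]_x k (s, x) = (j s)%:E)%E.
  rewrite /k /j/= [in RHS]indicE; have [/set_mem/= s0|/negP s0] :=
    boolP (s \in _).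
    rewrite mul1r EFinM EFin_tail// -[X in (_ * m X)%E]setIT.
    rewrite -(integral_indic m measurableT (measurable_superlevel s)).
    have c0 : 0 <= s * tail s `^ kap by rewrite mulr_ge0 ?powR_ge0// ltW.
    rewrite -ge0_integralZl//; last first.
      by apply/measurable_EFinP/measurable_indic; exact: measurable_superlevel.
    apply: eq_integral => x _; rewrite -EFinM mulrC; congr (_ * _)%:E.
    rewrite !indicE; congr (nat_of_bool _)%:R; apply/idP/idP => /set_mem h;
      apply/mem_set.
      by move: h => -[_]; rewrite /= subr_ge0.
    by split => //=; rewrite subr_ge0.
  rewrite mul0r; apply: integral0_eq => x _; rewrite indicE.
  by rewrite memNset ?mul0r// => -[s0' _]; apply: s0; apply/mem_set.
have -> : (\int[mu]_s (j s)%:E = \int[m]_x \int[mu]_s k (s, x))%E.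
  rewrite -(fubini_tonelli k mk k0); apply: eq_integral => s _; exact/esym/kj.
have mG := measurable_fun_fubini_tonelli_G (m1 := mu) k mk k0.
rewrite -ge0_integralZl//; last by move=> x _; exact: integral_ge0.
apply: ge0_le_integral => //.
- by move=> x _; rewrite lee_fin mulr_ge0 ?powR_ge0// sqr_ge0.
- apply/measurable_EFinP; apply: measurable_funM; first exact: measurable_funX.
  exact: measurable_weight.
- exact: measurable_funeM.
move=> x _; have := g0 x; rewrite le_eqVlt => /predU1P[gx|gx].
  by rewrite -gx expr0n/= mul0r mule_ge0// integral_ge0.
pose c := g x / 2 * weight x.
have c0 : 0 <= c by rewrite mulr_ge0 ?powR_ge0// divr_ge0// ltW.
pose U : set (measurableTypeR R) := `[g x / 2, g x]%classic.
apply: (@le_trans _ _ (4%:E * \int[mu]_s (\1_U s * c)%:E)%E).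
  rewrite integral_indic_scale//; last exact: measurable_itv.
  rewrite /U lebesgue_measure_itv/= lte_fin ifT;
    last by rewrite ltr_pdivrMr//; lra.
  rewrite -EFinD -!EFinM lee_fin /c; set w := weight x.
  by rewrite le_eqVlt; apply/orP; left; apply/eqP; field.
apply: lee_wpmul2l; first by rewrite lee_fin.
apply: ge0_le_integral => //.
- by move=> s _; rewrite lee_fin mulr_ge0// indicE.
- apply/measurable_EFinP; apply: measurable_funM => //.
  by apply: measurable_indic; exact: measurable_itv.
- exact: (measurableT_comp mk (pair2_measurable x)).
move=> s _; rewrite lee_fin [X in X * c]indicE.
have [/set_mem/=|_] := boolP (s \in U); last by rewrite mul0r -lee_fin;
  exact: k0.
rewrite /U/= in_itv/= => /andP[s1 s2]; have s0 :
  0 < s by apply: lt_le_trans s1; rewrite divr_gt0.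
rewrite mul1r indicE mem_set ?mul1r; last by split => //=; rewrite subr_ge0.
apply: ler_pM => //; [by rewrite divr_ge0// ltW|exact: powR_ge0|].
by apply: ge0_ler_powR; rewrite ?nnegrE ?tail_ge0// ?(ltW kap0)//;
  exact: tail_antitone.
Qed.

(** For t in [tail(s)/2, tail(s)] one has t^kap >= tail(s)^kap / 2, as kap <= 1, so tail(s)^(1+kap)
    is at most 4 times the integral of t^kap over this interval. After the exchange, t < tail(s)
    confines s to [0, fs(t)], and s <= fs(t) there yields fs(t)^2. *)
Let integral_layers_le (fs : R -> \bar R) : (forall t,
  0 < t -> (0 <= fs t)%E) ->
  (forall s t : R, 0 < s -> 0 < t -> t < tail s -> (s%:E <= fs t)%E) ->
  (\int[mu]_s (j s)%:E <=
   4%:E * \int[mu]_(t in `]0%R, +oo[) ((t `^ kap)%:E * (fs t) ^+ 2))%E.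
Proof.
move=> fs0 Hfs.
pose B : set (measurableTypeR R * measurableTypeR R) :=
  [set z | 0 < z.1] `&` ([set z | 0 < z.2] `&` [set z | 0 < tail z.1 - z.2]).
have mB : measurable B.
  apply: measurableI.
    apply: (measurable_set_gt0 (h := fun z :
      measurableTypeR R * measurableTypeR R => z.1)).
    exact: measurable_fst.
  apply: measurableI.
    apply: (measurable_set_gt0 (h := fun z :
      measurableTypeR R * measurableTypeR R => z.2)).
    exact: measurable_snd.
  apply: (measurable_set_gt0 (h := fun z :
    measurableTypeR R * measurableTypeR R => tail z.1 - z.2)).
  apply: measurable_funB; last exact: measurable_snd.
  exact: (measurableT_comp measurable_tail measurable_fst).
pose l (z : measurableTypeR R * measurableTypeR R) : \bar R :=
  (\1_B z * (z.1 * z.2 `^ kap))%:E.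
have ml : measurable_fun setT l.
  apply/measurable_EFinP; apply: measurable_funM; first exact: measurable_indic.
  apply: measurable_funM; first exact: measurable_fst.
  exact: (measurableT_comp (measurable_powR kap) measurable_snd).
have l0 z : (0 <= l z)%E.
  rewrite lee_fin indicE; have [/set_mem[z1 _]|_] := boolP (z \in B).
    by rewrite mul1r mulr_ge0 ?powR_ge0// ltW.
  by rewrite mul0r.
have mF := measurable_fun_fubini_tonelli_F (m2 := mu) l ml l0.
have jl s : ((j s)%:E <= 4%:E * \int[mu]_t l (s, t))%E.
  rewrite /j indicE; have [/set_mem/= s0|_] := boolP (s \in _); last first.
    by rewrite mul0r mule_ge0// integral_ge0.
  rewrite mul1r; have := tail_ge0 s; rewrite le_eqVlt => /predU1P[ts|ts].
    by rewrite -ts mulr0 mule_ge0// integral_ge0.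
  pose c := s * (tail s `^ kap / 2).
  have c0 : 0 <= c by rewrite mulr_ge0 ?divr_ge0 ?powR_ge0// ltW.
  pose U : set (measurableTypeR R) := `[tail s / 2, tail s[%classic.
  apply: (@le_trans _ _ (4%:E * \int[mu]_t (\1_U t * c)%:E)%E).
    rewrite integral_indic_scale//; last exact: measurable_itv.
    rewrite /U lebesgue_measure_itv/= lte_fin ifT;
      last by rewrite ltr_pdivrMr//; lra.
    rewrite -EFinD -!EFinM lee_fin /c; set w := tail s `^ kap.
    by rewrite le_eqVlt; apply/orP; left; apply/eqP; field.
  apply: lee_wpmul2l; first by rewrite lee_fin.
  apply: ge0_le_integral => //.
  - by move=> t _; rewrite lee_fin mulr_ge0// indicE.
  - apply/measurable_EFinP; apply: measurable_funM => //.
    by apply: measurable_indic; exact: measurable_itv.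
  - exact: (measurableT_comp ml (pair1_measurable s)).
  move=> t _; rewrite lee_fin [X in X * c]indicE.
  have [/set_mem/=|_] := boolP (t \in U); last by rewrite mul0r -lee_fin;
    exact: l0.
  rewrite /U/= in_itv/= => /andP[t1 t2].
  have t0 : 0 < t by apply: lt_le_trans t1; rewrite divr_gt0.
  rewrite mul1r indicE mem_set ?mul1r; last by split => //=; split => //=;
    rewrite subr_gt0.
  apply: ler_wpM2l; first exact: ltW.
  apply: (@le_trans _ _ ((tail s / 2) `^ kap)); last first.
    by apply: ge0_ler_powR; rewrite ?nnegrE// ltW// divr_gt0.
  rewrite powRM ?tail_ge0//; apply: ler_wpM2l; first exact: powR_ge0.
  rewrite -[leLHS]powRr1//; apply: ger_powR => //.
  by rewrite invr_gt0 invf_le1//; apply/andP; split => //; lra.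
apply: (@le_trans _ _ (4%:E * \int[mu]_s \int[mu]_t l (s, t))%E).
  rewrite -ge0_integralZl//; last by move=> s _; exact: integral_ge0.
  apply: ge0_le_integral => //.
  - move=> s _; rewrite lee_fin /j indicE; have [/set_mem/= s0|_] :=
    boolP (s \in _).
      by rewrite mul1r !mulr_ge0 ?powR_ge0 ?tail_ge0// ltW.
    by rewrite mul0r.
  - exact/measurable_EFinP.
  - exact: measurable_funeM.
apply: lee_wpmul2l => //; rewrite (fubini_tonelli l ml l0)
  [leRHS]integral_mkcond.
apply: ge0_le_integral_nonmeasurable => t _; first exact: integral_ge0.
rewrite patchE; have [/set_mem/=|/negP tn] := boolP (t \in _); last first.
  rewrite integral0_eq// => s _; rewrite /l indicE memNset ?mul0r//= =>
    -[_ [t0 _]].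
  by apply: tn; apply/mem_set => /=; rewrite in_itv/= andbT.
rewrite in_itv/= andbT => t0; have := fs0 t t0; have := Hfs ^~ t.
have tk : 0 < t `^ kap by rewrite powR_gt0.
case: (fs t) => [F| |] HF F0; last 2 first.
- by rewrite /= mulry gtr0_sg// mul1e leey.
- by [].
pose c := F * t `^ kap.
rewrite lee_fin in F0.
have c0 : 0 <= c by rewrite mulr_ge0// ltW.
pose U : set (measurableTypeR R) := `[0, F]%classic.
apply: (@le_trans _ _ (\int[mu]_s (\1_U s * c)%:E)%E).
  apply: ge0_le_integral => //.
  - exact: (measurableT_comp ml (pair2_measurable t)).
  - apply/measurable_EFinP; apply: measurable_funM => //.
    by apply: measurable_indic; exact: measurable_itv.
  move=> s _; rewrite lee_fin [X in X * (_ * _)]indicE.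
  have [/set_mem/= [s0 [_ ts]]|_] := boolP (_ \in B); last first.
    by rewrite mul0r mulr_ge0// indicE.
  have sF : s <= F by rewrite -lee_fin; apply: HF => //; rewrite -subr_gt0.
  rewrite mul1r indicE mem_set ?mul1r; last by rewrite /U/= in_itv/= sF ltW.
  by apply: ler_wpM2r => //; exact: ltW.
rewrite integral_indic_scale//; last exact: measurable_itv.
rewrite /U lebesgue_measure_itv/= lte_fin; case: ifPn => [_|nF]; last first.
  by rewrite mul0e mule_ge0// lee_fin ?sqr_ge0// ltW.
rewrite -EFinD subr0 -!EFinM lee_fin /c.
by rewrite le_eqVlt; apply/orP; left; apply/eqP; ring.
Qed.

Lemma integral_sq_weight_le (fs : R -> \bar R) :
  (forall t, 0 < t -> (0 <= fs t)%E) ->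
  (forall s t : R, 0 < s -> 0 < t -> t < tail s -> (s%:E <= fs t)%E) ->
  (\int[m]_x (g x ^+ 2 * weight x)%:E <=
   16%:E * \int[mu]_(t in `]0%R, +oo[) ((t `^ kap)%:E * (fs t) ^+ 2))%E.
Proof.
move=> fs0 Hfs; apply: (le_trans integral_sq_weight_le_layers).
apply: (le_trans (lee_wpmul2l _ (integral_layers_le fs0 Hfs))); first by [].
by rewrite muleA -EFinM (_ : 4 * 4 = 16 :> R)//; ring.
Qed.

End rearrangement_weight.

(** * Decomposition along the weight *)

Lemma sum_indic_setD (R : realType) T (S : nat -> set T) y N :
  (forall i, S i `<=` S i.+1) ->
  \sum_(i < N) (\1_(S i.+1 `\` S i) y : R) = \1_(S N `\` S 0%N) y.
Proof.
move=> S1; have S0 i : S 0%N `<=` S i.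
  by elim: i => // i IH; apply: subset_trans (S1 i).
elim: N => [|N IH]; first by rewrite big_ord0 setDv indic0.
rewrite big_ord_recr/= IH !indicE !in_setD.
have h0 : y \in S 0%N -> y \in S N by rewrite !inE; exact: S0.
have h1 : y \in S N -> y \in S N.+1 by rewrite !inE; exact: S1.
move: h0 h1; case: (y \in S 0%N); case: (y \in S N); case: (y \in S N.+1) =>
  //=;
  by [move=> /(_ isT)|move=> _ /(_ isT)|rewrite ?addr0 ?add0r].
Qed.

Lemma energy_add (R : realType) n (P : probability (euclidean R n) R) u v :
  (lebesgue_euclidean R n).-integrable setT (EFin \o u) ->
  (lebesgue_euclidean R n).-integrable setT (EFin \o v) ->
  energy P (fun x => u x + v x) (fun x => u x + v x) =
  energy P u u + 2 * energy P u v + energy P v v.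
Proof.
move=> u1 v1; pose F (c : bool) := if c then u else v.
have F1 c : (lebesgue_euclidean R n).-integrable setT (EFin \o F c) by case: c.
have := energy_sum P [:: true; false] F1.
have -> : (fun x => \sum_(c <- [:: true; false]) F c x) = (fun x => u x + v x).
  by apply/funext => x; rewrite big_cons big_seq1.
have S2 (h : bool -> bool -> R) : \sum_(i <- [:: true;
  false]) \sum_(j <- [:: true; false]) h i j =
    h true true + h true false + (h false true + h false false).
  by rewrite big_cons !big_seq1 !big_cons !big_nil !addr0.
move=> ->; rewrite (S2 (fun i j => energy P (F i) (F j))) -[F true]/u -[F
  false]/v.
rewrite (energyC P v u).
move: (energy P u u) (energy P u v) (energy P v v) => p q r; ring.
Qed.

Section weighted_energy.
Context {R : realType} {n : nat}.
Local Notation E := (euclidean R n).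
Local Notation leb := (lebesgue_euclidean R n).
Local Notation L1 f := (leb.-integrable setT (EFin \o f)).
Local Notation norm1 f := (\int[leb]_x `|f x|).
Local Notation norm2sq f := (\int[leb]_x f x ^+ 2).
Variables (a b A B eps : R) (g f : E -> R).
Hypotheses (n0 : (0 < n)%N) (A1 : 1 <= A) (B1 : 1 <= B).
Hypotheses (an : a < n%:R) (b0 : 0 < b) (bn : b <= (2 * n)%:R).
Hypotheses (eps0 : 0 < eps) (eps8 : eps <= 8^-1) (epsb :
  eps <= b / (n%:R - a) / 4).
Hypotheses (mg : measurable_fun setT g) (g0 : forall x, 0 <= g x).
Hypothesis ig : (\int[leb]_x (g x)%:E < +oo)%E.
Hypotheses (mf : measurable_fun setT f) (fg : forall x, `|f x| <= g x).

Let D := n%:R - a.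
Let s := b / D.
Let kap := D / (D + b).
Let w := weight leb g kap.
Hypothesis igw : (\int[leb]_x (g x ^+ 2 * w x)%:E < +oo)%E.

Let D0 : 0 < D. Proof. by rewrite subr_gt0. Qed.

Let s0 : 0 < s. Proof. by rewrite divr_gt0. Qed.

Let kap0 : 0 < kap. Proof. by rewrite divr_gt0// addr_gt0. Qed.

Let L1g : L1 g.
Proof.
apply/integrableP; split; first exact/measurable_EFinP.
apply: le_lt_trans ig; rewrite le_eqVlt; apply/orP; left; apply/eqP.
by apply: eq_integral => x _; rewrite /= ger0_norm.
Qed.

Let L1f : L1 f.
Proof.
apply: (le_integrable measurableT _ _ L1g); first exact/measurable_EFinP.
by move=> x _ /=; rewrite lee_fin [leRHS]ger0_norm.
Qed.

Let gw x := g x ^+ 2 * w x.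

Let gw0 x : 0 <= gw x. Proof. by rewrite mulr_ge0 ?sqr_ge0// powR_ge0. Qed.

Let L1gw : L1 gw.
Proof.
have mgw : measurable_fun setT gw.
  by apply: measurable_funM; [exact: measurable_funX|exact: measurable_weight].
apply/integrableP; split; first exact/measurable_EFinP.
apply: le_lt_trans igw; rewrite le_eqVlt; apply/orP; left; apply/eqP.
by apply: eq_integral => x _; rewrite /= ger0_norm.
Qed.

(** Since 1 + s = 1 / kap, this is the set where [g] is positive and the weight is at most 2^x. *)
Let lower (x : R) : set E := [set y | 0 < g y /\ tail leb g (g y) <= 2 `^ (x +
  x * s)].

Let layer (x : R) : set E := lower x `\` lower (x - 1).

Let mlower x : measurable (lower x).
Proof. exact: measurable_weight_sublevel. Qed.

Let mlayer x : measurable (layer x).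
Proof. exact: measurableD. Qed.

Let lowerS x y : x <= y -> lower x `<=` lower y.
Proof.
move=> xy z [gz tz]; split => //; apply: (le_trans tz); apply: powR2_le.
by apply: lerD => //; apply: ler_wpM2r => //; exact: ltW.
Qed.

Let powR2_kap x : (2 `^ (x + x * s)) `^ kap = 2 `^ x.
Proof.
rewrite -powRrM; congr (_ `^ _); rewrite /s /kap; field.
by apply/andP; split; rewrite gt_eqF// addr_gt0.
Qed.

Let layer_weight x y : layer x y -> 2 `^ x <= 2 * w y.
Proof.
move=> [[gy _] /not_andP[//|/negP]]; rewrite -ltNge => ty.
have -> : x = 1 + (x - 1) by ring.
rewrite powR2D powRr1//; apply: ler_wpM2l => //.
rewrite -powR2_kap; apply: ge0_ler_powR.
- exact: ltW.
- by rewrite nnegrE powR_ge0.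
- by rewrite nnegrE tail_ge0.
- exact: ltW.
Qed.

Let measure_layer x : (leb (layer x) <= (2 `^ (x + x * s))%:E)%E.
Proof.
apply: (@le_trans _ _ (leb (lower x))).
  by apply: le_measure; rewrite ?inE// => y [].
by apply: measure_weight_sublevel => //; exact: powR_ge0.
Qed.

Let piece (S : set E) y := f y * \1_S y.

Let L1piece S : measurable S -> L1 (piece S).
Proof.
move=> mS; apply: (@integrable_mul_bounded _ _ _ _ _ _ 1) => //.
by move=> x; rewrite indicE; case: (_ \in _); rewrite ?normr1 ?normr0.
Qed.

Let piece_layer_le x y : 2 `^ x * piece (layer x) y ^+ 2 <= 2 * (gw y *
  \1_(layer x) y).
Proof.
rewrite /piece indicE; have [/set_mem yx|_] := boolP (_ \in _); last first.
  by rewrite !mulr0 expr0n/= !mulr0.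
rewrite !mulr1 /gw (_ : 2 * _ = (2 * w y) * g y ^+ 2); last by ring.
apply: ler_pM; [exact: powR_ge0|exact: sqr_ge0|exact: layer_weight|].
by rewrite -real_normK ?num_real// ler_sqr// nnegrE.
Qed.

Let L1gw_layer x : L1 (fun y => gw y * \1_(layer x) y).
Proof.
apply: (@integrable_mul_bounded _ _ _ _ _ _ 1) => // y.
by rewrite indicE; case: (_ \in _); rewrite ?normr1 ?normr0.
Qed.

Let L1piece_sq x : L1 (fun y => piece (layer x) y ^+ 2).
Proof.
have i2 : L1 (fun y => 2 `^ (- x) * 2 * (gw y * \1_(layer x) y)).
  exact: (integrableZl measurableT (2 `^ (- x) * 2) (L1gw_layer x)).
apply: (le_integrable measurableT _ _ i2).
  apply/measurable_EFinP; apply: measurable_funX.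
  by have /integrableP[/measurable_EFinP] := L1piece (mlayer x).
move=> y _ /=; rewrite lee_fin ger0_norm ?sqr_ge0//.
apply: le_trans (ler_norm _); rewrite -mulrA powRN -ler_pdivrMl ?invr_gt0
  ?powR2_gt0//.
by rewrite invrK; exact: piece_layer_le.
Qed.

(* Cauchy-Schwarz, by integrating [2 t |F| <= t^2 F^2 + 1] over the support
   of [F]. *)
Let norm1_piece_sq x : norm1 (piece (layer x)) ^+ 2 <=
  2 `^ (x + x * s) * norm2sq (piece (layer x)).
Proof.
set N1 := norm1 _; set N2 := norm2sq _; set M := 2 `^ _.
have M0 : 0 < M by exact: powR2_gt0.
have N10 : 0 <= N1 by exact: norm1_ge0.
have N20 : 0 <= N2 by exact: norm2sq_ge0.
have fin : (leb (layer x) < +oo)%E by apply: le_lt_trans (measure_layer x) _;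
  rewrite ltry.
have iI : L1 (fun y => \1_(layer x) y).
  apply/integrableP; split; first by apply/measurable_EFinP/measurable_indic.
  apply: le_lt_trans fin; rewrite -[X in (_ <= leb X)%E]setIT -integral_indic//.
  rewrite le_eqVlt; apply/orP; left; apply/eqP.
  by apply: eq_integral => y _; rewrite /= ger0_norm.
have key (t : R) : 0 < t -> 2 * t * N1 <= t ^+ 2 * N2 + M.
  move=> t0.
  have i1 : L1 (fun y => 2 * t * `|piece (layer x) y|).
    exact: (integrableZl measurableT (2 * t) (integrable_norm (L1piece (mlayer
      x)))).
  have i2 : L1 (fun y => t ^+ 2 * piece (layer x) y ^+ 2).
    exact: (integrableZl measurableT (t ^+ 2) (L1piece_sq x)).
  have H := @le_Rintegral _ _ _ leb setT
    (fun y => 2 * t * `|piece (layer x) y|)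
    (fun y => t ^+ 2 * piece (layer x) y ^+ 2 + \1_(layer x) y)
    measurableT i1 (integrableD measurableT i2 iI).
  have {}H : 2 * t * N1 <= t ^+ 2 * N2 + \int[leb]_y \1_(layer x) y.
    rewrite -RintegralZl//; last exact: (integrable_norm (L1piece (mlayer x))).
    have -> : t ^+ 2 * N2 = \int[leb]_y (t ^+ 2 * piece (layer x) y ^+ 2).
      by rewrite RintegralZl//; exact: L1piece_sq.
    rewrite -RintegralD//; apply: H => y _; rewrite /piece indicE.
    have [_|_] := boolP (_ \in _); last first.
      by rewrite !mulr0 normr0 expr0n/= mulr0 mulr0 addr0.
    rewrite mulr1; have := sqr_ge0 (t * `|f y| - 1);
      rewrite -[f y ^+ 2]real_normK ?num_real//.
    by rewrite /= sqrrB1 exprMn mulr1n -mulr_natl mulrA; lra.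
  apply: (le_trans H); apply: lerD => //.
  by rewrite -lee_fin EFin_Rintegral// integral_indic// setIT;
    exact: measure_layer.
move: N10; rewrite le_eqVlt => /predU1P[<-|N10].
  by rewrite expr0n/= mulr_ge0// ltW.
(* With t = M / N1 the left side of [key] is 2 M, and cancelling one [M] leaves N1^2 <= M N2. *)
have t0 : 0 < M / N1 by rewrite divr_gt0.
have := key _ t0; rewrite (_ : 2 * (M / N1) * N1 = 2 * M); last by field;
  rewrite gt_eqF.
rewrite exprMn exprVn => h.
have {}h : M * 1 <= M * (M * N2 / N1 ^+ 2).
  have -> : M * (M * N2 / N1 ^+ 2) = M ^+ 2 / N1 ^+ 2 * N2 by ring.
  lra.
rewrite ler_pM2l// in h.
by rewrite -[leLHS]mul1r -ler_pdivlMr// exprn_gt0.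
Qed.

Let block_piece x : block a b x (piece (layer x)).
Proof. by split; [exact: L1piece|exact: L1piece_sq|exact: norm1_piece_sq]. Qed.

(** The shift by 1 makes the layer of index i - K the difference of two consecutive levels;
    [support K] then gathers the layers -K, ..., K. *)
Let level K i := lower (i%:R - 1 - K%:R).

Let support K := level K (2 * K).+1 `\` level K 0.

Let msupport K : measurable (support K).
Proof. by apply: measurableD; exact: mlower. Qed.

Let layerE K i : layer (i%:R - K%:R) = level K i.+1 `\` level K i.
Proof.
by rewrite /layer /level -natr1; congr (lower _ `\` lower _); ring.
Qed.

Let sum_layer K y :
  \sum_(i < (2 * K).+1) (\1_(layer (i%:R - K%:R)) y : R) = \1_(support K) y.
Proof.
rewrite /support -(sum_indic_setD _ _ (S := level K)); last first.
  by move=> i; apply: lowerS; rewrite lerB// lerB// ler_nat.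
by apply: eq_bigr => i _; rewrite layerE.
Qed.

Let C0 := @scale_constant R n.
Let Lam := A `^ (b / (D + b)) * B `^ (D / (D + b)).
Let CE := C0 * (2 + 2 * C0) * Lam * (4 / (1 - 2 `^ (- eps))).

Let CE_ge0 : 0 <= CE.
Proof.
have c0 : 0 <= C0 by apply: le_trans scale_constant_ge1.
have r1 : 2 `^ (- eps) <= 1 :> R 
    by rewrite -[leRHS](powRr0 2); apply: powR2_le; rewrite oppr_le0 ltW.
have l0 : 0 <= Lam by rewrite mulr_ge0// powR_ge0.
have h : 0 <= 4 / (1 - 2 `^ (- eps)) :> R by rewrite divr_ge0// subr_ge0.
exact: (mulr_ge0 (mulr_ge0 (mulr_ge0 c0 (addr_ge0 (ler0n _ 2) (mulr_ge0 (ler0n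
  _ 2) c0))) l0) h).
Qed.

Let energy_piece P K : admissible a b A B P ->
  energy P (piece (support K)) (piece (support K)) <= CE * (2 * \int[leb]_x gw
    x).
Proof.
move=> PA.
have e : piece (support K) = (fun y => \sum_(i < (2 * K).+1) piece (layer
  (i%:R - K%:R)) y).
  by apply/funext => y; rewrite /piece -sum_layer mulr_sumr.
rewrite e; apply: (le_trans (energy_sum_blocks n0 A1 B1 an b0 bn eps0 eps8
  epsb PA
  (fun i : 'I__ => block_piece (i%:R - K%:R)))).
apply: ler_wpM2l => //.
have i1 (i : 'I_(2 * K).+1) : L1 (fun y =>
  2 * (gw y * \1_(layer (i%:R - K%:R)) y)).
  exact: (integrableZl measurableT 2 (L1gw_layer _)).
have [i2 e2] := Rintegral_sum (index_enum 'I_(2 * K).+1) i1.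
have i3 : L1 (fun x => 2 * gw x) by exact: (integrableZl measurableT 2 L1gw).
rewrite -RintegralZl//.
apply: (@le_trans _ _ (\int[leb]_y
    \sum_(i < (2 * K).+1) 2 * (gw y * \1_(layer (i%:R - K%:R)) y))); last first.
  apply: le_Rintegral => // y _; rewrite -mulr_sumr -mulr_sumr sum_layer.
  apply: ler_wpM2l => //; apply: ler_piMr => //.
rewrite e2; apply: ler_sum => i _.
have <- : \int[leb]_y (2 `^ (i%:R - K%:R) * piece (layer (i%:R - K%:R)) y ^+
  2) =
    2 `^ (i%:R - K%:R) * norm2sq (piece (layer (i%:R - K%:R))).
  by rewrite RintegralZl//; exact: L1piece_sq.
apply: (le_Rintegral measurableT _ (i1 i)); last by move=> y _;
  exact: piece_layer_le.
exact: (integrableZl measurableT (2 `^ (i%:R - K%:R)) (L1piece_sq _)).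
Qed.

Let natr_le_powR2 (K : nat) : K%:R <= 2 `^ K%:R :> R.
Proof. by rewrite powR_mulrn// -natrX ler_nat ltnW// ltn_expl. Qed.

(** The excluded points have weight 0 although [g] is positive there: they belong to no layer, and
    form a null set by [measure_weight_sublevel] at level 0. Any other point with g(y) > 0 has a
    positive finite weight and lies in [support K] for large K. *)
Let piece_cvg y : ~ (0 < g y /\ tail leb g (g y) <= 0) ->
  \forall K \near \oo, piece (~` support K) y = 0.
Proof.
move=> gt; have := g0 y; rewrite le_eqVlt => /predU1P[gy|gy].
  apply: nearW => K; have := fg y; rewrite -gy normr_le0 => /eqP fy.
  by rewrite /piece fy mul0r.
have ty : 0 < tail leb g (g y).
  by rewrite ltNge; apply/negP => ty; apply: gt.
set T := tail leb g (g y) in ty gt *.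
(* From here on K > T + 1/T, and K <= 2^K places T between 2^(-K) and 2^K. *)
exists (Num.trunc (T + T^-1)).+1 => // K /= hK.
have TK : T + T^-1 < K%:R.
  by apply: lt_le_trans (Num.Theory.truncnS_gt _) _; rewrite ler_nat.
have Ti : 0 < T^-1 by rewrite invr_gt0.
have K2 := natr_le_powR2 K.
have K0 : 0 <= K%:R :> R by [].
rewrite /piece indicE memNset ?mulr0// => -[]; split.
  rewrite /level /lower/= -/T; split => //.
  apply: (@le_trans _ _ (2 `^ K%:R)); first lra.
  apply: powR2_le; rewrite -natr1 natrM mulr_natl.
  rewrite (_ : K%:R *+ 2 + 1 - 1 - K%:R = K%:R :> R); last by ring.
  by rewrite lerDl mulr_ge0// ltW.
rewrite /level /lower/= -/T => -[_]; apply/negP; rewrite -ltNge.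
apply: (@le_lt_trans _ _ (2 `^ (- K%:R))).
  apply: powR2_le; rewrite sub0r.
  have : 0 <= (1 + K%:R) * s by rewrite mulr_ge0 ?addr_ge0// ltW.
  lra.
rewrite powRN invf_plt ?posrE ?powR2_gt0//; lra.
Qed.

Let norm1_piece_cvg : norm1 (piece (~` support K)) @[K --> \oo] --> 0.
Proof.
have mfK K : measurable_fun setT (fun y => `|piece (~` support K) y|%:E).
  apply/measurable_EFinP; apply: measurableT_comp => //.
  have /integrableP[/measurable_EFinP] := L1piece (measurableC (msupport K)).
  by [].
have ae0 : {ae leb, forall y, setT y ->
    (fun K => `|piece (~` support K) y|%:E) @ \oo --> (cst 0%E :
      E -> \bar R) y}.
  exists [set y | 0 < g y /\ tail leb g (g y) <= 0]; split.
  - exact: measurable_weight_sublevel.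
  - apply/eqP; rewrite eq_le measure_ge0 andbT.
    exact: (measure_weight_sublevel mg g0 ig (lexx 0)).
  - move=> y /= ny; apply: contrapT => h; apply: ny => _.
    apply: cvg_near_cst; have := piece_cvg h; apply: filterS => K ->.
    by rewrite normr0.
have dom : {ae leb, forall y (K : nat), setT y ->
    (`| `|piece (~` support K) y|%:E | <= (g y)%:E)%E}.
  apply: aeW => y K _; rewrite /= normr_id lee_fin /piece normrM.
  apply: (@le_trans _ _ `|f y|) => //; apply: ler_piMr => //.
  by rewrite indicE; case: (_ \in _); rewrite ?normr1 ?normr0.
have [_ _] := dominated_convergence measurableT mfK (measurable_cst _) ae0 L1g
  dom.
rewrite integral0 => /fine_cvg; exact.
Qed.

(** In the application [g] is the modulus of a complex function and [f] its real or imaginary part,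
    so that both parts share one weight. By the linearized Cauchy-Schwarz inequality with t = 1,
    q(u+v, u+v) <= 3 q(u, u) + 3 q(v, v); the layers [u] contribute at most 2 CE times the weighted
    norm, whence the 6, and the rest [v] tends to 0 in L^1. *)
Lemma energy_weighted P : admissible a b A B P ->
  energy P f f <= 6 * CE * \int[leb]_x gw x.
Proof.
move=> PA; set W := \int[leb]_x gw x.
have H K : energy P f f <= 6 * CE * W + 3 * norm1 (piece (~` support K)) ^+ 2.
  set u := piece (support K); set v := piece (~` support K).
  have u1 : L1 u by exact: L1piece.
  have v1 : L1 v by apply: L1piece; exact: measurableC.
  have e : f = (fun y => u y + v y).
    apply/funext => y; rewrite /u /v /piece -mulrDr.
    by rewrite !indicE in_setC; case: (_ \in _); rewrite ?addr0 ?add0r mulr1.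
  rewrite (etrans (congr2 (energy P) e e) (energy_add P u1 v1)).
  have := energy_sq_amgm P u1 v1 ltr01; have := ler_norm (energy P u v).
  have := normr_energy P v1 v1; have := ler_norm (energy P v v).
  have := energy_piece K PA; rewrite -/u -/W -expr2 divr1 mul1r.
  have -> : 6 * CE * W = 3 * (CE * (2 * W)) by ring.
  move: (energy P u u) (energy P u v) (energy P v v) (CE * _) (norm1 v ^+ 2).
  move=> uu uv vv q N; lra.
have cv : 6 * CE * W + 3 * norm1 (piece (~` support K)) ^+ 2 @[K --> \oo] -->
  6 * CE * W.
  rewrite -[X in _ --> X]addr0 -(mulr0 3) -(mulr0 0) -expr2.
  apply: cvgD; first exact: cvg_cst.
  apply: cvgM; first exact: cvg_cst.
  by rewrite expr2; apply: cvgM; exact: norm1_piece_cvg.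
rewrite -(cvg_lim _ cv)//; apply: limr_ge; first by apply/cvg_ex; eexists;
  exact: cv.
by apply: nearW => K; exact: H.
Qed.

End weighted_energy.

(** * The restriction estimate *)

Section lorentz_norm.
Context d (T : measurableType d) (R : realType).
Variable m : {sigma_finite_measure set T -> \bar R}.
Implicit Type f : T -> R[i].

Lemma normcE2 (z : R[i]) : normc z = Num.sqrt (complex.Re z ^+ 2 + complex.Im
  z ^+ 2).
Proof. by case: z. Qed.

Lemma normc_ge0 (z : R[i]) : 0 <= normc z.
Proof. by rewrite normcE2 sqrtr_ge0. Qed.

Lemma normr_Re_le (z : R[i]) : `|complex.Re z| <= normc z.
Proof. by rewrite normcE2 -sqrtr_sqr; apply: ler_wsqrtr;
  rewrite lerDl sqr_ge0. Qed.

Lemma normr_Im_le (z : R[i]) : `|complex.Im z| <= normc z.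
Proof. by rewrite normcE2 -sqrtr_sqr; apply: ler_wsqrtr;
  rewrite lerDr sqr_ge0. Qed.

Lemma measurable_normc f : measurable_complex f ->
  measurable_fun setT (fun x => normc (f x)).
Proof.
move=> [fR fI].
have -> : (fun x => normc (f x)) =
    Num.sqrt \o (fun x => complex.Re (f x) ^+ 2 + complex.Im (f x) ^+ 2).
  by apply/funext => x; rewrite /= normcE2.
apply: measurableT_comp.
  by apply: continuous_measurable_fun => x; exact: sqrt_continuous.
by apply: measurable_funD; exact: measurable_funX.
Qed.

Lemma decreasing_rearrangement_ge0 f t :
  (0 <= decreasing_rearrangement m f t)%E.
Proof. by apply: le_ereal_inf_tmp => _ [s [s0 _] <-]; rewrite lee_fin. Qed.

(** For s' < s the strict superlevel set at s' contains the set {|f| >= s}; so no such s' competes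
    in the infimum when the latter has measure above t. *)
Lemma decreasing_rearrangement_ge_tail f (s t : R) : integrable_complex m f ->
  0 < s -> t < tail m (fun x => normc (f x)) s ->
  (s%:E <= decreasing_rearrangement m f t)%E.
Proof.
move=> [mf If] s0 ts; have mg := measurable_normc mf.
apply: le_ereal_inf_tmp => _ [s' [s'0 ms'] <-]; rewrite lee_fin leNgt;
  apply/negP => s's.
move: ts; apply/negP; rewrite -leNgt -lee_fin.
rewrite (EFin_tail mg (fun x => normc_ge0 (f x)) If s0).
apply: le_trans ms'; apply: le_measure; rewrite ?inE.
- exact: measurable_superlevel.
- rewrite (_ : [set x | _] = [set x | 0 < normc (f x) - s']).
    by apply: measurable_set_gt0; exact: measurable_funB.
  by apply/seteqP; split => x /=; rewrite subr_gt0.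
- by move=> x /=; exact: lt_le_trans.
Qed.

Lemma lorentz_norm_sq (p : R) f : 0 < p ->
  (lorentz_norm m p 2 f ^+ 2 = \int[lebesgue_measure]_(t in `]0%R, +oo[)
     ((t `^ (2 / p - 1))%:E * (decreasing_rearrangement m f t) ^+ 2))%E.
Proof.
move=> p0; have step : (\int[lebesgue_measure]_(t in `]0%R, +oo[)
     (((t `^ p^-1)%:E * decreasing_rearrangement m f t) `^ 2 * (t^-1)%:E) =
  \int[lebesgue_measure]_(t in `]0%R, +oo[)
     ((t `^ (2 / p - 1))%:E * (decreasing_rearrangement m f t) ^+ 2))%E.
  apply: eq_integral => t /set_mem/=; rewrite in_itv/= andbT => t0.
  have := decreasing_rearrangement_ge0 f t.
  have tp (q : R) : 0 < t `^ q by exact: powR_gt0.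
  case: (decreasing_rearrangement m f t) => [r| |] r0 //.
    rewrite -!EFinM; congr EFin.
    rewrite (powR_mulrn 2) ?mulr_ge0 ?powR_ge0// exprMn mulrAC -expr2;
      congr (_ * _).
    rewrite -[X in X / t](powR_mulrn 2) ?powR_ge0//
      -powRrM mulrC -[t^-1]powR_inv1 ?(ltW t0)//.
    rewrite -powRD; last by apply/implyP => _; rewrite gt_eqF.
    by congr (_ `^ _); ring.
  rewrite [in LHS]mulry gtr0_sg// mul1e poweRyr ?gt_eqF//
    mulyr gtr0_sg ?invr_gt0// mul1e.
  by rewrite /= mulyy mulry gtr0_sg// mul1e.
have I0 : (0 <= \int[lebesgue_measure]_(t in `]0%R, +oo[)
     (((t `^ p^-1)%:E * decreasing_rearrangement m f t) `^ 2 * (t^-1)%:E))%E.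
  apply: integral_ge0 => t /=; rewrite in_itv/= andbT => t0.
  by rewrite mule_ge0 ?poweR_ge0// lee_fin invr_ge0 ltW.
by rewrite /lorentz_norm poweR12_sqrt// sqr_sqrte.
Qed.

End lorentz_norm.

(** * From balls and complex transforms to cubes and real ones *)

Section hypotheses_on_the_measure.
Context {R : realType} {n : nat}.
Local Notation E := (euclidean R n).
Local Notation leb := (lebesgue_euclidean R n).
Local Notation L1 f := (leb.-integrable setT (EFin \o f)).
Implicit Type P : probability E R.

Lemma eballE (z : E) (r : R) : 0 < r ->
  eball z r = [set x | 0 < r ^+ 2 - \sum_(i < n) (tnth z i - tnth x i) ^+ 2].
Proof.
move=> r0; apply/seteqP; split => x; rewrite /eball /= subr_gt0;
  (have S0 : 0 <= \sum_(i < n) (tnth z i - tnth x i) ^+ 2 by rewrite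
    sumr_ge0// => i _; exact: sqr_ge0);
  by rewrite -[X in X < _ ^+ 2](sqr_sqrtr S0) ltr_sqr ?nnegrE ?sqrtr_ge0// ltW.
Qed.

Lemma measurable_eball (z : E) (r : R) : 0 < r -> measurable (eball z r).
Proof.
move=> r0; rewrite eballE//; apply: measurable_set_gt0;
  apply: measurable_funB => //.
apply: measurable_sum => i; apply: measurable_funX; apply: measurable_funB =>
  //.
exact: measurable_tnth.
Qed.

(** This inclusion fixes the half-side 1/(2 n r): the squared distance is at most n times its
    square, strictly less than r^(-2), as an open ball demands. *)
Lemma cube_sub_eball (z : E) (r : R) : (0 < n)%N -> 0 < r ->
  [set x | cube n (2 * n%:R * r)^-1 (tsub z x)] `<=` eball z r^-1.
Proof.
move=> n0 r0; have ri : 0 < r^-1 by rewrite invr_gt0.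
rewrite eballE// => x /= zx; rewrite subr_gt0.
set del := (2 * n%:R * r)^-1 in zx.
have nn : 1 <= n%:R :> R by rewrite ler1n.
have e : r^-1 = 2 * n%:R * del.
  by rewrite /del; field; rewrite !gt_eqF// (lt_le_trans ltr01).
have del0 : 0 < del by rewrite invr_gt0 !mulr_gt0// (lt_le_trans ltr01).
apply: (@le_lt_trans _ _ (\sum_(i < n) del ^+ 2)).
  apply: ler_sum => i _; have := zx i; rewrite /tsub tnth_mktuple => h.
  by rewrite -real_normK ?num_real// ler_sqr// nnegrE ltW.
rewrite sumr_const card_ord -mulr_natl e exprMn ltr_pM2r ?exprn_gt0//.
by rewrite exprMn; nra.
Qed.

Lemma fourier_measureE P (x : E) : fourier_measure P x =
  ((\int[P]_xi cos (2 * pi * dotp x xi)) +i* (- \int[P]_xi sin (2 * pi * dotp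
    x xi)))%C.
Proof.
rewrite /fourier_measure /integral_complex/=; congr (_ +i* _)%C.
  by apply: eq_Rintegral => xi _; rewrite cosN dotpC.
rewrite -mulN1r -RintegralZl//; last first.
  apply: (@probability_integrable _ _ _ _ _ 1).
    exact: (measurableT_comp measurable_sin_dotp (pair1_measurable x)).
  by move=> xi; exact: sin_max.
by apply: eq_Rintegral => xi _; rewrite sinN mulN1r dotpC.
Qed.

Lemma admissible_of_hypotheses (a b A B : R) P : (0 < n)%N ->
  ball_growth a A P -> fourier_decay b B P -> admissible a b A B P.
Proof.
move=> n0 PA PB; split=> [r z r1|theta x x1].
  have r0 : 0 < r by lra.
  have ri : 0 < r^-1 by rewrite invr_gt0.
  have ri1 : r^-1 <= 1 by rewrite invf_le1.
  have := PA z r^-1 ri ri1; rewrite lee_pdivrMr ?powR_gt0//.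
  have -> : r^-1 `^ a = r `^ (- a).
    by rewrite -(powR_inv1 (ltW r0)) -powRrM mulN1r.
  move=> h; apply: le_trans h; apply: le_measure; rewrite ?inE; last first.
  - exact: cube_sub_eball.
  - exact: measurable_eball.
  rewrite (_ : [set x | _] = [set: E] `&` (fun x : E =>
    tsub z x) @^-1` cube n (2 * n%:R * r)^-1).
    have mt : measurable_fun setT (fun x : E => tsub z x).
      exact: (measurableT_comp measurable_tsub (pair1_measurable z)).
    by apply: mt => //; exact: measurable_cube.
  by rewrite setTI.
have x0 : 0 < enorm x by lra.
have := PB x x1; rewrite mulrC -ler_pdivlMr ?powR_gt0// -powRN.
apply: le_trans; rewrite fourier_measureE normcE2/= sqrrN.
set U := \int[P]_xi cos (2 * pi * dotp x xi); set V :=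
  \int[P]_xi sin (2 * pi * dotp x xi).
have -> : \int[P]_xi cos (theta + 2 * pi * dotp x xi) = cos theta * U - sin
  theta * V.
  have ic : P.-integrable setT (EFin \o (fun xi => cos (2 * pi * dotp x xi))).
    apply: (@probability_integrable _ _ _ _ _ 1); last by move=> xi;
      exact: normr_cos_le1.
    exact: (measurableT_comp measurable_cos_dotp (pair1_measurable x)).
  have isn : P.-integrable setT (EFin \o (fun xi => sin (2 * pi * dotp x xi))).
    apply: (@probability_integrable _ _ _ _ _ 1); last by move=> xi;
      exact: sin_max.
    exact: (measurableT_comp measurable_sin_dotp (pair1_measurable x)).
  rewrite -!RintegralZl// -RintegralB//.
  - by apply: eq_Rintegral => xi _; rewrite cosD.
  - exact: (integrableZl measurableT (cos theta) ic).
  - exact: (integrableZl measurableT (sin theta) isn).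
(* Lagrange's identity: the difference of the two sides is the square of sin theta U + cos theta
   V. *)
rewrite -sqrtr_sqr; apply: ler_wsqrtr; rewrite -subr_ge0.
rewrite (_ : _ - _ = (sin theta * U + cos theta * V) ^+ 2);
  first exact: sqr_ge0.
have h := cos2Dsin2 theta.
have -> : U ^+ 2 + V ^+ 2 = (cos theta ^+ 2 + sin theta ^+ 2) * (U ^+ 2 + V ^+
  2).
  by rewrite h mul1r.
ring.
Qed.

(** The real and imaginary parts of the transform mix the cosine transform of one part of [f] with
    the sine transform of the other; (p + q)^2 <= 2 (p^2 + q^2) separates them at the cost of the
    factor 2. *)
Lemma normc_fourier_sq_le (f : E -> R[i]) xi :
  L1 (fun x => complex.Re (f x)) -> L1 (fun x => complex.Im (f x)) ->
  normc (fourier f xi) ^+ 2 <=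
  2 * (cross_density (fun x => complex.Re (f x)) (fun x =>
    complex.Re (f x)) xi +
       cross_density (fun x => complex.Im (f x)) (fun x =>
         complex.Im (f x)) xi).
Proof.
set u := (fun x => complex.Re (f x)); set v := (fun x => complex.Im (f x)) =>
  iu iv.
have mc : measurable_fun setT (fun x : E => cos (2 * pi * dotp x xi)).
  exact: (measurableT_comp measurable_cos_dotp (pair2_measurable xi)).
have ms : measurable_fun setT (fun x : E => sin (2 * pi * dotp x xi)).
  exact: (measurableT_comp measurable_sin_dotp (pair2_measurable xi)).
have ic h : L1 h -> L1 (fun x => h x * cos (2 * pi * dotp x xi)).
  by move=> ih; apply: (integrable_mul_bounded (M := 1) ih mc) => *;
    exact: normr_cos_le1.
have is_ h : L1 h -> L1 (fun x => h x * sin (2 * pi * dotp x xi)).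
  by move=> ih; apply: (integrable_mul_bounded (M := 1) ih ms) => *;
    exact: sin_max.
have eR : complex.Re (fourier f xi) = cos_transform u xi + sin_transform v xi.
  rewrite /= -RintegralD//; [|exact: ic|exact: is_].
  apply: eq_Rintegral => x _; rewrite /u /v /fourier_character /expi cosN sinN.
  by case: (f x) => p q /=; ring.
have eI : complex.Im (fourier f xi) = cos_transform v xi - sin_transform u xi.
  rewrite /= -RintegralB//; [|exact: ic|exact: is_].
  apply: eq_Rintegral => x _; rewrite /u /v /fourier_character /expi cosN sinN.
  by case: (f x) => p q /=; ring.
rewrite normcE2 sqr_sqrtr ?addr_ge0 ?sqr_ge0// eR eI /cross_density.
move: (cos_transform u xi) (sin_transform u xi) (cos_transform v xi)
  (sin_transform v xi).
move=> p q r s; have := sqr_ge0 (p - s); have := sqr_ge0 (r + q); lra.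
Qed.

End hypotheses_on_the_measure.

(** * Assembling the estimate and tracking the constant *)

Section final_estimate.
Context {R : realType} {n : nat}.
Local Notation E := (euclidean R n).
Local Notation leb := (lebesgue_euclidean R n).
Local Notation C0 := (@scale_constant R n).

Lemma block_constant_ge0 (eps : R) : 0 < eps ->
  0 <= C0 * (2 + 2 * C0) * (4 / (1 - 2 `^ (- eps))).
Proof.
move=> eps0; have C1 : 0 <= C0 by exact: le_trans (@scale_constant_ge1 R n).
have h : 2 `^ (- eps) <= 1 :> R.
  by rewrite -[leRHS](powRr0 2); apply: powR2_le; rewrite oppr_le0 ltW.
have q0 : 0 <= 4 / (1 - 2 `^ (- eps)) :> R by rewrite divr_ge0// subr_ge0.
exact: (mulr_ge0 (mulr_ge0 C1 (addr_ge0 (ler0n _ 2) (mulr_ge0 (ler0n _ 2) C1)))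
  q0).
Qed.

(** 384 = 2 * (6 + 6) * 16: the separation of real and imaginary parts, [energy_weighted] for each
    of them, and the comparison of the weighted norm with the Lorentz norm. *)
Lemma restriction_estimate_eps (a b eps : R) : (0 < n)%N -> a < n%:R -> 0 < b ->
  b <= (2 * n)%:R -> 0 < eps -> eps <= 8^-1 -> eps <= b / (n%:R - a) / 4 ->
  restriction_estimate n a b
    (1 + 384 * (C0 * (2 + 2 * C0) * (4 / (1 - 2 `^ (- eps))))).
Proof.
move=> n0 an b0 bn eps0 eps8 epsb A B P A1 B1 PA PB f [mf If] [_ Lf].
set p := restriction_exponent n a b in Lf *.
set D := n%:R - a; set kap := D / (D + b).
have D0 : 0 < D by rewrite subr_gt0.
have Db0 : 0 < D + b by rewrite addr_gt0.
have p0 : 0 < p by rewrite /p /restriction_exponent -/D divr_gt0//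
  ?addr_gt0 ?mulr_gt0.
(* Here the value of the exponent enters: the power of t in the squared Lorentz norm is exactly that
   of the weight. *)
have pk : 2 / p - 1 = kap.
  rewrite /p /restriction_exponent -/D /kap; field.
  by apply/andP; split; rewrite gt_eqF// ?addr_gt0 ?mulr_gt0.
have kap0 : 0 < kap by rewrite divr_gt0.
have kap1 : kap <= 1 by rewrite ler_pdivrMr// mul1r lerDl ltW.
pose g x := normc (f x).
have mg : measurable_fun setT g := measurable_normc mf.
have g0 x : 0 <= g x by exact: normc_ge0.
have PAB := admissible_of_hypotheses n0 PA PB.
have gw := integral_sq_weight_le mg g0 If kap0 kap1
  (fun t _ => decreasing_rearrangement_ge0 leb f t)
  (fun s t s0 _ => decreasing_rearrangement_ge_tail (conj mf If) s0).
rewrite -pk -lorentz_norm_sq// pk in gw.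
set L := lorentz_norm leb p 2 f in Lf gw *.
have L0 : (0 <= L)%E by exact: poweR_ge0.
have Lfin : L \is a fin_num by rewrite ge0_fin_numE.
have gwfin : (\int[leb]_x (g x ^+ 2 * weight leb g kap x)%:E < +oo)%E.
  by apply: le_lt_trans gw _; rewrite -(fineK Lfin) -EFin_expe -EFinM ltry.
have [mu mv] := mf.
have L1le (h : E -> R) : measurable_fun setT h -> (forall x, `|h x| <= g x) ->
    leb.-integrable setT (EFin \o h).
  move=> mh hg; apply/integrableP; split; first exact/measurable_EFinP.
  apply: le_lt_trans If; apply: ge0_le_integral => //.
  - by apply/measurable_EFinP; apply: measurableT_comp.
  - exact/measurable_EFinP.
  - by move=> x _; rewrite /= lee_fin; exact: hg.
have iu := L1le _ mu (fun x => normr_Re_le (f x)).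
have iv := L1le _ mv (fun x => normr_Im_le (f x)).
have eu := energy_weighted n0 A1 B1 an b0 bn eps0 eps8 epsb mg g0 If mu
  (fun x => normr_Re_le (f x)) gwfin PAB.
have ev := energy_weighted n0 A1 B1 an b0 bn eps0 eps8 epsb mg g0 If mv
  (fun x => normr_Im_le (f x)) gwfin PAB.
set W := Rintegral _ _ _ in eu ev.
have W0 : 0 <= W.
  by apply: Rintegral_ge0 => x _; rewrite mulr_ge0 ?sqr_ge0// powR_ge0.
have WL : W <= 16 * fine L ^+ 2.
  have igw : leb.-integrable setT (EFin \o (fun x =>
    g x ^+ 2 * weight leb g kap x)).
    apply/integrableP; split.
      apply/measurable_EFinP; apply: measurable_funM;
        first exact: measurable_funX.
      exact: measurable_weight.
    apply: le_lt_trans gwfin; rewrite le_eqVlt; apply/orP; left; apply/eqP.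
    apply: eq_integral => x _; rewrite /= ger0_norm// mulr_ge0 ?sqr_ge0//.
    exact: powR_ge0.
  rewrite -lee_fin (EFin_Rintegral igw) EFinM EFin_expe (fineK Lfin); exact: gw.
have K0 := block_constant_ge0 eps0.
set c := C0 in eu ev K0 *.
set q := 4 / (1 - 2 `^ (- eps)) in eu ev K0 *.
set Lam := A `^ _ * B `^ _ in eu ev.
apply: (@le_trans _ _ (\int[P]_xi (2 *
    (cross_density (fun x => complex.Re (f x)) (fun x => complex.Re (f x)) xi +
     cross_density (fun x => complex.Im (f x)) (fun x =>
       complex.Im (f x)) xi))%:E)%E).
  apply: ge0_le_integral_nonmeasurable => xi _.
    by rewrite lee_fin sqr_ge0.
  by rewrite lee_fin; exact: normc_fourier_sq_le.
have mcu := measurable_cross_density iu iu.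
have mcv := measurable_cross_density iv iv.
under eq_integral do rewrite EFinM.
rewrite ge0_integralZl//; last 2 first.
- by apply/measurable_EFinP; exact: measurable_funD.
- by move=> xi _; rewrite lee_fin addr_ge0// cross_density_self_ge0.
under eq_integral do rewrite EFinD.
rewrite ge0_integralD//; last 4 first.
- by move=> xi _; rewrite lee_fin cross_density_self_ge0.
- exact/measurable_EFinP.
- by move=> xi _; rewrite lee_fin cross_density_self_ge0.
- exact/measurable_EFinP.
rewrite -!EFin_energy// -(fineK Lfin) -EFin_expe -!EFinM lee_fin.
have Lam0 : 0 <= Lam by rewrite mulr_ge0// powR_ge0.
rewrite -mulrA -/Lam.
move: eu ev; move: (energy P _ _) (energy P _ _) => x y.
set K := c * (2 + 2 * c) * q in K0 *.
have -> : 6 * (c * (2 + 2 * c) * Lam * q) * W = 6 * K * Lam * W by rewrite /K;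
  ring.
move=> hx hy; have KL0 : 0 <= K * Lam by exact: mulr_ge0.
have h1 : K * Lam * W <= K * Lam * (16 * fine L ^+ 2) by exact: ler_wpM2l.
(* The estimate carries the square of the constant; the added 1 makes it dominate 384 K without a
   square root. *)
have h2 : 384 * K <= (1 + 384 * K) ^+ 2.
  by rewrite sqrrD expr1n; have := sqr_ge0 (384 * K); lra.
apply: (@le_trans _ _ (384 * K * (Lam * fine L ^+ 2))); first lra.
rewrite -[leRHS]mulrA; apply: ler_wpM2r => //.
by rewrite mulr_ge0// sqr_ge0.
Qed.

End final_estimate.

Theorem theorem1p1 (R : realType) (d : nat) :
  (forall a b : R, 0 < a -> a < d%:R -> 0 < b -> b <= a / 2 ->
     exists2 C : R, 0 < C & restriction_estimate d a b C) /\
  (forall alpha beta : R, 0 < alpha -> alpha <= beta ->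
     exists2 C : R, 0 < C &
       forall a b : R, alpha <= a <= beta -> alpha <= b <= beta ->
         0 < a -> a < d%:R -> 0 < b -> b <= a / 2 ->
         restriction_estimate d a b C).
Proof.
have H2 (alpha beta : R) : 0 < alpha -> alpha <= beta ->
     exists2 C : R, 0 < C &
       forall a b : R, alpha <= a <= beta -> alpha <= b <= beta ->
         0 < a -> a < d%:R -> 0 < b -> b <= a / 2 ->
         restriction_estimate d a b C.
  (* In dimension 0 no [a] satisfies 0 < a < d. *)
  move=> al0 _; case: d => [|n]; first by exists 1 => //
    a b _ _ a0 /(lt_trans a0); rewrite ltxx.
  have n0 : 0 < n.+1%:R :> R by [].
  (* Since b >= alpha and d - a <= d, the quantity alpha / (4 d) is below b / (d - a) / 4 for all
     admissible a and b, so [eps] depends on d and [alpha] only. *)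
  pose eps : R := Num.min 8^-1 (alpha / (4 * n.+1%:R)).
  have eps0 : 0 < eps by rewrite lt_min invr_gt0 ltr0n/= divr_gt0// mulr_gt0//
    ltr0n.
  have eps8 : eps <= 8^-1 by rewrite ge_min lexx.
  exists (1 + 384 * (@scale_constant R n.+1 * (2 + 2 * @scale_constant R n.+1)
      * (4 / (1 - 2 `^ (- eps))))).
    apply: ltr_pwDl; first exact: ltr01.
    exact: mulr_ge0 (ler0n _ 384) (block_constant_ge0 eps0).
  move=> a b _ /andP[alb _] a0 an b0 ba; apply: restriction_estimate_eps => //.
    have -> : (2 * n.+1)%:R = 2 * n.+1%:R :> R by rewrite natrM.
    lra.
  apply: (@le_trans _ _ (alpha / (4 * n.+1%:R)));
    first by rewrite ge_min lexx orbT.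
  have D0 : 0 < n.+1%:R - a by rewrite subr_gt0.
  have e (N D : R) : b / D / 4 * (4 * N) = b * N / D.
    by rewrite mulrA mulfVK// mulrAC.
  rewrite ler_pdivrMr ?mulr_gt0// e ler_pdivlMr//; apply: ler_pM => //;
    first exact: ltW.
    exact: ltW.
  by rewrite gerBl ltW.
split=> // a b a0 an b0 ba; have ab : b <= a by lra.
(* The pointwise claim is the uniform one on the interval [b, a]. *)
have [C C0 HC] := H2 b a b0 ab.
by exists C => //; apply: HC => //; rewrite ab lexx.
Qed.
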